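(* Let $D\subset\mathbb R^d$, $d\in\{2,3\}$, be a bounded Lipschitz domain and let $\mathcal S\colon L^\infty_+(D)\times L^2(D)\to H_0^1(D)$ be the solution operator of the elliptic diffusion problem. Let $p\ge1$, $r_m<\infty$, $\sigma_{\max}<\infty$, $k_{\max}\in\mathbb N_0$, $\rho_{\min}>0$, and set $$\mathcal M:=\{m\in C(D)\colon\|m\|_{C(D)}\le r_m\},\qquad\mathcal C:=\{c_{\sigma^2,\rho,k+\frac12}\colon\sigma\le\sigma_{\max},\ \rho\ge\rho_{\min},\ k\in\{0,\dots,k_{\max}\}\}.$$ Let $r_f<\infty$. Then there exists a constant $C<\infty$ such that $$d_p(\mathcal S_*P,\mathcal S_*Q)\le C\,d_{2p}(P,Q)$$ for all product measures $P=P_a\otimes P_f$, $Q=Q_a\otimes Q_f$ on $L^\infty_+(D)\times L^2(D)$ with $$\log_*P_a,\ \log_*Q_a\in\{\mathcal N(m,c)\colon m\in\mathcal M,\ c\in\mathcal C\}$$ and $$\int\|f\|_{L^2(D)}^{2p}\,P_f(df)\le r_f,\qquad\int\|f\|_{L^2(D)}^{2p}\,Q_f(df)\le r_f.$$ Here the Wasserstein distances are those derived from the metric induced by $\|\cdot\|_{H_0^1(D)}$ on $H_0^1(D)$ and from either of the two metrics $$\|\log a_1-\log a_2\|_{L^\infty(D)}+\|f_1-f_2\|_{L^2(D)}\qquad\text{or}\qquad\|a_1-a_2\|_{L^\infty(D)}+\|f_1-f_2\|_{L^2(D)}$$ between $(a_1,f_1)$ and $(a_2,f_2)$ on $L^\infty_+(D)\times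 L^2(D)$.
   Context: $L^\infty_+(D):=\{a\in L^\infty(D)\colon\operatorname{ess\,inf}a>0\}$. For $(a,f)\in L^\infty_+(D)\times L^2(D)$, $\mathcal S(a,f)$ is the unique $u\in H_0^1(D)$ with $(a\nabla u,\nabla v)_{L^2(D)}=(f,v)_{L^2(D)}$ for all $v\in H_0^1(D)$. $C(D)$ is the space of continuous functions on (the closure of) $D$ with the supremum norm. $\mathcal N(m,c)$ is the Gaussian measure on $C(D)$ which is the law of the pathwise continuous Gaussian random field with mean function $m$ and covariance function $c$; $\log_*P_a$ is the pushforward of $P_a$ under $a\mapsto\log a$ (so $a$ is a lognormal random field). For $\sigma,\rho>0$, $k\in\mathbb N_0$: $$c_{\sigma^2,\rho,k+\frac12}(x,y)=\sigma^2\frac{k!}{(2k)!}\sum_{i=0}^k\frac{(k+i)!}{i!\,(k-i)!}\Big(\frac{2\sqrt{2k+1}}{\rho}|x-y|\Big)^{k-i}\exp\Big(-\frac{\sqrt{2k+1}}{\rho}|x-y|\Big).$$ On a metric space $(\mathcal X,d)$, $d_q(P,Q)=\inf_\pi(\iint d(x,y)^q\,\pi(dx,dy))^{1/q}$, the infimum over all Borel probability measures $\pi$ on $\mathcal X\times\mathcal X$ with marginals $P$ and $Q$; $\mathcal S_*P=P\circ\mathcal S^{-1}$. *)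

(* Defs.v *)
From HB Require Import structures.
From mathcomp Require Import all_boot all_order all_algebra.
From mathcomp Require Import all_classical all_reals all_analysis.
From mathcomp Require Import ess_sup_inf measurable_realfun.
Set Implicit Arguments. Unset Strict Implicit. Unset Printing Implicit Defensive.
Import Order.TTheory GRing.Theory Num.Theory.
Import numFieldNormedType.Exports.
Local Open Scope classical_set_scope.
Local Open Scope ring_scope.

Section tuple_measure.
Context dd (T : measurableType dd) (R : realType).
Variable m1 : {sigma_finite_measure set T -> \bar R}.
Local Open Scope ereal_scope.

Definition tuple_cons n (z : T * n.-tuple T) : n.+1.-tuple T :=
  [the n.+1.-tuple T of z.1 :: z.2].

Lemma measurable_tuple_cons n : measurable_fun [set: _] (@tuple_cons n).
Proof. exact: measurable_cons. Qed.

HB.instance Definition _ n :=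
  isMeasurableFun.Build _ _ _ _ (@tuple_cons n) (@measurable_tuple_cons n).

Section step.
Variables (n : nat) (m : {sigma_finite_measure set (n.-tuple T) -> \bar R}).

Definition cons_measure := pushforward (m1 \x m) (@tuple_cons n).

Let cons_measure0 : cons_measure set0 = 0%E.
Proof. exact: measure0. Qed.

Let cons_measure_ge0 A : (0 <= cons_measure A)%E.
Proof. exact: measure_ge0. Qed.

Let cons_measure_sigma_additive : semi_sigma_additive cons_measure.
Proof. exact: measure_semi_sigma_additive. Qed.

HB.instance Definition _ := isMeasure.Build _ _ _ cons_measure
  cons_measure0 cons_measure_ge0 cons_measure_sigma_additive.

Let cons_measure_sigma_finite : sigma_finite setT cons_measure.
Proof.
have /sigma_finiteP[F [TF ndF Foo]] := sigma_finiteT m1.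
have /sigma_finiteP[G [TG ndG Goo]] := sigma_finiteT m.
exists (fun k => [set t | F k (thead t) /\ G k [tuple of behead t]]).
  apply/seteqP; split => // t _.
  have [i _ Fi] : (\bigcup_i F i) (thead t) by rewrite -TF.
  have [j _ Gj] : (\bigcup_i G i) [tuple of behead t] by rewrite -TG.
  exists (maxn i j) => //; split.
  - by move: Fi; exact/subsetPset/ndF/leq_maxl.
  - by move: Gj; exact/subsetPset/ndG/leq_maxr.
move=> k; have [mF Fk] := Foo k; have [mG Gk] := Goo k; split.
  apply: measurableI; rewrite -[X in measurable X]setTI.
    by apply: (@measurable_tnth _ T n.+1 ord0).
  exact: (@measurable_behead _ T n).
rewrite /cons_measure /pushforward (_ : _ @^-1` _ = F k `*` G k).
  by rewrite product_measure1E// lte_mul_pinfty// ge0_fin_numE.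
by apply/seteqP; split=> -[x t]/=; rewrite theadE (_ : [tuple of _] = t)//;
  exact: val_inj.
Qed.

HB.instance Definition _ :=
  Measure_isSigmaFinite.Build _ _ _ cons_measure cons_measure_sigma_finite.
End step.

(* n-fold product of m1 *)
Fixpoint tuple_measure n : {sigma_finite_measure set (n.-tuple T) -> \bar R} :=
  match n with
  | 0 => @dirac _ _ ([tuple] : 0.-tuple T) R
  | n'.+1 => cons_measure (tuple_measure n')
  end.
Lemma tuple_measureE n (A : 'I_n -> set T) : (forall i, measurable (A i)) ->
  tuple_measure n [set t | forall i, A i (tnth t i)] = \prod_(i < n) m1 (A i).
Proof.
elim: n A => [|n ih] A mA /=.
  by rewrite big_ord0 /dirac/= indicE mem_set//= => -[].
rewrite /cons_measure /pushforward big_ord_recl.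
rewrite (_ : _ @^-1` _ = A ord0 `*`
    [set t : n.-tuple T | forall i, A (lift ord0 i) (tnth t i)]); last first.
  apply/seteqP; split=> [[x t]/= h|[x t]/= [h0 h] i].
    split=> [|i]; first by have := h ord0; rewrite tnth0.
    by have := h (lift ord0 i); rewrite tnthS.
  by case: (unliftP ord0 i) => [j|] ->; rewrite ?tnthS ?tnth0.
rewrite product_measure1E//.
  by congr (_ * _); exact: (ih (fun i => A (lift ord0 i))).
rewrite (_ : mkset _ = \bigcap_(i in [set: 'I_n])
   (fun t : n.-tuple T => tnth t i) @^-1` (A (lift ord0 i))); last first.
  by apply/seteqP; split=> t h i //=; exact: h.
apply: fin_bigcap_measurable => // i _.
by rewrite -[X in measurable X]setTI; exact: measurable_tnth.
Qed.
End tuple_measure.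

Notation borel_rV R d := (g_sigma_algebraType (@open 'rV[R]_d)).

Section lebesgue_rV.
Variables (R : realType) (d : nat).

Definition rV_of_tuple (t : d.-tuple (measurableTypeR R)) : borel_rV R d :=
  \row_i tnth t i.

Lemma measurable_rV_of_tuple : measurable_fun [set: _] rV_of_tuple.
Proof.
apply: (@measurability _ _ _ _ setT rV_of_tuple (@open 'rV[R]_d)) => //.
move=> _ [U oU <-]; rewrite setTI.
pose box (c : 'rV[rat]_d * rat) : set 'rV[R]_d :=
  [set v | forall i, `|ratr (c.1 ord0 i) - v ord0 i| < ratr c.2].
have UE : U = \bigcup_(c in [set c | box c `<=` U]) box c.
  apply/seteqP; split=> [v Uv|v [c cU]]; last exact: cU.
  have /nbhs_ballP[e /= e0 beU] : nbhs v U by exact: open_nbhs_nbhs.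
  have [q [q0 qe]] : exists q : rat, (0 : R) < ratr q /\ ratr q < e / 2.
    have [q] := rat_in_itvoo (divr_gt0 e0 (ltr0n _ 2)).
    by rewrite in_itv/= => /andP[? ?]; exists q.
  have /choice[c cP] : forall i, exists c : rat, `|ratr c - v ord0 i| < ratr q.
    move=> i.
    have vq : v ord0 i - ratr q < v ord0 i + ratr q.
      by rewrite ltrBlDr -addrA ltrDl addr_gt0.
    have [c] := rat_in_itvoo vq.
    by rewrite in_itv/= => h; exists c; rewrite ltr_distl.
  exists (\row_i c i, q) => [w /= wP|i /=]; last by rewrite mxE; exact: cP.
  apply: beU; split => // i j; rewrite (ord1 i) /ball/=.
  have := wP j; rewrite mxE => h.
  rewrite -[X in `|X|](subrKA (ratr (c j))) (le_lt_trans (ler_normD _ _))//.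
  by rewrite [e]splitr ltrD// ?(lt_trans h)// distrC (lt_trans (cP j)).
rewrite UE preimage_bigcup; rewrite bigcup_mkcond.
apply: countable_bigcupT_measurable => // c; case: ifP => // _.
rewrite (_ : _ @^-1` _ = \bigcap_(i in [set: 'I_d])
   (fun t : d.-tuple (measurableTypeR R) => tnth t i) @^-1` (ball (ratr (c.1 ord0 i) : R) (ratr c.2))); last first.
  apply/seteqP; split => [t h i _|t h i] /=.
    by have := h i; rewrite mxE.
  by rewrite mxE; exact: h.
apply: fin_bigcap_measurable => // i _.
rewrite -[X in measurable X]setTI; apply: measurable_tnth => //.
by rewrite ball_itv.
Qed.

HB.instance Definition _ :=
  isMeasurableFun.Build _ _ _ _ rV_of_tuple measurable_rV_of_tuple.

(* Lebesgue measure on the Borel sets of R^d, transported from tuples of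
   coordinates; lebesgue_rVE gives its value on boxes. *)
Definition lebesgue_rV : set (borel_rV R d) -> \bar R :=
  pushforward (tuple_measure (@lebesgue_measure R) d) rV_of_tuple.

Let lebesgue_rV0 : lebesgue_rV set0 = 0%E.
Proof. exact: measure0. Qed.

Let lebesgue_rV_ge0 A : (0 <= lebesgue_rV A)%E.
Proof. exact: measure_ge0. Qed.

Let lebesgue_rV_sigma_additive : semi_sigma_additive lebesgue_rV.
Proof. exact: measure_semi_sigma_additive. Qed.

HB.instance Definition _ := isMeasure.Build _ _ _ lebesgue_rV
  lebesgue_rV0 lebesgue_rV_ge0 lebesgue_rV_sigma_additive.

Lemma lebesgue_rVE (A : 'I_d -> set (measurableTypeR R)) :
  (forall i, measurable (A i)) ->
  lebesgue_rV [set v | forall i, A i (v ord0 i)] =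
  (\prod_(i < d) lebesgue_measure (A i))%E.
Proof.
move=> mA; rewrite -(tuple_measureE _ mA) /lebesgue_rV /pushforward.
by congr (tuple_measure _ _ _); apply/seteqP; split=> t h i; have := h i;
  rewrite /= mxE.
Qed.
End lebesgue_rV.

Section Lspace_of.
Local Open Scope quotient_scope.
Context dd (T : measurableType dd) (R : realType).
Variables (mu : {measure set T -> \bar R}) (p : \bar R) (p1 : (1 <= p)%E).

Lemma ae_eq_Lnorm (f g : T -> R) :
  measurable_fun [set: T] f -> measurable_fun [set: T] g ->
  f = g %[ae mu] -> 'N[mu]_p[EFin \o f]%E = 'N[mu]_p[EFin \o g]%E.
Proof.
move=> mf mg fg; rewrite unlock; case: p p1 => [r r1| _|//]; last first.
  case: ifP => // _; apply: eq_ess_sup.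
  by apply: filterS fg => x /= ->.
congr (_ `^ _)%E; apply: ge0_ae_eq_integral => //.
- apply/measurable_EFinP. 
  apply: (measurableT_comp (measurable_powR _)) => //.
  exact: measurableT_comp.
- apply/measurable_EFinP.
  apply: (measurableT_comp (measurable_powR _)) => //.
  exact: measurableT_comp.
- by move=> x _; exact: poweR_ge0.
- by move=> x _; exact: poweR_ge0.
- by apply: filterS fg => x /= /[apply] ->.
Qed.

Section class_of.
Variable f : LfunType mu p1.

(* Lspaces are built over the copy [measurableTypeR R] of [R] *)
Let fR : T -> measurableTypeR R := f.

Let measurable_fR : measurable_fun [set: T] fR.
Proof. exact: (@measurable_funPT _ _ _ _ f). Qed.

HB.instance Definition _ :=
  isMeasurableFun.Build _ _ T (measurableTypeR R) fR measurable_fR.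

Definition Lclass : {mfun_ mu, T >-> measurableTypeR R} :=
  \pi_({mfun_ mu, T >-> measurableTypeR R})
    [the {mfun T >-> measurableTypeR R} of fR].

Lemma LclassE : f = (Lclass : T -> R) %[ae mu].
Proof.
have /eqmodP/asboolP : [the {mfun T >-> measurableTypeR R} of fR] = repr Lclass
  %[mod {mfun_ mu, T >-> measurableTypeR R}] by rewrite reprK.
by [].
Qed.

Let Lclass_finite : finite_norm mu p Lclass.
Proof.
rewrite /finite_norm -(ae_eq_Lnorm _ _ LclassE)//.
  exact: Lfunction_finite.
exact: (@measurable_funPT _ _ _ (measurableTypeR R) (repr Lclass)).
Qed.

HB.instance Definition _ := @isFinLebesgue.Build _ _ _ _ _ p1 Lclass Lclass_finite.
End class_of.

(* The class of f in L^p, with the junk value 0 when f is not in L^p *)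
Definition Lspace_of (f : T -> R) : LspaceType mu p1 :=
  match pselect (f \in Lfun mu p) with
  | left fL => Lclass (Lfun_Sub p1 fL)
  | right _ => Lclass (cst 0)
  end.

HB.instance Definition _ := gen_eqMixin (LspaceType mu p1).
HB.instance Definition _ := gen_choiceMixin (LspaceType mu p1).
HB.instance Definition _ := isPointed.Build (LspaceType mu p1) (Lspace_of (cst 0)).

End Lspace_of.

Section borel_of_distance.
Variable R : realType.

(* open sets of the metric [dist]; [borelType dist] below carries the Borel
   sigma-algebra they generate *)
Definition dist_open (T : Type) (dist : T -> T -> R) : set (set T) :=
  [set U | forall x, U x -> exists2 e, 0 < e & [set y | dist x y < e] `<=` U].

Definition sum_dist (S T : Type) (dS : S -> S -> R) (dT : T -> T -> R)
  (z w : S * T) : R := dS z.1 w.1 + dT z.2 w.2.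

End borel_of_distance.

Notation borelType dist := (g_sigma_algebraType (dist_open dist)).

Section wasserstein.
Context (R : realType) (T : pointedType) (dist : T -> T -> R).

(* [sum_dist dist dist] induces the product topology on [T * T] *)
Definition coupling (P Q : set (borelType dist) -> \bar R) :
    set (probability (borelType (sum_dist dist dist)) R) :=
  [set pi | forall A : set (borelType dist), measurable A ->
    pi (A `*` [set: T]) = P A /\ pi ([set: T] `*` A) = Q A].

Definition wasserstein (q : R) (P Q : set (borelType dist) -> \bar R) : \bar R :=
  ereal_inf [set ((\int[pi]_z (dist z.1 z.2 `^ q)%:E) `^ q^-1)%E
            | pi in coupling P Q].

End wasserstein.

Section euclidean.
Variable R : realType.

(* the library norm on ['rV[R]_d] is the maximum norm *)
Definition eucl_norm d (x : 'rV[R]_d) : R := Num.sqrt (\sum_i x ord0 i ^+ 2).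

(* Near every boundary point [D] is, up to an orthogonal change of coordinates,
   the strict epigraph of a Lipschitz function. *)
Definition lipschitz_boundary d (D : set 'rV[R]_d) : Prop :=
  forall x, closure D x -> ~ D x ->
  exists (i : 'I_d) (A : 'M[R]_d) (g : 'rV[R]_d.-1 -> R) (L r : R),
  [/\ A *m A^T = 1%:M,
      forall y z, `|g y - g z| <= L * eucl_norm (y - z),
      0 < r &
      forall y, eucl_norm (y - x) < r ->
        (D y <-> g (col' i (y *m A)) < (y *m A) ord0 i)].

Record bounded_lipschitz_domain d := BoundedLipschitzDomain {
  domain_set :> set 'rV[R]_d ;
  domain_open : open domain_set ;
  domain_connected : connected domain_set ;
  domain_nonempty : domain_set !=set0 ;
  domain_bounded : bounded_set domain_set ;
  domain_lipschitz : lipschitz_boundary domain_set }.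

(* s2 is the variance, rho the correlation length, k + 1/2 the smoothness *)
Definition matern (s2 rho : R) (k : nat) d (x y : 'rV[R]_d) : R :=
  s2 * (k`!%:R / (2 * k)`!%:R) *
  (\sum_(i < k.+1) (k + i)`!%:R / (i`!%:R * (k - i)`!%:R) *
     (2 * Num.sqrt (2 * k + 1)%:R / rho * eucl_norm (x - y)) ^+ (k - i)) *
  expR (- (Num.sqrt (2 * k + 1)%:R / rho * eucl_norm (x - y))).

Definition matern_class (s_max rho_min : R) (k_max d : nat) :
    set ('rV[R]_d -> 'rV[R]_d -> R) :=
  [set c | exists s rho k, [/\ 0 < s <= s_max, rho_min <= rho, (k <= k_max)%N &
           c = @matern (s ^+ 2) rho k d]].

Definition partial d (i : 'I_d) (f : 'rV[R]_d -> R) : 'rV[R]_d -> R :=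
  fun x => 'D_(delta_mx ord0 i) f x.

Definition smooth d (f : 'rV[R]_d -> R) : Prop :=
  forall s : seq 'I_d, let g := foldr (@partial d) f s in
  continuous g /\ forall i x, derivable g x (delta_mx ord0 i).

Definition test_function d (D : set 'rV[R]_d) : set ('rV[R]_d -> R) :=
  [set f | let K := closure [set x | f x != 0] in
           [/\ smooth f, compact K & K `<=` D]].

End euclidean.

Section domain_spaces.
Context (R : realType) (d : nat) (D : bounded_lipschitz_domain R d).

Lemma measurable_domain : measurable (D : set (borel_rV R d)).
Proof. by apply: sub_sigma_algebra; exact: domain_open. Qed.

Definition lebesgue_domain : {measure set (borel_rV R d) -> \bar R} :=
  mrestr (lebesgue_rV (d:=d)) measurable_domain.

Local Notation mu := lebesgue_domain.

Definition L2 := LspaceType2 mu.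
Definition Linf := LspaceType mu (leey 1%E).
HB.instance Definition _ := Pointed.on L2.
HB.instance Definition _ := Pointed.on Linf.

(* norms of functions D -> R, through arbitrary extensions to R^d *)
Definition L2_norm (f : borel_rV R d -> R) : R := fine ('N[mu]_2[EFin \o f]%E).
Definition Linf_norm (f : borel_rV R d -> R) : R :=
  fine ('N[mu]_+oo[EFin \o f]%E).

Definition L2_dist (f g : L2) : R := L2_norm (fun x => f x - g x).
Definition Linf_dist (f g : Linf) : R := Linf_norm (fun x => f x - g x).

(* L^oo_+(D) *)
Record Linfp := MkLinfp {
  Linfp_val :> LspaceType mu (leey 1%E) ;
  Linfp_gt0 : (0 < ess_inf mu (EFin \o Linfp_val))%E }.

Definition Linfp_dist (a b : Linfp) : R := Linf_norm (fun x => a x - b x).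
Definition Linfp_logdist (a b : Linfp) : R :=
  Linf_norm (fun x => ln (a x) - ln (b x)).

Definition Linfp_ln (a : Linfp) : Linf := Lspace_of mu (leey 1%E) (fun x => ln (a x)).

HB.instance Definition _ := gen_eqMixin Linfp.
HB.instance Definition _ := gen_choiceMixin Linfp.

Lemma cst_Linf (c : R) : cst c \in Lfun mu +oo%E.
Proof.
apply/andP; split; rewrite inE//= /finite_norm unlock.
case: ifP => // _; apply: (@le_lt_trans _ _ `|c|%:E); last exact: ltry.
by apply/ess_supP; exact: nearW.
Qed.

Lemma Linf_one_gt0 :
  (0 < ess_inf mu (EFin \o Lspace_of mu (leey 1) (fun=> 1%R)))%E.
Proof.
apply: (@lt_le_trans _ _ 1%E) => //; apply/ess_infP.
rewrite /Lspace_of; case: pselect => [f1|]; last by rewrite cst_Linf.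
by apply: filterS (LclassE (Lfun_Sub (leey 1%E) f1)) => x /= <-.
Qed.

HB.instance Definition _ := isPointed.Build Linfp (MkLinfp Linf_one_gt0).

Definition weak_partial (i : 'I_d) (u g : L2) : Prop :=
  forall phi, test_function D phi ->
  \int[mu]_x (u x * partial i phi x) = - \int[mu]_x (g x * phi x).

(* An element of H^1_0(D), the closure of the test functions in H^1(D),
   packed with its weak gradient (unique in L^2(D)^d). H10_dist is the distance
   of the H^1(D) norm. *)
Record H10 := MkH10 {
  H10_val :> LspaceType mu (lee1n 2) ;
  H10_grad : 'I_d -> L2 ;
  H10_weak : forall i, weak_partial i H10_val (H10_grad i) ;
  H10_approx : forall e, 0 < e -> exists2 phi, test_function D phi &
    L2_norm (fun x => H10_val x - phi x) ^+ 2 +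
    \sum_i L2_norm (fun x => H10_grad i x - partial i phi x) ^+ 2 < e ^+ 2 }.

Definition H10_dist (u v : H10) : R :=
  Num.sqrt (L2_norm (fun x => u x - v x) ^+ 2 +
    \sum_i L2_norm (fun x => H10_grad u i x - H10_grad v i x) ^+ 2).

HB.instance Definition _ := gen_eqMixin H10.
HB.instance Definition _ := gen_choiceMixin H10.

Lemma continuous_measurable_rV (f : 'rV[R]_d -> R) :
  continuous f -> measurable_fun [set: borel_rV R d] f.
Proof.
move=> /continuousP cf.
apply: (measurability _ (RGenOpens.measurableE R)) => _ [_ [x [e ->]] <-].
rewrite setTI; apply: sub_sigma_algebra; apply: cf.
exact: interval_open.
Qed.

Lemma L2_point_ae0 : ((point : L2) : borel_rV R d -> R) = (fun=> 0) %[ae mu].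
Proof.
rewrite /point/= /Lspace_of; case: pselect => [f0|f0].
  by apply: filterS (LclassE (Lfun_Sub (lee1n 2) f0)) => x /= /[apply].
by apply: filterS (LclassE (cst 0 : LfunType mu (lee1n 2))) => x /= /[apply].
Qed.

Lemma measurable_L2 (u : L2) : measurable_fun [set: borel_rV R d] (u : _ -> R).
Proof. 
exact: (@measurable_funPT _ _ _ (measurableTypeR R)
  (repr (u : {mfun_ mu, borel_rV R d >-> measurableTypeR R}))).
Qed.

Lemma partial_cst0 (i : 'I_d) : partial i (cst 0) = cst (0 : R).
Proof. by apply/funext => x; rewrite /partial derive_cst. Qed.

Lemma test_function_cst0 : test_function D (cst 0).
Proof.
have -> : test_function D (cst 0) =
    [/\ smooth (cst 0 : 'rV[R]_d -> R), compact (@set0 'rV[R]_d) & set0 `<=` (D : set 'rV[R]_d)].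
  rewrite /test_function/= (_ : [set x | _] = set0) ?closure0//.
  by apply/seteqP; split=> x //=; rewrite eqxx.
split=> //; last exact: compact0.
move=> s; have -> : foldr (@partial R d) (cst 0) s = cst 0.
  by elim: s => //= i s ->; exact: partial_cst0.
by split=> [x|i x]; [exact: cst_continuous|exact: derivable_cst].
Qed.

Lemma Rintegral_point0 (h : 'rV[R]_d -> R) :
  continuous h -> \int[mu]_x ((point : L2) x * h x) = 0.
Proof.
move=> ch; rewrite /Rintegral.
rewrite (@ae_eq_integral _ _ _ mu setT (fun=> 0%E)) ?integral0//.
- apply/measurable_EFinP; apply: measurable_funM; first exact: measurable_L2.
  exact: continuous_measurable_rV.
- by apply: filterS L2_point_ae0 => x /= /[apply] ->; rewrite mul0r.
Qed.

Lemma H10_zero_weak i : weak_partial i point point.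
Proof.
move=> phi [sphi _ _]; rewrite !Rintegral_point0 ?oppr0//.
- exact: (sphi [::]).1.
- exact: (sphi [:: i]).1.
Qed.

Lemma L2_norm_point0 : L2_norm (fun x => (point : L2) x - 0) = 0.
Proof.
rewrite /L2_norm (@ae_eq_Lnorm _ _ _ mu 2%:E (lee1n 2) _ (fun=> 0)).
- by rewrite (_ : EFin \o _ = cst 0%E)// Lnorm0.
- by apply: measurable_funB => //; exact: measurable_L2.
- by [].
- by apply: filterS L2_point_ae0 => x /= /[apply] ->; rewrite subr0.
Qed.

Lemma H10_zero_approx e : 0 < e -> exists2 phi, test_function D phi &
    L2_norm (fun x => (point : L2) x - phi x) ^+ 2 +
    \sum_(i < d) L2_norm (fun x => (point : L2) x - partial i phi x) ^+ 2 < e ^+ 2.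
Proof.
move=> e0; exists (cst 0); first exact: test_function_cst0.
under eq_bigr do rewrite partial_cst0 L2_norm_point0 expr0n.
by rewrite L2_norm_point0 expr0n big1// addr0 exprn_gt0.
Qed.

HB.instance Definition _ :=
  isPointed.Build H10 (MkH10 H10_zero_weak H10_zero_approx).

Definition weak_solution (a : Linfp) (f : L2) : set H10 :=
  [set u | forall v : H10,
    \int[mu]_x (a x * \sum_i H10_grad u i x * H10_grad v i x) =
    \int[mu]_x (f x * v x)].

(* the choice made by [get] is immaterial, as weak solutions are unique *)
Definition solution_operator (z : Linfp * L2) : H10 :=
  get (weak_solution z.1 z.2).

(* C(D), the continuous functions on the closure of D *)
Definition CD := continuousType (closure D) R.
HB.instance Definition _ := Choice.on CD.

Definition sup_norm (f : closure D -> R) : R := sup (range (fun x => `|f x|)).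
Definition CD_dist (f g : CD) : R := sup_norm (fun x => f x - g x).

HB.instance Definition _ := isPointed.Build CD
  [the continuousType (closure D) R of
   mkcts (fun x : closure D => @cst_continuous (closure D) R 0 x)].

Definition mean_class (r_m : R) : set CD := [set m | sup_norm m <= r_m].

(* N(m, v) on R; the case v = 0 is apart since [normal_prob m 0] is not the
   Dirac measure at m. *)
Definition gaussian1 (m v : R) : set R -> \bar R :=
  if v == 0 then \d_m else normal_prob m (Num.sqrt v).

(* nu is N(m, c): under nu the coordinate process f |-> f x, x in closure D, is
   a Gaussian random field with mean function m and covariance function c. *)
Definition is_gaussian (m : CD) (c : 'rV[R]_d -> 'rV[R]_d -> R)
    (nu : probability (borelType CD_dist) R) : Prop :=
  forall (n : nat) (x : 'I_n -> closure D) (t : 'I_n -> R) (B : set R),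
  measurable B ->
  nu [set f : CD | B (\sum_i t i * f (x i))] =
  gaussian1 (\sum_i t i * m (x i))
            (\sum_i \sum_j t i * t j * c (set_val (x i)) (set_val (x j))) B.

(* the embedding of C(D) into L^oo(D) *)
Definition CD_Linf (f : CD) : Linf := Lspace_of mu (leey 1%E) ('valL_ 0 f).

(* log_* Pa = N(m, c) for some m in M, c in K, both sides as measures on the
   Borel sets of L^oo(D) *)
Definition lognormal (M : set CD) (K : set ('rV[R]_d -> 'rV[R]_d -> R))
    (Pa : set Linfp -> \bar R) : Prop :=
  exists m c (nu : probability (borelType CD_dist) R),
  [/\ M m, K c, is_gaussian m c nu &
      forall B : set (borelType Linf_dist), measurable B ->
        Pa (Linfp_ln @^-1` B) = nu (CD_Linf @^-1` B)].

End domain_spaces.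

Definition is_product (R : realType) (S T : pointedType) (dS : S -> S -> R)
    (dT : T -> T -> R) (P : probability (borelType (sum_dist dS dT)) R)
    (PS : probability (borelType dS) R) (PT : probability (borelType dT) R) :=
  forall (A : set (borelType dS)) (B : set (borelType dT)),
  measurable A -> measurable B -> P (A `*` B) = (PS A * PT B)%E.

(* Main.v *)
Require Import Defs.
From HB Require Import structures.
From mathcomp Require Import all_boot all_order all_algebra.
From mathcomp Require Import all_classical all_reals all_analysis.
From mathcomp Require Import ess_sup_inf measurable_realfun ring lra.
Set Implicit Arguments.
Unset Strict Implicit.
Unset Printing Implicit Defensive.
Import Order.TTheory GRing.Theory Num.Theory.
Import numFieldNormedType.Exports.
Local Open Scope classical_set_scope.
Local Open Scope ring_scope.

(** The proof compares a coupling of [P] and [Q] with its image under the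
    solution operator [S], which couples the two pushforwards. What remains is a
    local Lipschitz estimate for [S] whose constant has finite moments, followed
    by the Cauchy-Schwarz inequality along the coupling: this is where the
    exponent [p] on the left becomes [2p] on the right
    ([wasserstein_weighted_lipschitz]).

    The size of a coefficient is measured by [lognorm a], the supremum norm of
    [ln a], whose exponential bounds both [a] and [1 / a]. Weak solutions exist
    by Riesz' theorem for the energy inner product ([energy_solution]), where
    Poincare's inequality is obtained by testing with coordinate multiples of
    test functions. Testing the equations with solutions and their differences
    gives the a priori and the stability estimates ([solution_stability]). The
    latter involves [exp (lognorm a1) * exp (lognorm a2) * |f2|], a product over
    both arguments of the coupling. It is turned into a sum of [weight]s, each of
    which depends on one argument only ([solution_lipschitz]): if [a1] and [a2]
    are close on the scale [exp (- lognorm a2)], then [lognorm a1] is at most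
    [lognorm a2 + 1], and symmetrically; if they are close on neither scale, the
    a priori estimates are enough. The argument is the same for the logarithmic
    and the linear metric on the coefficients.

    The weight is [exp (3 lognorm a) * (1 + |f|)]. Its [2p]-th moment is an
    integral with respect to one marginal, [P] or [Q], of the coupling, hence
    factorises because these are product measures ([weight_moment]). The factor
    of [f] is bounded by assumption. The factor of [a] is an exponential moment
    of the supremum of a Gaussian field and has to be bounded uniformly over the
    class of means and covariances ([lognormal_moment]). Matern covariances
    satisfy [0 <= s^2 - c(x, y) <= s^2 sqrt(2k+1) / rho * |x - y|], by comparing
    their polynomial factor with the exponential series ([matern_bounds]), so
    that increments of the field over a dyadic mesh have geometrically decaying
    variances, uniformly in the class. The exponential moment then follows by
    chaining ([sup_moment]): Jensen's inequality distributes the exponential of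
    the sum of the increments over the levels of the mesh, and the exponential
    moments of the Gaussian increments are explicit. *)

(** * Quadratic functionals on inner product spaces *)

Section quadratic.
Context {R : realType}.

Lemma discriminant_le (a b c : R) : 0 <= c ->
  (forall t, 0 <= a + 2 * t * b + t ^+ 2 * c) -> b ^+ 2 <= a * c.
Proof.
rewrite le_eqVlt => /predU1P[<-|c0] h.
  have [->|bn0] := eqVneq b 0; first by rewrite expr0n mulr0.
  have := h (- (1 + a) / (2 * b)).
  have -> : 2 * (- (1 + a) / (2 * b)) * b = - (1 + a) by field; exact: bn0.
  lra.
have := h (- b / c).
have -> : a + 2 * (- b / c) * b + (- b / c) ^+ 2 * c = (a * c - b ^+ 2) / c.
  by field; rewrite gt_eqF.
by rewrite pmulr_lge0 ?invr_gt0// subr_ge0.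
Qed.

Variables (V : lmodType R) (H : set V) (B : V -> V -> R).
Hypothesis HZD : forall a u v, H u -> H v -> H (a *: u + v).
Hypothesis BC : forall u v, H u -> H v -> B u v = B v u.
Hypothesis BZD : forall a u v w, H u -> H v -> H w ->
  B (a *: u + v) w = a * B u w + B v w.
Hypothesis B_ge0 : forall u, H u -> 0 <= B u u.

Lemma form_expand t u v : H u -> H v ->
  B (t *: u + v) (t *: u + v) = B v v + 2 * t * B u v + t ^+ 2 * B u u.
Proof.
move=> Hu Hv; have Hw := HZD t Hu Hv.
rewrite BZD// (BC Hu Hw) (BC Hv Hw) !BZD// (BC Hv Hu); ring.
Qed.

Lemma form_CauchySchwarz u v : H u -> H v -> B u v ^+ 2 <= B u u * B v v.
Proof.
move=> Hu Hv; rewrite mulrC; apply: discriminant_le; first exact: B_ge0.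
by move=> t; rewrite -form_expand//; exact/B_ge0/HZD.
Qed.

Lemma form_triangle u v : H u -> H v ->
  Num.sqrt (B (u + v) (u + v)) <= Num.sqrt (B u u) + Num.sqrt (B v v).
Proof.
move=> Hu Hv; have := form_expand 1 Hu Hv; rewrite scale1r => ->.
have x0 := sqrtr_ge0 (B u u); have y0 := sqrtr_ge0 (B v v).
have CS : B u v <= Num.sqrt (B u u) * Num.sqrt (B v v).
  rewrite -sqrtrM ?B_ge0//; apply: le_trans (ler_norm _) _.
  by rewrite -sqrtr_sqr; apply: ler_wsqrtr; exact: form_CauchySchwarz.
rewrite -[leRHS]ger0_norm ?addr_ge0// -sqrtr_sqr; apply: ler_wsqrtr.
rewrite sqrrD !sqr_sqrtr ?B_ge0//; lra.
Qed.

(** The minimising sequence of [v |-> B v v - 2 l v] is Cauchy by the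
    parallelogram identity, and its limit satisfies the Euler-Lagrange
    equation. Completeness is stated in terms of [B], which may vanish at nonzero
    vectors: functions that agree almost everywhere are not identified. *)
Lemma riesz_representation (l : V -> R) (K : R) :
  H !=set0 ->
  (forall a u v, H u -> H v -> l (a *: u + v) = a * l u + l v) ->
  (forall u, H u -> l u ^+ 2 <= K * B u u) -> 0 <= K ->
  (forall u : nat -> V, (forall n, H (u n)) ->
    (forall e : R, 0 < e -> exists N, forall n m, (N <= n)%N -> (N <= m)%N ->
      B (u n - u m) (u n - u m) < e) ->
    exists2 w, H w & forall e : R, 0 < e -> exists N, forall n, (N <= n)%N ->
      B (u n - w) (u n - w) < e) ->
  exists2 u, H u & forall v, H v -> B u v = l v.
Proof.
move=> [v0 Hv0] lZD lB K0 complete.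
pose J v := B v v - 2 * l v.
have J_ge v : H v -> - K <= J v.
  move=> Hv; rewrite /J; have := lB _ Hv; have := B_ge0 Hv.
  have [->|Kn0] := eqVneq K 0.
    rewrite mul0r => b0 l0; have /eqP -> : l v == 0.
      by rewrite -sqrf_eq0 eq_le l0 sqr_ge0.
    lra.
  move=> b0 lb; have Kp : 0 < K by rewrite lt_neqAle eq_sym Kn0.
  have sq : 0 <= (K - l v) ^+ 2 by rewrite sqr_ge0.
  rewrite -(ler_pM2l Kp); nra.
pose S := [set J v | v in H].
have infS : has_inf S.
  split; first by exists (J v0), v0.
  by exists (- K) => _ [v Hv <-]; exact: J_ge.
have J_inf v : H v -> inf S <= J v.
  by move=> Hv; apply: ge_inf; [exact: infS.2|exists v].
have /choice[u uP] : forall n : nat, exists u, H u /\ J u < inf S + n.+1%:R^-1.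
  move=> n; have [|_ [u Hu <-] uS] := @inf_adherent R S n.+1%:R^-1 _ infS.
    by rewrite invr_gt0.
  by exists u.
have Hu n := (uP n).1.
have HB v w : H v -> H w -> H (v - w).
  by move=> Hv Hw; rewrite -scaleN1r addrC; exact: HZD.
have near_inf v w (a b : R) : H v -> H w -> J v < inf S + a -> J w < inf S + b ->
    B (v - w) (v - w) <= 2 * (a + b).
  move=> Hv Hw Jv Jw.
  have H0 : H 0 by rewrite -(subrr v); exact: HB.
  (* the midpoint of v and w, where J is at least its infimum *)
  pose m := 2^-1 *: v + (2^-1 *: w + 0).
  have Hm' : H (2^-1 *: w + 0) by exact: HZD.
  have Hm : H m by exact: HZD.
  have l0 : l 0 = 0 by have := lZD 1 _ _ H0 H0; rewrite scaler0 addr0; lra.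
  have B0 z : H z -> B 0 z = 0.
    by move=> Hz; have := BZD 1 H0 H0 Hz; rewrite scaler0 addr0; lra.
  have := J_inf _ Hm; rewrite /J lZD// lZD// l0 form_expand//.
  rewrite form_expand// (BC Hv Hm') BZD// (BC Hw H0) !B0// (BC Hw Hv).
  have -> : v - w = (-1) *: w + v by rewrite scaleN1r addrC.
  rewrite form_expand// (BC Hw Hv); move: Jv Jw; rewrite /J; lra.
have small (e : R) : 0 < e -> exists N, forall n, (N <= n)%N -> n.+1%:R^-1 < e.
  move=> e0; exists (Num.truncn e^-1) => n Nn.
  rewrite invf_plt ?posrE//; apply: (lt_le_trans (Num.Theory.truncnS_gt _)).
  by rewrite ler_nat.
have [|w Hw uw] := complete u Hu.
  move=> e e0; have [|N NP] := small (e / 4); first by rewrite divr_gt0.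
  exists N => n m Nn Nm.
  apply: le_lt_trans (near_inf _ _ _ _ (Hu n) (Hu m) (uP n).2 (uP m).2) _.
  have := NP _ Nn; have := NP _ Nm.
  by move: n.+1%:R^-1 m.+1%:R^-1 => x y; lra.
exists w => // v Hv; apply/eqP; rewrite -subr_eq0 -sqrf_eq0 eq_le sqr_ge0 andbT.
apply/ler_addgt0Pl => e e0; rewrite addr0.
have b0 := B_ge0 Hv.
pose e' := e / (4 * (B v v + 1)).
have e'0 : 0 < e' by rewrite divr_gt0 ?mulr_gt0 ?ltr_wpDl.
have [|N1 N1P] := small e'; first by [].
have [|N2 N2P] := uw e'; first by [].
pose n := maxn N1 N2.
have n1 := N1P n (leq_maxl _ _); have n2 := N2P n (leq_maxr _ _).
have r1 : (B (u n) v - l v) ^+ 2 <= n.+1%:R^-1 * B v v.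
  apply: discriminant_le => // t.
  have := J_inf _ (HZD t Hv (Hu n)); have := (uP n).2.
  rewrite /J form_expand// lZD// (BC Hv (Hu n)).
  by move: n.+1%:R^-1 => x; lra.
have r2 := form_CauchySchwarz (HB _ _ (Hu n) Hw) Hv.
have : B (u n - w) v = B (u n) v - B w v.
  by rewrite -scaleN1r addrC BZD//; ring.
move: r2 => /[swap] -> r2.
have se : (4 * e') * (B v v + 1) = e by rewrite /e'; field; lra.
have r1' : (B (u n) v - l v) ^+ 2 <= e' * B v v.
  by apply: le_trans r1 _; rewrite ler_wpM2r// ltW.
have r2' : (B (u n) v - B w v) ^+ 2 <= e' * B v v.
  by apply: le_trans r2 _; rewrite ler_wpM2r// ltW.
have sq : 0 <= (B (u n) v - l v + (B (u n) v - B w v)) ^+ 2 by rewrite sqr_ge0.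
nra.
Qed.

End quadratic.

(** * Continuous maps are Borel measurable *)

Section borel_maps.
Context {R : realType}.

Lemma measurable_borelType (S T : pointedType) (dS : S -> S -> R) (dT : T -> T -> R)
  (F : S -> T) :
  (forall x (e : R), 0 < e -> exists2 t : R, 0 < t &
     forall y, dS x y < t -> dT (F x) (F y) < e) ->
  measurable_fun [set: borelType dS] (F : borelType dS -> borelType dT).
Proof.
move=> cF; apply: (@measurability _ _ (borelType dS) (borelType dT) setT F (dist_open dT)) => //.
move=> _ [U oU <-]; rewrite setTI; apply: sub_sigma_algebra => x Ux.
have [e e0 eU] := oU _ Ux; have [t t0 tP] := cF x e e0.
by exists t => // y /tP ?; exact: eU.
Qed.

Lemma measurable_borelType_real (S : pointedType) (dS : S -> S -> R) (F : S -> R) :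
  (forall x (e : R), 0 < e -> exists2 t : R, 0 < t &
     forall y, dS x y < t -> `|F x - F y| < e) ->
  measurable_fun [set: borelType dS] (F : borelType dS -> R).
Proof.
move=> cF; apply: (measurability _ (RGenOpens.measurableE R)).
move=> _ [U [a [b ->]] <-]; rewrite setTI; apply: sub_sigma_algebra => x /= Ux.
  have /nbhs_ballP[e /= e0 eU] : nbhs (F x) [set` `]a, b[] by exact: near_in_itvoo Ux.
have [t t0 tP] := cF x e e0; exists t => // y /tP Fxy; exact: eU.
Qed.

End borel_maps.

(** * The space of square integrable functions *)

Section square_integrable.
Context d (T : measurableType d) (R : realType) (mu : {measure set T -> \bar R}).
Implicit Types f g h b : T -> R.

Lemma aeS (P Q : T -> Prop) : {ae mu, forall x, P x} ->
  (forall x, P x -> Q x) -> {ae mu, forall x, Q x}.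
Proof. by move=> aeP PQ; apply: filterS aeP. Qed.

Lemma aeS2 (P1 P2 Q : T -> Prop) : {ae mu, forall x, P1 x} ->
  {ae mu, forall x, P2 x} -> (forall x, P1 x -> P2 x -> Q x) ->
  {ae mu, forall x, Q x}.
Proof. by move=> aeP1 aeP2 PQ; apply: filterS2 aeP1 aeP2. Qed.

Lemma aeI (P1 P2 : T -> Prop) : {ae mu, forall x, P1 x} ->
  {ae mu, forall x, P2 x} -> {ae mu, forall x, P1 x /\ P2 x}.
Proof. by move=> aeP1 aeP2; apply: (aeS2 aeP1 aeP2). Qed.

Definition sqint : set (T -> R) :=
  [set f : T -> R | measurable_fun setT f /\ (\int[mu]_x (f x ^+ 2)%:E < +oo)%E].

Definition dot f g : R := \int[mu]_x (f x * g x).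

Definition norm2 f : R := Num.sqrt (dot f f).

Lemma sqint_measurable f : sqint f -> measurable_fun setT f.
Proof. by case. Qed.

Lemma sqint_Lfun f : sqint f <-> f \in Lfun mu 2%:E.
Proof.
have E : measurable_fun setT f ->
    ('N[mu]_2%:E[EFin \o f] = (\int[mu]_x (f x ^+ 2)%:E) `^ 2^-1)%E.
  move=> mf; rewrite unlock; congr (_ `^ _)%E; apply: eq_integral => x _ /=.
  by rewrite powR_mulrn// real_normK// num_real.
split=> [[mf foo]|].
  rewrite inE/=; apply/andP; split; rewrite inE//= /finite_norm E//.
  exact: poweR_lty.
rewrite inE/= => /andP[/[!inE]/= mf]; rewrite /finite_norm E// => foo.
by split=> //; exact: (@lty_poweRy _ _ 2^-1).
Qed.

Lemma norm2E f : measurable_fun setT f ->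
  fine ('N[mu]_2%:E[EFin \o f])%E = norm2 f.
Proof.
move=> mf; rewrite unlock /norm2 /dot /Rintegral.
have -> : (\int[mu]_x (`|(EFin \o f) x| `^ 2) = \int[mu]_x (f x * f x)%:E)%E.
  apply: eq_integral => x _ /=.
  by rewrite powR_mulrn// real_normK// num_real.
have : (0 <= \int[mu]_x (f x * f x)%:E)%E.
  by apply: integral_ge0 => x _; rewrite lee_fin -expr2 sqr_ge0.
case: (integral _ _ _) => [r|_|//]; last first.
  by rewrite poweRyr ?invr_neq0// sqrtr0.
by rewrite lee_fin => r0; rewrite /= powR12_sqrt.
Qed.

Lemma sqint0 : sqint (cst 0).
Proof.
split; first exact: measurable_cst.
by under eq_integral do rewrite /= expr0n; rewrite integral0.
Qed.

Lemma sqintZD a f g : sqint f -> sqint g -> sqint (a *: f + g).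
Proof.
move=> /sqint_Lfun Lf /sqint_Lfun Lg; apply/sqint_Lfun.
have := @Lfun_submod_closed _ T R mu 2%:E; move=> /(_ (lee1n 2))[_ h].
exact: h.
Qed.

Lemma sqintB f g : sqint f -> sqint g -> sqint (f - g).
Proof.
by move=> Lf Lg; rewrite -scaleN1r addrC; exact: sqintZD.
Qed.

Lemma sqint_ae f g : measurable_fun setT g -> f = g %[ae mu] ->
  sqint f -> sqint g.
Proof.
move=> mg fg [mf foo]; split=> //; apply: le_lt_trans foo.
rewrite (ge0_ae_eq_integral measurableT (f := fun x => (g x ^+ 2)%:E)
   (g := fun x => (f x ^+ 2)%:E))//.
- by apply/measurable_EFinP; exact: measurable_funX.
- by apply/measurable_EFinP; exact: measurable_funX.
- by move=> x _; rewrite lee_fin sqr_ge0.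
- by move=> x _; rewrite lee_fin sqr_ge0.
- by apply: filterS fg => x /= fg xT; rewrite fg.
Qed.

Lemma integrable_dot f g : sqint f -> sqint g ->
  mu.-integrable setT (EFin \o (fun x => f x * g x)).
Proof.
by move=> /sqint_Lfun Lf /sqint_Lfun Lg; exact/Lfun1_integrable/Lfun2_mul_Lfun1.
Qed.

Lemma dotC f g : dot f g = dot g f.
Proof. by apply: eq_Rintegral => x _; rewrite mulrC. Qed.

Lemma dot0l f : dot 0 f = 0.
Proof.
rewrite /dot /Rintegral (_ : (fun x => _) = cst 0%E) ?integral0//.
by apply/funext => x; rewrite /= mul0r.
Qed.

Lemma dotZDl a f g h : sqint f -> sqint g -> sqint h ->
  dot (a *: f + g) h = a * dot f h + dot g h.
Proof.
move=> Lf Lg Lh; rewrite /dot -RintegralZl//; last exact: integrable_dot.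
rewrite -RintegralD//; last exact: integrable_dot.
  by apply: eq_Rintegral => x _; rewrite fctE/= mulrDl -mulrA.
have -> : (fun x => a * (f x * h x)) = (fun x => (a *: f + 0) x * h x).
  by apply/funext => x; rewrite addr0 mulrA.
by apply: integrable_dot => //; apply: sqintZD => //; exact: sqint0.
Qed.

Lemma dotBl f g h : sqint f -> sqint g -> sqint h ->
  dot (f - g) h = dot f h - dot g h.
Proof.
by move=> *; rewrite -scaleN1r addrC dotZDl// mulN1r addrC.
Qed.

Lemma dotBr f g h : sqint f -> sqint g -> sqint h ->
  dot h (f - g) = dot h f - dot h g.
Proof. by move=> *; rewrite dotC dotBl// !(dotC h). Qed.

Lemma dot_ge0 f : 0 <= dot f f.
Proof. by apply: Rintegral_ge0 => x _; rewrite -expr2 sqr_ge0. Qed.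

Lemma norm2_ge0 f : 0 <= norm2 f.
Proof. exact: sqrtr_ge0. Qed.

Lemma sqr_norm2 f : norm2 f ^+ 2 = dot f f.
Proof. by rewrite sqr_sqrtr// dot_ge0. Qed.

Lemma dot_EFin f : sqint f -> (dot f f)%:E = (\int[mu]_x (f x ^+ 2)%:E)%E.
Proof.
move=> [mf foo]; rewrite /dot /Rintegral fineK//.
by rewrite ge0_fin_numE ?integral_ge0// => x _; rewrite lee_fin -expr2 sqr_ge0.
Qed.

Lemma norm_dot_le f g : sqint f -> sqint g -> `|dot f g| <= norm2 f * norm2 g.
Proof.
move=> Lf Lg; rewrite -ler_sqr ?nnegrE ?mulr_ge0 ?norm2_ge0//.
rewrite real_normK ?num_real// exprMn !sqr_norm2.
apply: (@form_CauchySchwarz _ _ sqint dot) => //.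
- by move=> *; exact: sqintZD.
- by move=> *; exact: dotC.
- by move=> *; exact: dotZDl.
- by move=> *; exact: dot_ge0.
Qed.

Lemma norm2D f g : sqint f -> sqint g -> norm2 (f + g) <= norm2 f + norm2 g.
Proof.
apply: (@form_triangle _ _ sqint dot) => //.
- by move=> *; exact: sqintZD.
- by move=> *; exact: dotC.
- by move=> *; exact: dotZDl.
- by move=> *; exact: dot_ge0.
Qed.

Lemma norm2_ae f g : sqint f -> sqint g -> f = g %[ae mu] -> norm2 f = norm2 g.
Proof.
move=> Lf Lg fg; rewrite /norm2; congr Num.sqrt.
apply: EFin_inj; rewrite !dot_EFin//.
have mf := sqint_measurable Lf; have mg := sqint_measurable Lg.
apply: (ge0_ae_eq_integral measurableT) => //.
- by apply/measurable_EFinP; exact: measurable_funX.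
- by apply/measurable_EFinP; exact: measurable_funX.
- by move=> x _; rewrite lee_fin sqr_ge0.
- by move=> x _; rewrite lee_fin sqr_ge0.
- by apply: filterS fg => x /= fg xT; rewrite fg.
Qed.

Lemma eq_dot_ae f f' g g' : sqint f -> sqint f' -> sqint g -> sqint g' ->
  f = f' %[ae mu] -> g = g' %[ae mu] -> dot f g = dot f' g'.
Proof.
move=> Lf Lf' Lg Lg' ff' gg'; congr fine.
apply: ae_eq_integral => //.
- by case/integrableP : (integrable_dot Lf Lg).
- by case/integrableP : (integrable_dot Lf' Lg').
- by apply: filterS2 ff' gg' => x /= + + xT => -> // ->.
Qed.

Lemma dot_ael f f' g : sqint f -> sqint f' -> sqint g ->
  f = f' %[ae mu] -> dot f g = dot f' g.
Proof. by move=> *; apply: eq_dot_ae => //; exact: nearW. Qed.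

Lemma sqint_bounded_mul b (M : R) f : measurable_fun setT b ->
  (\forall x \ae mu, `|b x| <= M) -> sqint f -> sqint (b * f).
Proof.
move=> mb bM [mf foo]; split; first exact: measurable_funM.
apply: (@le_lt_trans _ _ (\int[mu]_x ((M ^+ 2)%:E * (f x ^+ 2)%:E))%E); last first.
  rewrite ge0_integralZl//=; last 3 first.
  - by apply/measurable_EFinP; exact: measurable_funX.
  - by move=> x _; rewrite lee_fin sqr_ge0.
  - by rewrite lee_fin sqr_ge0.
  by rewrite lte_mul_pinfty// lee_fin sqr_ge0.
apply: ae_ge0_le_integral => //.
- by move=> x _; rewrite lee_fin sqr_ge0.
- by apply/measurable_EFinP; apply: measurable_funX; exact: measurable_funM.
- by move=> x _; rewrite -EFinM lee_fin mulr_ge0// sqr_ge0.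
- apply/measurable_EFinP; apply: measurable_funM => //; exact: measurable_funX.
- apply: filterS bM => x /= bM _; rewrite -EFinM lee_fin exprMn.
  rewrite ler_wpM2r ?sqr_ge0// -(real_normK (num_real (b x))) ler_sqr ?nnegrE//.
  by rewrite (le_trans _ bM).
Qed.

Lemma norm2_bounded_mul b (M : R) f : 0 <= M -> measurable_fun setT b ->
  (\forall x \ae mu, `|b x| <= M) -> sqint f -> norm2 (b * f) <= M * norm2 f.
Proof.
move=> M0 mb bM Lf; have Lbf := sqint_bounded_mul mb bM Lf.
rewrite -ler_sqr ?nnegrE ?mulr_ge0 ?norm2_ge0// exprMn !sqr_norm2 -lee_fin EFinM.
rewrite !dot_EFin//; case: Lf => mf foo.
rewrite -ge0_integralZl//=; last 3 first.
  - by apply/measurable_EFinP; exact: measurable_funX.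
  - by move=> x _; rewrite lee_fin sqr_ge0.
  - by rewrite lee_fin sqr_ge0.
apply: ae_ge0_le_integral => //.
- by move=> x _; rewrite lee_fin sqr_ge0.
- by apply/measurable_EFinP; apply: measurable_funX; exact: measurable_funM.
- by move=> x _; rewrite -EFinM lee_fin mulr_ge0// sqr_ge0.
- apply/measurable_EFinP; apply: measurable_funM => //; exact: measurable_funX.
- apply: filterS bM => x /= bM _; rewrite -EFinM lee_fin exprMn.
  rewrite ler_wpM2r ?sqr_ge0// -(real_normK (num_real (b x))) ler_sqr ?nnegrE//.
Qed.

End square_integrable.

Lemma limn_einf_ge0 (R : realType) (u : (\bar R)^nat) :
  (forall n, 0 <= u n)%E -> (0 <= limn_einf u)%E.
Proof.
move=> u0; rewrite limn_einf_lim; apply: lime_ge; first exact: is_cvg_einfs.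
by apply: nearW => n; apply: le_ereal_inf_tmp => _ [k _ <-].
Qed.

Lemma limn_einf_le (R : realType) (u : (\bar R)^nat) e K :
  (forall n, (K <= n)%N -> u n <= e)%E -> (limn_einf u <= e)%E.
Proof.
move=> ue; rewrite limn_einf_lim; apply: lime_le; first exact: is_cvg_einfs.
apply: nearW => n; apply: (@le_trans _ _ (u (maxn n K))).
  by apply: ereal_inf_lbound; exists (maxn n K) => //=; exact: leq_maxl.
by apply: ue; exact: leq_maxr.
Qed.

Section completeness.
Context d (T : measurableType d) (R : realType) (mu : {measure set T -> \bar R}).

Lemma cvg_geometric_increments (u : R^nat) (c : R) :
  (forall k, 4 ^+ k * (u k.+1 - u k) ^+ 2 <= c) -> cvgn u.
Proof.
move=> uc.
have c0 : 0 <= c.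
  by have := uc 0%N; rewrite expr0 mul1r; apply: le_trans; exact: sqr_ge0.
pose s := Num.sqrt c.
have us k : `|u k.+1 - u k| <= s * 2^-1 ^+ k.
  rewrite -ler_sqr ?nnegrE ?mulr_ge0 ?sqrtr_ge0 ?exprn_ge0//.
  rewrite real_normK ?num_real// exprMn sqr_sqrtr// -exprM mulnC exprM.
  have -> : 2^-1 ^+ 2 = 4^-1 :> R by field.
  by rewrite exprVn ler_pdivlMr ?exprn_gt0// mulrC.
have : cvgn (series (fun k => u k.+1 - u k)).
  apply: normed_cvg; apply: (@series_le_cvg _ _ (geometric s 2^-1)) => //.
  - by move=> n /=.
  - by move=> n; rewrite /geometric/= mulr_ge0 ?sqrtr_ge0 ?exprn_ge0.
  - by apply: is_cvg_geometric_series; rewrite ger0_norm// invf_lt1// ltr1n.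
have -> : series (fun k => u k.+1 - u k) = (fun n => u n - u 0%N).
  by apply/funext => n; rewrite /series/= telescope_sumr.
move=> cu.
have -> : u = (fun n => u n - u 0%N + u 0%N) by apply/funext => n; rewrite subrK.
by apply: is_cvgD => //; exact: is_cvg_cst.
Qed.

(** Riesz-Fischer: along a subsequence whose increments are square summable with
    geometric weights the functions converge almost everywhere, and by Fatou's
    lemma the pointwise limit is also the limit in the mean. *)
Lemma sqint_complete (f : nat -> T -> R) : (forall n, sqint mu (f n)) ->
  (forall e : R, 0 < e -> exists N, forall n m, (N <= n)%N -> (N <= m)%N ->
     norm2 mu (f n - f m) ^+ 2 < e) ->
  exists2 g, sqint mu g & forall e : R, 0 < e ->
    exists N, forall n, (N <= n)%N -> norm2 mu (f n - g) ^+ 2 <= e.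
Proof.
move=> Lf cf.
have Lfg n m : sqint mu (f n - f m) by exact: sqintB.
have mf n := sqint_measurable (Lf n).
(* the factor 4 ^ k in h below leaves a summable 2 ^ -k *)
have /choice[N NP] : forall k, exists N, forall n m, (N <= n)%N -> (N <= m)%N ->
    norm2 mu (f n - f m) ^+ 2 < 8^-1 ^+ k.
  by move=> k; apply: cf; rewrite exprn_gt0.
pose phi k := (k + \sum_(i < k.+1) N i)%N.
have Nphi k l : (k <= l)%N -> (N k <= phi l)%N.
  by move=> kl; rewrite /phi (bigD1 (Ordinal (kl : k < l.+1)%N))//= addnCA leq_addr.
pose g k := f (phi k).
pose h k x := (4 ^+ k * (g k.+1 x - g k x) ^+ 2)%:E.
have h0 k x : (0 <= h k x)%E by rewrite lee_fin mulr_ge0 ?sqr_ge0 ?exprn_ge0.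
have mh k : measurable_fun setT (h k).
  apply/measurable_EFinP; apply: measurable_funM => //.
  by apply: measurable_funX; apply: measurable_funB; exact: mf.
pose S x := (\sum_(k <oo) h k x)%E.
have intS : (\int[mu]_x S x < +oo)%E.
  rewrite /S integral_nneseries//.
  apply: (@le_lt_trans _ _ (\sum_(k <oo) (2^-1 ^+ k)%:E)%E); last first.
    have -> : (\sum_(k <oo) ((2^-1 : R) ^+ k)%:E =
        limn (EFin \o series (geometric (1 : R) 2^-1)))%E.
      congr (limn _); apply/funext => n /=; rewrite /series/= -sumEFin.
      by apply: eq_bigr => i _; rewrite mul1r.
    rewrite EFin_lim ?ltry//; apply: is_cvg_geometric_series.
    by rewrite ger0_norm// invf_lt1// ltr1n.
  apply: lee_nneseries => [k _ _|k _]; first exact: integral_ge0.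
  have -> : (\int[mu]_x h k x = (4 ^+ k * norm2 mu (g k.+1 - g k) ^+ 2)%:E)%E.
    rewrite sqr_norm2 EFinM dot_EFin; last exact: Lfg.
    rewrite -ge0_integralZl//=; last 2 first.
    - apply/measurable_EFinP; apply: measurable_funX.
      by apply: measurable_funB; exact: mf.
    - by move=> x _; rewrite lee_fin sqr_ge0.
  rewrite lee_fin (_ : 2^-1 = 4 * 8^-1 :> R); last by field.
  rewrite exprMn ler_wpM2l ?exprn_ge0//; apply/ltW/NP; exact: Nphi.
have S_fin : {ae mu, forall x, S x < +oo}%E.
  have iS : mu.-integrable setT S.
    apply/integrableP; split.
      by apply: ge0_emeasurable_sum => //.
    under eq_integral do rewrite gee0_abs ?nneseries_ge0//.
    exact: intS.
  have := integrable_ae measurableT iS.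
  apply: filterS => x /= /(_ I); rewrite ge0_fin_numE//.
  by apply: nneseries_ge0.
have cvg_g : {ae mu, forall x, cvgn (g ^~ x)}.
  apply: filterS S_fin => x Sx.
  apply: (@cvg_geometric_increments _ (fine (S x))) => k.
  rewrite -lee_fin fineK; last first.
    by rewrite ge0_fin_numE//; apply: nneseries_ge0.
  have -> : (4 ^+ k * (g k.+1 x - g k x) ^+ 2)%:E = (\sum_(k <= i < k.+1) h i x)%E.
    by rewrite big_nat1.
  apply: le_trans (nneseries_lim_ge k.+1 _); last by [].
  rewrite big_nat1 big_nat_recr//= leeDr//.
  by apply: sume_ge0.
pose F x := fine (limn_esup (fun k => (g k x)%:E)).
have mF : measurable_fun setT F.
  apply: measurableT_comp => //; apply: measurable_fun_limn_esup => n.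
  by apply/measurable_EFinP; exact: mf.
have gF : {ae mu, forall x, g ^~ x @ \oo --> F x}.
  apply: filterS cvg_g => x /cvg_ex[l gl].
  have E : (fun k => (g k x)%:E) @ \oo --> l%:E.
    by apply: cvg_EFin; first exact: nearW.
  by rewrite /F (cvg_limn_einf_sup E).2.
have fatou_bound m (e : R) : 0 <= e -> (exists K, forall k, (K <= k)%N ->
    norm2 mu (f m - g k) ^+ 2 <= e) ->
    (\int[mu]_x ((f m x - F x) ^+ 2)%:E <= e%:E)%E.
  move=> e0 [K KP].
  pose q k x := ((f m x - g k x) ^+ 2)%:E.
  have mq k : measurable_fun setT (q k).
    apply/measurable_EFinP; apply: measurable_funX.
    by apply: measurable_funB; exact: mf.
  apply: (@le_trans _ _ (\int[mu]_x limn_einf (q ^~ x))%E).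
    apply: ae_ge0_le_integral => //.
    - by move=> x _; rewrite lee_fin sqr_ge0.
    - by apply/measurable_EFinP; apply: measurable_funX; exact: measurable_funB.
    - by move=> x _; apply: limn_einf_ge0 => n; rewrite lee_fin sqr_ge0.
    - apply: measurableT_comp => //; apply: measurable_fun_limn_esup => n.
      exact: measurableT_comp.
    - apply: filterS gF => x gx _.
      have : q ^~ x @ \oo --> ((f m x - F x) ^+ 2)%:E.
        apply: cvg_EFin; first by apply: nearW.
        have c1 : (fun k => f m x - g k x) @ \oo --> f m x - F x.
          by apply: cvgB => //; exact: cvg_cst.
        exact: (cvgM c1 c1).
      by move=> /cvg_limn_einf_sup[-> _].
  apply: le_trans (fatou _ _ _ _) _ => //.
    by move=> k x _; rewrite lee_fin sqr_ge0.
  apply: (@limn_einf_le _ _ _ K) => k Kk; rewrite /q.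
  rewrite -(@dot_EFin _ _ _ mu (f m - g k)); last exact: Lfg.
  by rewrite -sqr_norm2 lee_fin; exact: KP.
have bound (e : R) : 0 < e -> exists N, forall n, (N <= n)%N ->
    (\int[mu]_x ((f n x - F x) ^+ 2)%:E <= e%:E)%E.
  move=> e0; have [M MP] := cf e e0; exists M => n Mn.
  apply: fatou_bound; first exact: ltW.
  exists M => k Mk; apply/ltW/MP => //.
  by apply: leq_trans Mk _; exact: leq_addr.
have [M MP] := bound 1 ltr01.
have LfF : sqint mu (f M - F).
  split; first exact: measurable_funB.
  by apply: le_lt_trans (MP M (leqnn _)) _; rewrite ltry.
have LF : sqint mu F.
  by rewrite -(subKr (f M) F); exact: sqintB.
exists F => // e e0; have [N' N'P] := bound e e0; exists N' => n N'n.
rewrite sqr_norm2 -lee_fin dot_EFin; last exact: sqintB.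
exact: N'P.
Qed.

End completeness.

(** * Test functions *)

Section test_functions.
Context {R : realType} {d : nat}.
Implicit Types (f g phi : 'rV[R]_d -> R) (i j : 'I_d) (s : seq 'I_d).

Local Notation iterD s f := (foldr (@partial R d) f s).

Definition coordf i (x : 'rV[R]_d) : R := x ord0 i.

Lemma continuous_coord i : continuous (coordf i).
Proof. by move=> x; exact: coord_continuous. Qed.

Lemma coord_cvg_derive i j x :
  (fun h : R => h^-1 *: ((coordf i \o shift x) (h *: delta_mx ord0 j) - coordf i x))
    @ 0^' --> ((i == j)%:R : R).
Proof.
apply: cvg_near_cst; near=> h.
rewrite /coordf/= !mxE eqxx/= addrK -[RHS]mul1r -[LHS]/(_ * (h * _)) mulrA mulVf//.
by near: h; exact: nbhs_dnbhs_neq.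
Unshelve. all: by end_near. Qed.

Lemma derivable_coord i j x : derivable (coordf i) x (delta_mx ord0 j).
Proof. by apply/cvg_ex; exists ((i == j)%:R); exact: coord_cvg_derive. Qed.

Lemma partial_coord i j x : partial j (coordf i) x = (i == j)%:R.
Proof. by apply: cvg_lim => //; exact: coord_cvg_derive. Qed.

Lemma smooth_derivable s f i x : smooth f ->
  derivable (iterD s f) x (delta_mx ord0 i).
Proof. by move=> /(_ s)[_]; exact. Qed.

Lemma smooth_continuous s f : smooth f -> continuous (iterD s f).
Proof. by move=> /(_ s)[]. Qed.

Lemma partialZD a f g i :
  (forall x, derivable f x (delta_mx ord0 i)) ->
  (forall x, derivable g x (delta_mx ord0 i)) ->
  partial i (a *: f + g) = a *: partial i f + partial i g.
Proof.
move=> df dg; apply/funext => x; rewrite /partial.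
have daf : derivable (a *: f) x (delta_mx ord0 i) by exact: derivableZ.
have -> := deriveD daf (dg x).
by have -> := deriveZ a (df x).
Qed.

Lemma iterD_ZD s a f g : smooth f -> smooth g ->
  iterD s (a *: f + g) = a *: iterD s f + iterD s g.
Proof.
move=> sf sg; elim: s => //= i s ->.
by rewrite partialZD// => x; exact: smooth_derivable.
Qed.

Lemma smoothZD a f g : smooth f -> smooth g -> smooth (a *: f + g).
Proof.
move=> sf sg s; rewrite /= iterD_ZD//; split=> [x|i x].
  apply: continuousD; last exact: smooth_continuous.
  by apply: continuousZl_tmp; exact: smooth_continuous.
apply: derivableD; last exact: smooth_derivable.
by apply: derivableZ; exact: smooth_derivable.
Qed.

Lemma smooth_sum (L : seq (seq 'I_d)) phi : smooth phi ->
  let F := \sum_(t <- L) iterD t phi in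
  [/\ continuous F, forall i x, derivable F x (delta_mx ord0 i) &
     forall i, partial i F = \sum_(t <- map (cons i) L) iterD t phi].
Proof.
move=> sphi; elim: L => [|t L [cF dF pF]] /=.
  rewrite !big_nil; split=> [x|i x|i]; rewrite ?big_nil.
  - exact: cst_continuous.
  - exact: derivable_cst.
  - by apply/funext => x; exact: derive_cst.
rewrite !big_cons; split=> [x|i x|i].
- by apply: continuousD; [exact: smooth_continuous|exact: cF].
- by apply: derivableD; [exact: smooth_derivable|exact: dF].
- rewrite big_cons -pF/= -[in LHS](scale1r (iterD t phi)) partialZD ?scale1r//.
  by move=> x; exact: smooth_derivable.
Qed.

(** By induction, every iterated derivative of [coordf i * phi] is [coordf i]
    times an iterated derivative of [phi] plus a sum of iterated derivatives
    of [phi]. *)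
Lemma smooth_coordM i phi : smooth phi -> smooth (coordf i * phi).
Proof.
move=> sphi.
have dX j x s : derivable (coordf i * iterD s phi) x (delta_mx ord0 j).
  by apply: derivableM; [exact: derivable_coord|exact: smooth_derivable].
have E s : exists L, iterD s (coordf i * phi) =
    coordf i * iterD s phi + \sum_(t <- L) iterD t phi.
  elim: s => [|j s [L EL]] /=; first by exists [::]; rewrite big_nil addr0.
  have [cF dF pF] := smooth_sum L sphi.
  have : partial j (coordf i * iterD s phi) =
      coordf i * partial j (iterD s phi) + (i == j)%:R *: iterD s phi.
    apply/funext => x; rewrite /partial.
    have -> := deriveM (@derivable_coord i j x) (@smooth_derivable s phi j x sphi).
    congr (_ + _); have := partial_coord i j x; rewrite /partial => ->.
    by rewrite -[LHS]/(_ * _) mulrC.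
  move=> pM; rewrite EL.
  exists ((if i == j then [:: s] else [::]) ++ map (cons j) L).
  rewrite -[X in partial _ (X + _)]scale1r partialZD// scale1r pM pF big_cat/= addrA; congr (_ + _ + _).
  by case: eqP => _; rewrite ?big_seq1 ?big_nil ?scale1r ?scale0r.
move=> s; have [L ->] := E s; have [cF dF _] := smooth_sum L sphi.
split=> [x|j x].
  apply: continuousD; last exact: cF.
  by apply: continuousM; [exact: continuous_coord|exact: smooth_continuous].
by apply: derivableD; [exact: dX|exact: dF].
Qed.

Lemma partial_coordM i phi x : smooth phi ->
  partial i (coordf i * phi) x = phi x + x ord0 i * partial i phi x.
Proof.
move=> sphi; rewrite /partial.
have -> := deriveM (@derivable_coord i i x) (@smooth_derivable [::] phi i x sphi).
by have := partial_coord i i x; rewrite /partial => ->; rewrite eqxx addrC -[X in X + _]/(_ * _) mulr1.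
Qed.

Local Notation tsupp f := (closure [set x | f x != 0]).

Lemma partial_eq0 phi i x : ~ tsupp phi x -> partial i phi x = 0.
Proof.
move=> Kx; rewrite /partial.
have : \near x, phi x = cst 0 x.
  have : nbhs x (~` tsupp phi).
    by apply: open_nbhs_nbhs; split => //; apply: closed_openC; exact: closed_closure.
  apply: filterS => y /= Ky; apply/eqP/negP => /negP phiy.
  by apply: Ky; apply: subset_closure.
by move=> /near_eq_derive ->; rewrite derive_cst.
Qed.

(** Supports are stable under the operations on test functions because the
    result vanishes where the arguments do. *)
Lemma test_functionP (D : set 'rV[R]_d) g phi psi :
  smooth g -> test_function D phi -> test_function D psi ->
  (forall x, phi x = 0 -> psi x = 0 -> g x = 0) -> test_function D g.
Proof.
move=> sg [_ c1 K1] [_ c2 K2] g0.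
have sub : tsupp g `<=` tsupp phi `|` tsupp psi.
  rewrite -closureU; apply: closureS => x /= gx.
  have [p0|] := eqVneq (phi x) 0; last by left.
  by have [q0|] := eqVneq (psi x) 0; [rewrite g0 ?eqxx in gx|right].
split=> //.
  by apply: subclosed_compact sub; [exact: closed_closure|exact: compactU].
by move=> x /sub[/K1|/K2].
Qed.

Lemma test_functionZD (D : set 'rV[R]_d) a phi psi :
  test_function D phi -> test_function D psi -> test_function D (a *: phi + psi).
Proof.
move=> t1 t2; apply: (@test_functionP D _ phi psi) => //.
  by apply: smoothZD; [case: t1|case: t2].
by move=> x p0 q0; rewrite -[LHS]/(a * phi x + psi x) p0 q0 mulr0 addr0.
Qed.

Lemma test_function_coordM (D : set 'rV[R]_d) i phi :
  test_function D phi -> test_function D (coordf i * phi).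
Proof.
move=> t1; apply: (@test_functionP D _ phi phi) => //.
  by apply: smooth_coordM; case: t1.
by move=> x p0 _; rewrite -[LHS]/(coordf i x * phi x) p0 mulr0.
Qed.

Lemma bounded_compact_support g (K : set 'rV[R]_d) : continuous g -> compact K ->
  (forall x, ~ K x -> g x = 0) -> exists M : R, forall x, `|g x| <= M.
Proof.
move=> cg cK g0.
have /compact_bounded[M [Mr MP]] : compact (g @` K).
  by apply: continuous_compact => //; exact: continuous_subspaceT.
have M1 : M < `|M| + 1 by rewrite (le_lt_trans (ler_norm _))// ltrDl.
exists (`|M| + 1) => x; have [Kx|nKx] := pselect (K x); last first.
  by rewrite g0// normr0 addr_ge0.
by apply: MP M1 _ _; exists x.
Qed.

Lemma test_function_bounded (D : set 'rV[R]_d) phi : test_function D phi ->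
  (exists M : R, forall x, `|phi x| <= M) /\
  forall i, exists M : R, forall x, `|partial i phi x| <= M.
Proof.
move=> [sphi cK KD]; split=> [|i].
  apply: bounded_compact_support cK _; first exact: (sphi [::]).1.
  by move=> x Kx; apply/eqP/negP => /negP ?; apply: Kx; exact: subset_closure.
apply: bounded_compact_support cK _; first exact: (sphi [:: i]).1.
by move=> x; exact: partial_eq0.
Qed.

End test_functions.

(** * The Sobolev space of functions vanishing on the boundary *)

Section pairs.
Context {R : realType} {T I : Type}.
Implicit Types (w z : (T -> R) * (I -> T -> R)) (a : R) (i : I).

Lemma fstZD a w z : (a *: w + z).1 = a *: w.1 + z.1. Proof. by []. Qed.

Lemma sndZD a w z i : (a *: w + z).2 i = a *: w.2 i + z.2 i. Proof. by []. Qed.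

Lemma fstB w z : (w - z).1 = w.1 - z.1. Proof. by []. Qed.

Lemma sndB w z i : (w - z).2 i = w.2 i - z.2 i. Proof. by []. Qed.

End pairs.

Section sobolev.
Context {R : realType} {d : nat} (D : bounded_lipschitz_domain R d).
Local Notation mu := (lebesgue_domain D).
Local Notation T := (borel_rV R d).

Lemma ae_domain : {ae mu, forall x : T, domain_set D x}.
Proof.
exists (~` (D : set T)); split => //.
- by apply: measurableC; exact: measurable_domain.
- by rewrite /lebesgue_domain/= /mrestr setICl measure0.
Qed.

Lemma domain_bounded_norm : exists2 M : R, 0 < M & forall x, domain_set D x -> `|x| < M.
Proof.
have [M [Mr MP]] := domain_bounded D.
exists (`|M| + 2) => [|x Dx]; first by rewrite ltr_wpDl.
have M1 : M < `|M| + 1 by rewrite (le_lt_trans (ler_norm _))// ltrDl.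
by apply: (le_lt_trans (MP _ M1 _ Dx)); rewrite ltrD2l ltr1n.
Qed.

Lemma normr_coord_le (x : 'rV[R]_d) i : `|x ord0 i| <= `|x|.
Proof.
rewrite [leRHS]/Num.norm/= mx_normrE.
by apply: (le_bigmax _ (fun ij => `|x ij.1 ij.2|) (ord0, i)).
Qed.

Lemma lebesgue_domain_lty : (mu setT < +oo)%E.
Proof.
have [M M0 MP] := domain_bounded_norm.
pose A (i : 'I_d) : set (measurableTypeR R) := `[- M, M]%classic.
have mA (i : 'I_d) : measurable (A i) by exact: measurable_itv.
pose B : set T := [set v : T | forall i, A i ((v : 'rV[R]_d) ord0 i)].
have mB : measurable B.
  have -> : B = \bigcap_(i in [set: 'I_d]) (coordf i @^-1` A i).
    by apply/seteqP; split => [v h i _|v h i]; [exact: h|exact: (h i I)].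
  apply: fin_bigcap_measurable => // i _; rewrite -[X in measurable X]setTI.
  have := continuous_measurable_rV (@continuous_coord R d i).
  by move=> /(_ measurableT _ (mA i)).
apply: (@le_lt_trans _ _ (lebesgue_rV B)).
  rewrite /lebesgue_domain/= /mrestr setTI; apply: le_measure.
  - by rewrite inE; exact: measurable_domain.
  - by rewrite inE.
  - move=> x Dx i; rewrite /A/= in_itv/= -ler_norml.
    by apply: le_trans (normr_coord_le _ _) _; exact/ltW/MP.
rewrite lebesgue_rVE//.
under eq_bigr do rewrite /A lebesgue_measure_itv/= lte_fin gtrN// -EFinB.
by rewrite prodEFin ltry.
Qed.

Implicit Types (f g : T -> R) (w z : (T -> R) * ('I_d -> T -> R)).

Lemma sqint_bounded f (M : R) : measurable_fun setT f ->
  (forall x, `|f x| <= M) -> sqint mu f.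
Proof.
move=> mf fM; split => //.
apply: (@le_lt_trans _ _ (\int[mu]_x (M ^+ 2)%:E)%E).
  apply: ge0_le_integral => //.
  - by move=> x _; rewrite lee_fin sqr_ge0.
  - by apply/measurable_EFinP; exact: measurable_funX.
  - move=> x _; rewrite lee_fin -(real_normK (num_real (f x))).
    by rewrite ler_sqr ?nnegrE// (le_trans _ (fM x)).
by rewrite integral_cst// lte_mul_pinfty ?lee_fin ?sqr_ge0// lebesgue_domain_lty.
Qed.

Lemma test_function_sqint phi : test_function D phi ->
  sqint mu phi /\ forall i, sqint mu (partial i phi).
Proof.
move=> tphi; have [[M MP] bp] := test_function_bounded tphi.
have [sphi _ _] := tphi.
split=> [|i].
  by apply: sqint_bounded MP; apply: continuous_measurable_rV; exact: (sphi [::]).1.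
have [M' MP'] := bp i.
by apply: sqint_bounded MP'; apply: continuous_measurable_rV; exact: (sphi [:: i]).1.
Qed.

(** [H^1] is modelled by pairs of functions, the second one being a candidate for
    the gradient of the first: unlike the records [H10], which carry classes and
    proofs, these pairs form a vector space. *)
Definition sqint1 : set ((T -> R) * ('I_d -> T -> R)) :=
  [set w | sqint mu w.1 /\ forall i, sqint mu (w.2 i)].

Definition hdot w z : R := dot mu w.1 z.1 + \sum_i dot mu (w.2 i) (z.2 i).

Definition jet (phi : T -> R) : (T -> R) * ('I_d -> T -> R) :=
  (phi, fun i => partial i phi).

Definition in_H10 : set ((T -> R) * ('I_d -> T -> R)) :=
  [set w | [/\ sqint1 w,
    forall i phi, test_function D phi ->
      dot mu w.1 (partial i phi) = - dot mu (w.2 i) phi &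
    forall e : R, 0 < e -> exists2 phi, test_function D phi &
      hdot (w - jet phi) (w - jet phi) < e ^+ 2]].

Lemma in_H10_sqint1 w : in_H10 w -> sqint1 w. Proof. by case. Qed.

Lemma sqint1ZD a w z : sqint1 w -> sqint1 z -> sqint1 (a *: w + z).
Proof. by move=> [w1 w2] [z1 z2]; split=> [|i]; rewrite ?fstZD ?sndZD; exact: sqintZD. Qed.

Lemma sqint1B w z : sqint1 w -> sqint1 z -> sqint1 (w - z).
Proof. by move=> ? ?; rewrite -scaleN1r addrC; exact: sqint1ZD. Qed.

Lemma jet_sqint1 phi : test_function D phi -> sqint1 (jet phi).
Proof. by move=> /test_function_sqint. Qed.

Lemma hdotC w z : hdot w z = hdot z w.
Proof. by rewrite /hdot dotC; under eq_bigr do rewrite dotC. Qed.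

Lemma hdotZDl a w z v : sqint1 w -> sqint1 z -> sqint1 v ->
  hdot (a *: w + z) v = a * hdot w v + hdot z v.
Proof.
move=> [w1 w2] [z1 z2] [v1 v2]; rewrite /hdot fstZD dotZDl// mulrDr addrACA.
congr (_ + _); rewrite mulr_sumr -big_split; apply: eq_bigr => i _.
by rewrite sndZD dotZDl.
Qed.

Lemma hdot_ge0 w : 0 <= hdot w w.
Proof. by rewrite addr_ge0 ?dot_ge0// sumr_ge0// => i _; exact: dot_ge0. Qed.

Definition hnorm w : R := Num.sqrt (hdot w w).

Lemma sqr_hnorm w : hnorm w ^+ 2 = hdot w w.
Proof. by rewrite sqr_sqrtr// hdot_ge0. Qed.

Lemma hnorm_lt w (e : R) : 0 < e -> (hdot w w < e ^+ 2) = (hnorm w < e).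
Proof. by move=> e0; rewrite -sqr_hnorm ltr_sqr ?nnegrE ?sqrtr_ge0 ?ltW. Qed.

Lemma hnormD w z : sqint1 w -> sqint1 z -> hnorm (w + z) <= hnorm w + hnorm z.
Proof.
apply: (@form_triangle _ _ sqint1 hdot) => //.
- by move=> *; exact: sqint1ZD.
- by move=> *; exact: hdotC.
- by move=> *; exact: hdotZDl.
- by move=> *; exact: hdot_ge0.
Qed.

Lemma hnormZ a w : sqint1 w -> hnorm (a *: w) = `|a| * hnorm w.
Proof.
move=> Lw; rewrite /hnorm -sqrtr_sqr -sqrtrM ?sqr_ge0//; congr Num.sqrt.
have L0 : sqint1 0 by rewrite -(subrr w); exact: sqint1B.
have h0 v : sqint1 v -> hdot 0 v = 0.
  move=> Lv; rewrite -(subrr w) -scaleN1r addrC hdotZDl//; lra.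
rewrite -[a *: w]addr0 (form_expand (H := sqint1))//.
- by rewrite (hdotC w) !h0//; ring.
- by move=> *; exact: sqint1ZD.
- by move=> *; exact: hdotC.
- by move=> *; exact: hdotZDl.
Qed.

Lemma norm2_fst_le w : norm2 mu w.1 <= hnorm w.
Proof.
by apply: ler_wsqrtr; rewrite lerDl sumr_ge0// => i _; exact: dot_ge0.
Qed.

Lemma norm2_snd_le w i : norm2 mu (w.2 i) <= hnorm w.
Proof.
apply: ler_wsqrtr; rewrite /hdot (bigD1 i)//= addrCA lerDl.
by rewrite addr_ge0 ?dot_ge0// sumr_ge0// => j _; exact: dot_ge0.
Qed.

Lemma jetZD a phi psi : test_function D phi -> test_function D psi ->
  jet (a *: phi + psi) = a *: jet phi + jet psi.
Proof.
move=> [sp _ _] [sq _ _]; congr pair; apply/funext => i.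
by rewrite partialZD// => x; [exact: (sp [::]).2|exact: (sq [::]).2].
Qed.

Lemma in_H10ZD a w z : in_H10 w -> in_H10 z -> in_H10 (a *: w + z).
Proof.
move=> [Lw ww aw] [Lz wz az]; split; first exact: sqint1ZD.
  move=> i phi tphi; have [Lp Lpi] := test_function_sqint tphi.
  case: Lw => w1 w2; case: Lz => z1 z2.
  by rewrite fstZD sndZD !dotZDl// ww// wz//; ring.
move=> e e0.
have e2 : 0 < e / (2 * (`|a| + 1)) by rewrite divr_gt0 ?mulr_gt0// ltr_wpDl.
have e3 : 0 < e / 2 by rewrite divr_gt0.
have [phi tphi pw] := aw _ e2; have [psi tpsi pz] := az _ e3.
exists (a *: phi + psi); first exact: test_functionZD.
have L1 : sqint1 (w - jet phi) by apply: sqint1B => //; exact: jet_sqint1.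
have L2 : sqint1 (z - jet psi) by apply: sqint1B => //; exact: jet_sqint1.
rewrite jetZD// hnorm_lt//.
have -> : a *: w + z - (a *: jet phi + jet psi) =
    a *: (w - jet phi) + (z - jet psi) by rewrite scalerBr addrACA opprD.
have L0 : sqint1 0 by rewrite -(subrr w); exact: sqint1B.
apply: (le_lt_trans (hnormD _ _)) => //.
  by rewrite -[_ *: _]addr0; exact: sqint1ZD.
rewrite hnormZ//.
rewrite hnorm_lt// in pw; rewrite hnorm_lt// in pz.
have h : `|a| * hnorm (w - jet phi) <= (`|a| + 1) * (e / (2 * (`|a| + 1))).
  by apply: ler_pM => //; [exact: sqrtr_ge0|rewrite lerDl|exact: ltW].
have E : (`|a| + 1) * (e / (2 * (`|a| + 1))) = e / 2.
  by field; rewrite gt_eqF// ltr_wpDl.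
rewrite E in h; have E2 : e / 2 + e / 2 = e by field.
by rewrite -E2; apply: ler_ltD.
Qed.

Lemma in_H10_0 : in_H10 0.
Proof.
have L0 : sqint1 0 by split=> [|i]; exact: sqint0.
split=> // [i phi _|e e0]; first by rewrite !dot0l oppr0.
exists (cst 0); first exact: test_function_cst0.
have -> : jet (cst 0) = 0.
  by congr pair; apply/funext => i; exact: partial_cst0.
rewrite subr0 /hdot dot0l big1 ?addr0 ?exprn_gt0// => i _; exact: dot0l.
Qed.

Lemma in_H10B w z : in_H10 w -> in_H10 z -> in_H10 (w - z).
Proof. by move=> ? ?; rewrite -scaleN1r addrC; exact: in_H10ZD. Qed.

Lemma eq_small (x y C : R) : 0 <= C ->
  (forall e : R, 0 < e -> `|x - y| <= C * e) -> x = y.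
Proof.
move=> C0 h; apply/eqP; rewrite -subr_eq0 -normr_le0.
apply/ler_addgt0Pl => e e0; rewrite addr0.
have c1 : 0 < C + 1 by rewrite ltr_wpDl.
apply: (le_trans (h (e / (C + 1)) _)); first by rewrite divr_gt0.
by rewrite mulrA ler_pdivrMr// mulrC ler_wpM2l ?lerDl// ltW.
Qed.

Lemma in_H10_closed w : sqint1 w ->
  (forall e : R, 0 < e -> exists2 z, in_H10 z & hnorm (w - z) < e) -> in_H10 w.
Proof.
move=> Lw cw; split=> //.
  move=> i phi tphi; have [Lp Lpi] := test_function_sqint tphi.
  apply: (@eq_small _ _ (norm2 mu (partial i phi) + norm2 mu phi)).
    by rewrite addr_ge0 ?norm2_ge0.
  move=> e e0; have [z Hz wz] := cw e e0; have [Lz zw _] := Hz.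
  have Lwz := sqint1B Lw Lz.
  have -> : dot mu w.1 (partial i phi) - - dot mu (w.2 i) phi =
     dot mu (w - z).1 (partial i phi) + dot mu ((w - z).2 i) phi.
    case: Lw => w1 w2; case: Lz => z1 z2.
    by rewrite fstB sndB !dotBl// zw//; ring.
  rewrite mulrDl; apply: le_trans (ler_normD _ _) _; apply: lerD.
    apply: le_trans (norm_dot_le _ _) _; [exact: Lwz.1|exact: Lpi|].
    rewrite mulrC ler_wpM2l ?norm2_ge0//.
    exact: le_trans (norm2_fst_le _) (ltW wz).
  apply: le_trans (norm_dot_le _ _) _; [exact: Lwz.2|exact: Lp|].
  rewrite mulrC ler_wpM2l ?norm2_ge0//.
  exact: le_trans (norm2_snd_le _ _) (ltW wz).
move=> e e0; have e2 : 0 < e / 2 by rewrite divr_gt0.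
have [z Hz wz] := cw _ e2; have [Lz _ /(_ _ e2)[phi tphi pz]] := Hz.
exists phi => //; rewrite hnorm_lt//.
have -> : w - jet phi = (w - z) + (z - jet phi) by rewrite addrA subrK.
have Lj := jet_sqint1 tphi.
apply: (le_lt_trans (hnormD _ _)); try exact: sqint1B.
rewrite hnorm_lt// in pz.
have E2 : e / 2 + e / 2 = e by field.
by rewrite -E2; apply: ltrD.
Qed.

End sobolev.

Section elliptic.
Context {R : realType} {d : nat} (D : bounded_lipschitz_domain R d).
Local Notation mu := (lebesgue_domain D).
Local Notation T := (borel_rV R d).
Local Notation in_H10 := (in_H10 D).
Implicit Types (f g a : T -> R) (w z : (T -> R) * ('I_d -> T -> R)).

Lemma measurable_coordf i : measurable_fun setT (coordf i : T -> R).
Proof. exact: (continuous_measurable_rV (@continuous_coord R d i)). Qed.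

Lemma dotMr b f g : dot mu f (b * g) = dot mu (b * f) g.
Proof. by apply: eq_Rintegral => x _; rewrite !fctE/= mulrCA mulrA. Qed.

(** Since [u] vanishes on the boundary, integrating the derivative of
    [x_i u ^ 2] gives [int u^2 = - 2 int x_i u d_i u]. For the elements of the
    space this follows from the weak derivative tested against [x_i phi], where
    the test functions [phi] tend to [u]. *)
Lemma poincare : exists2 c : R, 0 < c &
  forall w i, in_H10 w -> norm2 mu w.1 <= c * norm2 mu (w.2 i).
Proof.
have [M M0 MP] := domain_bounded_norm D.
exists (2 * M) => [|w i Hw]; first by rewrite mulr_gt0.
pose X : T -> R := coordf i.
have mX : measurable_fun setT X by exact: measurable_coordf.
have XM : \forall x \ae mu, `|X x| <= M.
  apply: (aeS (ae_domain D)) => x Dx.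
  by apply: le_trans (normr_coord_le _ _) _; exact/ltW/MP.
have [[L1 L2] ww aw] := Hw.
have LX f : sqint mu f -> sqint mu (X * f) by exact: sqint_bounded_mul XM.
set u := w.1 in L1 ww *; set g := w.2 i.
have Lg : sqint mu g by exact: L2.
(* the integral of the derivative of x_i u ^ 2 *)
have E : dot mu u u + dot mu (X * u) g + dot mu (X * g) u = 0.
  apply: (@eq_small _ _ _ (norm2 mu u + norm2 mu (X * u) + norm2 mu (X * g))).
    by rewrite !addr_ge0 ?norm2_ge0.
  move=> e e0; have [phi tphi pw] := aw e e0.
  have [Lp Lpi] := test_function_sqint tphi.
  have Lj := jet_sqint1 tphi.
  have Lwj : sqint1 D (w - jet phi) by apply: sqint1B.
  rewrite hnorm_lt// in pw.
  have n1 : norm2 mu (u - phi) <= e.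
    exact: le_trans (norm2_fst_le D (w - jet phi)) (ltW pw).
  have n2 : norm2 mu (g - partial i phi) <= e.
    exact: le_trans (norm2_snd_le D (w - jet phi) i) (ltW pw).
  have := ww i _ (test_function_coordM i tphi).
  have -> : partial i (coordf i * phi) = 1 *: phi + X * partial i phi.
    apply/funext => x; rewrite scale1r; apply: partial_coordM.
    by case: tphi.
  have -> : dot mu u (1 *: phi + X * partial i phi) =
      dot mu u phi + dot mu (X * u) (partial i phi).
    rewrite dotC dotZDl//; last exact: LX.
    by rewrite mul1r (dotC mu phi) (dotC mu (X * _)) dotMr.
  rewrite -/X -/g (dotMr X g) => Eu.
  have -> : dot mu u u + dot mu (X * u) g + dot mu (X * g) u - 0 =
      dot mu u (u - phi) + dot mu (X * u) (g - partial i phi) +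
      dot mu (X * g) (u - phi).
    by rewrite !dotBr//; try exact: LX; move: Eu; lra.
  rewrite !mulrDl.
  have LB1 : sqint mu (u - phi) by exact: sqintB.
  have LB2 : sqint mu (g - partial i phi) by apply: sqintB.
  apply: le_trans (ler_normD _ _) _; apply: lerD; last first.
    apply: le_trans (norm_dot_le (LX _ Lg) LB1) _.
    by rewrite ler_wpM2l ?norm2_ge0.
  apply: le_trans (ler_normD _ _) _; apply: lerD.
    by apply: le_trans (norm_dot_le L1 LB1) _; rewrite ler_wpM2l ?norm2_ge0.
  apply: le_trans (norm_dot_le (LX _ L1) LB2) _.
  by rewrite ler_wpM2l ?norm2_ge0.
have E2 : norm2 mu u ^+ 2 <= 2 * (M * norm2 mu u) * norm2 mu g.
  rewrite sqr_norm2.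
  have -> : dot mu u u = - (2 * dot mu (X * u) g).
    by move: E; rewrite -(dotMr X g u) (dotC mu g); lra.
  have h : `|dot mu (X * u) g| <= M * norm2 mu u * norm2 mu g.
    apply: le_trans (norm_dot_le (LX _ L1) Lg) _.
    by rewrite ler_wpM2r ?norm2_ge0// norm2_bounded_mul// ltW.
  have := ler_norm (- dot mu (X * u) g); rewrite normrN; lra.
have [u0|un0] := eqVneq (norm2 mu u) 0.
  by rewrite u0 !mulr_ge0 ?norm2_ge0// ltW.
have up : 0 < norm2 mu u by rewrite lt_neqAle eq_sym un0 norm2_ge0.
by rewrite -(ler_pM2l up) -expr2 (le_trans E2)//; lra.
Qed.

Definition edot a w z : R := \sum_i dot mu (a * w.2 i) (z.2 i).

Section energy.
Variables (a : T -> R) (m M : R).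
Hypotheses (ma : measurable_fun setT a) (m0 : 0 < m) (M0 : 0 <= M)
  (am : \forall x \ae mu, m <= a x) (aM : \forall x \ae mu, `|a x| <= M).

Let La f : sqint mu f -> sqint mu (a * f).
Proof. exact: sqint_bounded_mul aM. Qed.

Lemma edotC w z : edot a w z = edot a z w.
Proof. by apply: eq_bigr => i _; rewrite -dotMr dotC. Qed.

Lemma edotZDl c w z v : sqint1 D w -> sqint1 D z -> sqint1 D v ->
  edot a (c *: w + z) v = c * edot a w v + edot a z v.
Proof.
move=> [_ w2] [_ z2] [_ v2]; rewrite /edot mulr_sumr -big_split.
apply: eq_bigr => i _; rewrite /= -dotZDl//; try exact: La.
congr (dot _ _ _); apply/funext => x.
by rewrite !fctE/= mulrDr -[c *: w.2 i x]/(c * w.2 i x) mulrCA.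
Qed.

Lemma dot_coercive g : sqint mu g -> m * dot mu g g <= dot mu (a * g) g.
Proof.
move=> Lg.
(* a modification of a that is bounded below everywhere *)
pose b : T -> R := fun x => Num.max m (a x).
have mb : measurable_fun setT b by apply: measurable_maxr.
have ab : a = b %[ae mu].
  by apply: (aeS am) => x ax _; rewrite /b; apply/esym/max_idPr.
have Lbg : sqint mu (b * g).
  apply: sqint_ae (La Lg); first by apply: measurable_funM => //; case: Lg.
  by apply: (aeS ab) => x /= /[apply]; rewrite !fctE/= => ->.
have -> : dot mu (a * g) g = dot mu (b * g) g.
  apply: eq_dot_ae => //; first exact: La.
    by apply: (aeS ab) => x /= /[apply]; rewrite !fctE/= => ->.
  by apply: (aeS am).
have Lmg : sqint mu (m *: g).
  by rewrite -[_ *: _]addr0; apply: sqintZD => //; exact: sqint0.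
apply: (@le_trans _ _ (dot mu (m *: g) g)).
  by rewrite -[m *: g]addr0 dotZDl//; [rewrite lerDl dot0l|exact: sqint0].
apply: le_Rintegral => //; try exact: integrable_dot.
move=> x _; rewrite -!mulrA -expr2 ler_wpM2r ?sqr_ge0//.
by rewrite /b le_max lexx.
Qed.

Lemma edot_coercive w : sqint1 D w ->
  m * (\sum_i norm2 mu (w.2 i) ^+ 2) <= edot a w w.
Proof.
move=> [_ w2]; rewrite mulr_sumr; apply: ler_sum => i _.
by rewrite sqr_norm2; exact: dot_coercive.
Qed.

Lemma edot_ge0 w : sqint1 D w -> 0 <= edot a w w.
Proof.
move=> Lw; apply: le_trans (edot_coercive Lw).
by apply: mulr_ge0; [exact: ltW|apply: sumr_ge0 => i _; exact: sqr_ge0].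
Qed.

Lemma norm_edot_le w z : sqint1 D w -> sqint1 D z ->
  `|edot a w z| <= M * (\sum_i norm2 mu (w.2 i) * norm2 mu (z.2 i)).
Proof.
move=> [_ w2] [_ z2]; rewrite mulr_sumr.
apply: le_trans (ler_norm_sum _ _ _) _; apply: ler_sum => i _.
apply: le_trans (norm_dot_le (La (w2 i)) (z2 i)) _.
by rewrite mulrA ler_wpM2r ?norm2_ge0// norm2_bounded_mul.
Qed.

(** A weak solution exists by Riesz' theorem for the energy inner product, which
    is equivalent to the one of [H^1] by coercivity and Poincare's
    inequality. *)
Lemma energy_solution (i0 : 'I_d) f : sqint mu f ->
  exists2 w, in_H10 w & forall z, in_H10 z -> edot a w z = dot mu f z.1.
Proof.
move=> Lf; have [c c0 cP] := poincare.
have iL w : in_H10 w -> sqint1 D w by exact: in_H10_sqint1.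
have grad_le w i : sqint1 D w -> m * norm2 mu (w.2 i) ^+ 2 <= edot a w w.
  move=> Lw; apply: le_trans (edot_coercive Lw); apply: ler_wpM2l; first exact: ltW.
  by rewrite (bigD1 i)//= lerDl sumr_ge0// => j _; exact: sqr_ge0.
apply: (@riesz_representation _ _ in_H10 (edot a) _ _ _ _ (fun z => dot mu f z.1)
  (norm2 mu f ^+ 2 * (c ^+ 2 / m))).
- by move=> *; exact: in_H10ZD.
- by move=> *; exact: edotC.
- by move=> *; apply: edotZDl; exact: iL.
- by move=> *; apply: edot_ge0; exact: iL.
- by exists 0; exact: in_H10_0.
- move=> t u v /iL[Lu _] /iL[Lv _]; rewrite fstZD dotC dotZDl//.
  by rewrite !(dotC mu f).
- move=> u Hu; have [Lu _] := iL _ Hu.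
  apply: (@le_trans _ _ (norm2 mu f ^+ 2 * norm2 mu u.1 ^+ 2)).
    rewrite -exprMn -(real_normK (num_real (dot _ _ _))).
    by rewrite ler_sqr ?nnegrE ?mulr_ge0 ?norm2_ge0// norm_dot_le.
  rewrite -mulrA ler_wpM2l ?sqr_ge0//.
  apply: (@le_trans _ _ (c ^+ 2 * norm2 mu (u.2 i0) ^+ 2)).
    rewrite -exprMn ler_sqr ?nnegrE ?mulr_ge0 ?norm2_ge0//; last exact: ltW.
    exact: cP.
  rewrite -mulrA ler_wpM2l ?sqr_ge0// mulrC ler_pdivlMr// mulrC.
  by apply: grad_le; exact: iL.
- by rewrite mulr_ge0 ?sqr_ge0// divr_ge0 ?sqr_ge0// ltW.
move=> u Hu cu; have Lu n := iL _ (Hu n).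
have L2 n i : sqint mu ((u n).2 i) by case: (Lu n).
have L1 n : sqint mu (u n).1 by case: (Lu n).
have Hd n k : in_H10 (u n - u k) by exact: in_H10B.
have cauchy_grad i (e : R) : 0 < e -> exists N, forall n k, (N <= n)%N -> (N <= k)%N ->
    norm2 mu ((u n).2 i - (u k).2 i) ^+ 2 < e.
  move=> e0; have [|N NP] := cu (m * e); first by rewrite mulr_gt0.
  exists N => n k Nn Nk; rewrite -sndB -(ltr_pM2l m0).
  by apply: le_lt_trans (NP n k Nn Nk); apply: grad_le; exact: iL.
have cauchy_fun (e : R) : 0 < e -> exists N, forall n k, (N <= n)%N -> (N <= k)%N ->
    norm2 mu ((u n).1 - (u k).1) ^+ 2 < e.
  move=> e0; have c2 : 0 < c ^+ 2 by rewrite exprn_gt0.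
  have [|N NP] := cauchy_grad i0 (e / c ^+ 2); first by rewrite divr_gt0.
  exists N => n k Nn Nk; have := NP n k Nn Nk.
  rewrite ltr_pdivlMr// mulrC -exprMn; apply: le_lt_trans.
  rewrite -fstB -sndB ler_sqr ?nnegrE ?mulr_ge0 ?norm2_ge0//; last exact: ltW.
  exact: cP.
have [v Lv uv] := sqint_complete L1 cauchy_fun.
have /choice[g gP] : forall i, exists g, sqint mu g /\ forall e : R, 0 < e ->
    exists N, forall n, (N <= n)%N -> norm2 mu ((u n).2 i - g) ^+ 2 <= e.
  by move=> i; have [g] := sqint_complete (L2 ^~ i) (cauchy_grad i); exists g.
pose w : (T -> R) * ('I_d -> T -> R) := (v, g).
have Lw : sqint1 D w by split=> // i; have [] := gP i.
have Luw n : sqint1 D (u n - w) by exact: sqint1B.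
have uw (e : R) : 0 < e -> exists N, forall n, (N <= n)%N ->
    norm2 mu ((u n - w).1) ^+ 2 <= e /\
    \sum_i norm2 mu ((u n - w).2 i) ^+ 2 <= d%:R * e.
  move=> e0; have [N1 N1P] := uv e e0.
  have /choice[N2 N2P] : forall i, exists N, forall n, (N <= n)%N ->
      norm2 mu ((u n).2 i - g i) ^+ 2 <= e.
    by move=> i; have [_ /(_ e e0)] := gP i.
  exists (maxn N1 (\max_i N2 i)) => n; rewrite geq_max => /andP[n1 n2].
  split; first by rewrite fstB; exact: N1P.
  rewrite mulr_natl -[X in _ *+ X](card_ord d) -sumr_const.
  apply: ler_sum => i _; rewrite sndB; apply: N2P.
  by apply: leq_trans n2; exact: leq_bigmax.
have d0 : 0 < d%:R :> R by rewrite ltr0n; case: (d) i0 => // -[].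
exists w.
  apply: in_H10_closed => // e e0.
  have e2 : 0 < e ^+ 2 / (2 * (1 + d%:R)).
    by rewrite divr_gt0 ?exprn_gt0// mulr_gt0// addr_gt0.
  have [N NP] := uw _ e2; exists (u N) => //; have [h1 h2] := NP N (leqnn _).
  have -> : w - u N = (-1) *: (u N - w) by rewrite scaleN1r opprB.
  rewrite hnormZ// normrN normr1 mul1r -hnorm_lt// /hdot -sqr_norm2.
  under eq_bigr do rewrite -sqr_norm2.
  apply: (le_lt_trans (lerD h1 h2)).
  have -> : e ^+ 2 / (2 * (1 + d%:R)) + d%:R * (e ^+ 2 / (2 * (1 + d%:R))) = e ^+ 2 / 2.
    by field; rewrite gt_eqF// addr_gt0.
  by rewrite ltr_pdivrMr// ltr_pMr ?exprn_gt0// ltr1n.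
move=> e e0.
have e2 : 0 < e / ((M + 1) * (2 * d%:R)).
  by rewrite divr_gt0// !mulr_gt0// ltr_wpDl.
have [N NP] := uw _ e2; exists N => n Nn; have [_ h2] := NP n Nn.
apply: (le_lt_trans (ler_norm _)).
apply: (le_lt_trans (norm_edot_le (Luw n) (Luw n))).
under eq_bigr do rewrite -expr2.
apply: (@le_lt_trans _ _ ((M + 1) * (d%:R * (e / ((M + 1) * (2 * d%:R)))))).
  by rewrite ler_pM// ?lerDl// sumr_ge0// => i _; exact: sqr_ge0.
have -> : (M + 1) * (d%:R * (e / ((M + 1) * (2 * d%:R)))) = e / 2.
  by field; rewrite !gt_eqF// ltr_wpDl.
by rewrite ltr_pdivrMr// ltr_pMr// ltr1n.
Qed.

End energy.

End elliptic.

(** * Bounded coefficients *)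

Section coefficients.
Context {R : realType} {d : nat} (D : bounded_lipschitz_domain R d).
Local Notation mu := (lebesgue_domain D).
Local Notation T := (borel_rV R d).
Implicit Types (f g h : T -> R) (a b : Linfp D).

Definition essbdd f : Prop :=
  measurable_fun setT f /\ exists M : R, \forall x \ae mu, `|f x| <= M.

Lemma Linf_norm_ge0 f : 0 <= Linf_norm D f.
Proof. by rewrite fine_ge0// Lnorm_ge0. Qed.

Lemma Linf_norm_le f (M : R) : 0 <= M -> {ae mu, forall x, `|f x| <= M} ->
  Linf_norm D f <= M.
Proof.
move=> M0 fM; rewrite /Linf_norm.
have : ('N[mu]_+oo[EFin \o f] <= M%:E)%E.
  rewrite unlock; case: ifP => _; last by rewrite lee_fin.
  apply/ess_supP; apply: (aeS fM) => x /=.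
  by rewrite lee_fin.
have := Lnorm_ge0 mu +oo%E (EFin \o f).
by case: ('N[_]_ _ [_])%E.
Qed.

Lemma Linf_normP f : essbdd f -> {ae mu, forall x, `|f x| <= Linf_norm D f}.
Proof.
move=> [mf [M fM]]; rewrite /Linf_norm unlock; case: ifPn => mu0; last first.
  exists setT; split => //.
  by apply/eqP; rewrite -measure_le0 leNgt.
have h : (ess_sup mu (abse \o (EFin \o f)) <= M%:E)%E.
  apply/ess_supP; apply: (aeS fM) => x /=.
  by rewrite lee_fin.
have h0 : (0 <= ess_sup mu (abse \o (EFin \o f)))%E.
  by apply: ess_sup_gee => //; apply: (aeS fM) => x _; rewrite lee_fin.
have hge := ess_sup_ge mu (abse \o (EFin \o f)).
apply: (aeS hge) => x /=.
rewrite -lee_fin fineK// ge0_fin_numE//.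
by apply: le_lt_trans h _; rewrite ltry.
Qed.

Lemma essbddB f g : essbdd f -> essbdd g -> essbdd (fun x => f x - g x).
Proof.
move=> [mf [M fM]] [mg [M' gM]]; split; first exact: measurable_funB.
exists (M + M'); apply: (aeS2 fM gM) => x fx gx.
by apply: le_trans (ler_normB _ _) _; apply: lerD.
Qed.

Lemma Linf_norm_triangle f g h : essbdd f -> essbdd g -> essbdd h ->
  Linf_norm D (fun x => f x - h x) <=
  Linf_norm D (fun x => f x - g x) + Linf_norm D (fun x => g x - h x).
Proof.
move=> bf bg bh; apply: Linf_norm_le; first by rewrite addr_ge0 ?Linf_norm_ge0.
apply: (aeS2 (Linf_normP (essbddB bf bg)) (Linf_normP (essbddB bg bh))) => x.
by move=> h1 h2; rewrite -(subrKA (g x)) (le_trans (ler_normD _ _))// lerD.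
Qed.

Lemma Linf_norm_sym f g :
  Linf_norm D (fun x => f x - g x) = Linf_norm D (fun x => g x - f x).
Proof.
rewrite /Linf_norm -[in RHS](oppe_Lnorm mu); congr (fine (Lnorm mu +oo%E _)).
by apply/funext => x /=; rewrite opprB.
Qed.

Lemma eq_Linf_norm_ae f g : essbdd f -> essbdd g -> f = g %[ae mu] ->
  Linf_norm D f = Linf_norm D g.
Proof.
move=> bf bg fg; apply/eqP; rewrite eq_le; apply/andP; split.
  apply: Linf_norm_le; first exact: Linf_norm_ge0.
  by apply: (aeS2 (Linf_normP bg) fg) => x + /(_ I) ->.
apply: Linf_norm_le; first exact: Linf_norm_ge0.
by apply: (aeS2 (Linf_normP bf) fg) => x + /(_ I) <-.
Qed.

Lemma Lfun_essbdd f : (f \in Lfun mu +oo%E) <-> essbdd f.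
Proof.
split.
  rewrite inE/= => /andP[/[!inE]/= mf]; rewrite /finite_norm unlock.
  case: ifPn => mu0 fy.
    by split=> //; have [M MP] := ess_supr_bounded fy; exists M.
  split => //; exists 0; exists setT; split => //.
  by apply/eqP; rewrite -measure_le0 leNgt.
move=> [mf [M fM]]; rewrite inE/=; apply/andP; split; rewrite inE//=.
rewrite /finite_norm unlock; case: ifPn => // mu0.
apply: (@le_lt_trans _ _ M%:E); last exact: ltry.
apply/ess_supP; apply: (aeS fM) => x /=.
by rewrite lee_fin.
Qed.

Lemma Linf_essbdd (f : LspaceType mu (leey 1%E)) : essbdd f.
Proof.
apply/Lfun_essbdd; rewrite inE/=; apply/andP; split; rewrite inE/=.
  exact: (@measurable_funPT _ _ _ (measurableTypeR R)
    (repr (f : {mfun_ mu, T >-> measurableTypeR R}))).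
exact: Lebesgue_finite.
Qed.

Lemma Lspace_ofE (p : \bar R) (p1 : (1 <= p)%E) f : f \in Lfun mu p ->
  f = (Lspace_of mu p1 f : T -> R) %[ae mu].
Proof.
rewrite /Lspace_of => fL; case: pselect => [fL'|//].
exact: (LclassE (Lfun_Sub p1 fL')).
Qed.

Lemma Linfp_pos a : exists2 m : R, 0 < m & {ae mu, forall x, m <= a x}.
Proof.
have := Linfp_gt0 a; have := ess_inf_le mu (EFin \o a).
case: (ess_inf _ _) => [r| |] h; rewrite ?lte_fin// => r0.
  by exists r => //; apply: (aeS h) => x /=; rewrite lee_fin.
by exists 1 => //; apply: (aeS h) => x /=; rewrite leye_eq.
Qed.

Lemma essbdd_ln a : essbdd (fun x => ln (a x)).
Proof.
have [ma [M aM]] := Linf_essbdd a; have [m m0 am] := Linfp_pos a.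
split; first by apply: measurableT_comp => //; exact: measurable_ln.
exists (`|ln m| + `|ln M|); apply: (aeS2 aM am) => x axM axm.
have ax0 : 0 < a x by exact: lt_le_trans axm.
have lm : ln m <= ln (a x) by rewrite ler_ln ?posrE.
have lM : ln (a x) <= ln M.
  have axM' := le_trans (ler_norm _) axM.
  by rewrite ler_ln ?posrE// (lt_le_trans ax0).
rewrite ler_norml; apply/andP; split.
  by apply: le_trans lm; rewrite lerNl; have := ler_norm (- ln m); rewrite normrN; have := normr_ge0 (ln M); lra.
by apply: le_trans lM _; have := ler_norm (ln M); have := normr_ge0 (ln m); lra.
Qed.

(** Its exponential bounds [a] and [1 / a] at once, and for a lognormal
    coefficient it is the supremum norm of a Gaussian field. *)
Definition lognorm a : R := Linf_norm D (fun x => ln (a x)).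

Lemma lognorm_ge0 a : 0 <= lognorm a. Proof. exact: Linf_norm_ge0. Qed.

Lemma lognorm_bounds a :
  {ae mu, forall x, expR (- lognorm a) <= a x <= expR (lognorm a)}.
Proof.
have [m m0 am] := Linfp_pos a.
apply: (aeS2 (Linf_normP (essbdd_ln a)) am) => x ax axm.
have ax0 : 0 < a x by exact: lt_le_trans axm.
by move: ax; rewrite ler_norml -/(lognorm a) -[in X in _ -> X](lnK ax0) !ler_expR.
Qed.

Lemma lognorm_logdist a b : lognorm a <= lognorm b + Linfp_logdist a b.
Proof.
apply: Linf_norm_le; first by rewrite addr_ge0 ?lognorm_ge0 ?Linf_norm_ge0.
apply: (aeS2 (Linf_normP (essbdd_ln b))
  (Linf_normP (essbddB (essbdd_ln a) (essbdd_ln b)))) => x h1 h2.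
by rewrite -(subrK (ln (b x)) (ln (a x))) addrC (le_trans (ler_normD _ _))// lerD.
Qed.

Lemma expR_lipschitz (s t c : R) : s <= c -> t <= c ->
  `|expR s - expR t| <= expR c * `|s - t|.
Proof.
wlog st : s t / t <= s => [H sc tc|sc tc].
  have [ts|st] := leP t s; first exact: H.
  by rewrite distrC (distrC s); apply: H => //; exact: ltW.
rewrite !ger0_norm ?subr_ge0 ?ler_expR//.
have h : (1 + (t - s)) * expR s <= expR t.
  have -> : expR t = expR (t - s) * expR s by rewrite -expRD subrK.
  by rewrite ler_wpM2r ?expR_ge0// expR_ge1Dx.
have h' : expR s * (s - t) <= expR c * (s - t).
  by rewrite ler_wpM2r ?subr_ge0 ?ler_expR.
nra.
Qed.

Lemma Linfp_dist_log a b :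
  Linfp_dist a b <= expR (Num.max (lognorm a) (lognorm b)) * Linfp_logdist a b.
Proof.
apply: Linf_norm_le; first by rewrite mulr_ge0 ?expR_ge0 ?Linf_norm_ge0.
have [m m0 am] := Linfp_pos a; have [m' m'0 bm] := Linfp_pos b.
have h1 := aeI (Linf_normP (essbdd_ln a)) am.
have h2 := aeI (Linf_normP (essbdd_ln b)) bm.
have h3 := aeI h1 h2.
apply: (aeS2 h3 (Linf_normP (essbddB (essbdd_ln a) (essbdd_ln b)))).
move=> x [[ax axm] [bx bxm]] lx.
have ax0 : 0 < a x by exact: lt_le_trans axm.
have bx0 : 0 < b x by exact: lt_le_trans bxm.
rewrite -{1}(lnK ax0) -{1}(lnK bx0).
apply: le_trans (expR_lipschitz (c := Num.max (lognorm a) (lognorm b)) _ _) _.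
- by rewrite le_max (le_trans (ler_norm _) ax).
- by rewrite le_max (le_trans (ler_norm _) bx) ?orbT.
- by rewrite ler_wpM2l// expR_ge0.
Qed.

(** Where [a] and [b] are both at least [exp (- lognorm b) / 2], the logarithm is
    Lipschitz with the inverse of that constant. *)
Lemma Linfp_logdist_dist a b : Linfp_dist a b <= expR (- lognorm b) / 2 ->
  Linfp_logdist a b <= 2 * expR (lognorm b) * Linfp_dist a b.
Proof.
move=> small; apply: Linf_norm_le.
  by rewrite !mulr_ge0 ?expR_ge0 ?Linf_norm_ge0.
have [m m0 am] := Linfp_pos a.
have h1 := aeI (lognorm_bounds b) am.
apply: (aeS2 h1 (Linf_normP (essbddB (Linf_essbdd a) (Linf_essbdd b)))).
rewrite -/(Linfp_dist a b) => x [/andP[bx _] axm] abx.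
have e0 := expR_gt0 (- lognorm b).
have := le_trans abx small; rewrite ler_norml => /andP[ab1 ab2].
have ax : expR (- lognorm b) / 2 <= a x by lra.
have ax0 : 0 < a x by lra.
have bx0 : 0 < b x by lra.
have bx' : expR (- lognorm b) / 2 <= b x by lra.
set e := expR (- lognorm b) / 2 in ax bx' *.
have ee : 2 * expR (lognorm b) = e^-1 by rewrite /e invf_div expRN invrK mulrC.
have ep : 0 < e by rewrite /e divr_gt0.
rewrite ee.
have key (s t : R) : e <= s -> e <= t -> ln s - ln t <= e^-1 * `|s - t|.
  move=> es et; have s0 : 0 < s by exact: lt_le_trans es.
  have t0 : 0 < t by exact: lt_le_trans et.
  rewrite -ln_div ?posrE//.
  apply: (@le_trans _ _ (s / t - 1)).
    rewrite -{1}(subrK 1 (s / t)) addrC le_ln1Dx// ltrBrDr addNr.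
    by rewrite divr_gt0.
  have -> : s / t - 1 = t^-1 * (s - t) by field; rewrite gt_eqF.
  apply: (@le_trans _ _ (t^-1 * `|s - t|)).
    by rewrite ler_wpM2l ?invr_ge0 ?ler_norm// ltW.
  by rewrite ler_wpM2r// lef_pV2 ?posrE.
apply: (@le_trans _ _ (e^-1 * `|a x - b x|)); last first.
  by rewrite ler_wpM2l ?invr_ge0// ltW.
by rewrite ler_norml lerNl opprB key//= distrC key.
Qed.

End coefficients.

(** * Weak solutions and their stability *)

Section stability.
Context {R : realType} {d : nat} (D : bounded_lipschitz_domain R d).
Local Notation mu := (lebesgue_domain D).
Local Notation T := (borel_rV R d).
Implicit Types (f g : L2 D) (a b : Linfp D) (u v : H10 D).

Lemma L2_sqint f : sqint mu (f : T -> R).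
Proof.
apply/sqint_Lfun; rewrite inE/=; apply/andP; split; rewrite inE/=.
  exact: (@measurable_L2 R d D f).
exact: Lebesgue_finite.
Qed.

Lemma L2_normE (h : T -> R) : sqint mu h -> L2_norm D h = norm2 mu h.
Proof. by move=> [mh _]; rewrite -norm2E. Qed.

Lemma L2_distE f g : L2_dist f g = norm2 mu ((f : T -> R) - (g : T -> R)).
Proof. by rewrite -L2_normE//; apply: sqintB; exact: L2_sqint. Qed.

Definition fun_grad u : (T -> R) * ('I_d -> T -> R) :=
  (u : T -> R, fun i => H10_grad u i : T -> R).

Lemma fun_grad_sqint1 u : sqint1 D (fun_grad u).
Proof. by split=> [|i]; exact: L2_sqint. Qed.

Lemma fun_grad_in_H10 u : in_H10 D (fun_grad u).
Proof.
split; first exact: fun_grad_sqint1.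
- by move=> i phi tphi; exact: (H10_weak u i tphi).
- move=> e e0; have [phi tphi h] := H10_approx u e0; exists phi => //.
  have [Lp Lpi] := test_function_sqint tphi.
  move: h; rewrite L2_normE; last by apply: sqintB => //; exact: L2_sqint.
  rewrite sqr_norm2.
  under eq_bigr => i _.
    rewrite L2_normE ?sqr_norm2; last by apply: sqintB => //; exact: L2_sqint.
    over.
  by [].
Qed.

Lemma H10_distE u v : H10_dist u v = hnorm D (fun_grad u - fun_grad v).
Proof.
rewrite /H10_dist /hnorm /hdot; congr (Num.sqrt (_ + _)).
  by rewrite L2_normE ?sqr_norm2//; apply: sqintB; exact: L2_sqint.
apply: eq_bigr => i _.
by rewrite L2_normE ?sqr_norm2//; apply: sqintB; exact: L2_sqint.
Qed.

Lemma in_H10_record (w : (T -> R) * ('I_d -> T -> R)) : in_H10 D w ->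
  exists u, (w.1 = (u : T -> R) %[ae mu]) /\
    forall i, w.2 i = (H10_grad u i : T -> R) %[ae mu].
Proof.
move=> [[w1 w2] ww aw].
pose u0 : L2 D := Lspace_of mu (lee1n 2) w.1.
pose g0 i : L2 D := Lspace_of mu (lee1n 2) (w.2 i).
have E1 : w.1 = (u0 : T -> R) %[ae mu] by apply: Lspace_ofE; apply/sqint_Lfun.
have E2 i : w.2 i = (g0 i : T -> R) %[ae mu].
  by apply: Lspace_ofE; apply/sqint_Lfun.
have L0 := L2_sqint u0; have Lg i := L2_sqint (g0 i).
have W i : weak_partial i u0 (g0 i).
  move=> phi tphi; have [Lp Lpi] := test_function_sqint tphi.
  have := ww i phi tphi.
  by rewrite (dot_ael w1 L0 (Lpi i) E1) (dot_ael (w2 i) (Lg i) Lp (E2 i)).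
have A (e : R) : 0 < e -> exists2 phi, test_function D phi &
    L2_norm D (fun x => u0 x - phi x) ^+ 2 +
    \sum_i L2_norm D (fun x => g0 i x - partial i phi x) ^+ 2 < e ^+ 2.
  move=> e0; have [phi tphi h] := aw e e0; exists phi => //.
  have [Lp Lpi] := test_function_sqint tphi.
  have B (f f' k : T -> R) : sqint mu f -> sqint mu f' -> sqint mu k ->
      f = f' %[ae mu] -> L2_norm D (fun x => f' x - k x) ^+ 2 = dot mu (f - k) (f - k).
    move=> Lf Lf' Lk ff'; rewrite L2_normE; last exact: sqintB.
    rewrite -sqr_norm2; congr (_ ^+ 2); apply/esym; apply: norm2_ae; try exact: sqintB.
    by apply: (aeS ff') => x /= E /E {}E; rewrite -E.
  rewrite (B w.1)//; under eq_bigr => i _ do rewrite (B (w.2 i))//.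
  exact: h.
by exists (MkH10 W A).
Qed.

(** The sum over the coordinates may be taken out of the integral, since each
    summand is a product of two square integrable functions. *)
Lemma weak_solutionE a f u : weak_solution a f u <->
  forall v, edot D (a : T -> R) (fun_grad u) (fun_grad v) = dot mu f (v : T -> R).
Proof.
have [ma [M aM]] := Linf_essbdd a.
have La (h : T -> R) : sqint mu h -> sqint mu ((a : T -> R) * h).
  exact: sqint_bounded_mul aM.
have E v : \int[mu]_x (a x * \sum_i H10_grad u i x * H10_grad v i x) =
    edot D (a : T -> R) (fun_grad u) (fun_grad v).
  transitivity (\int[mu]_x (\sum_(i < d)
      ((a : T -> R) * (H10_grad u i : T -> R)) x * H10_grad v i x)).
    apply: eq_Rintegral => x _; rewrite mulr_sumr.
    by apply: eq_bigr => i _; rewrite mulrA.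
  have I i : mu.-integrable setT (EFin \o (fun x =>
      ((a : T -> R) * (H10_grad u i : T -> R)) x * H10_grad v i x)).
    by apply: integrable_dot; [apply: La|]; exact: L2_sqint.
  rewrite /Rintegral; under eq_integral do rewrite -sumEFin.
  rewrite integral_sum// -sum_fine// => i _.
  exact: (integrable_fin_num measurableT (I i)).
by split=> h v; have := h v; rewrite E.
Qed.

Lemma Linfp_coefficient a :
  [/\ measurable_fun setT (a : T -> R), 0 < expR (- lognorm a),
      0 <= expR (lognorm a),
      {ae mu, forall x, expR (- lognorm a) <= a x} &
      {ae mu, forall x, `|a x| <= expR (lognorm a)}].
Proof.
have [ma _] := Linf_essbdd a; split; rewrite ?expR_gt0 ?expR_ge0//.
  by apply: (aeS (lognorm_bounds a)) => x /andP[].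
apply: (aeS (lognorm_bounds a)) => x /andP[h1 h2].
by rewrite ger0_norm// (le_trans _ h1)// expR_ge0.
Qed.

Lemma weak_solution_exists (i0 : 'I_d) a f : exists u, weak_solution a f u.
Proof.
have [ma m0 M0 am aM] := Linfp_coefficient a.
have [w Hw wP] := energy_solution ma m0 M0 am aM i0 (L2_sqint f).
have [u [uw gw]] := in_H10_record Hw; exists u.
apply/weak_solutionE => v; rewrite -(wP _ (fun_grad_in_H10 v)).
have [Lw1 Lw2] := in_H10_sqint1 Hw.
apply: eq_bigr => i _; apply: dot_ael; last 1 first.
- by apply: (aeS (gw i)) => x /= /[apply] E; rewrite !fctE/= E.
- by apply: sqint_bounded_mul aM _ => //; exact: L2_sqint.
- exact: sqint_bounded_mul aM _.
- exact: L2_sqint.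
Qed.

Lemma solution_operatorP (i0 : 'I_d) a f :
  weak_solution a f (solution_operator (a, f)).
Proof. by apply: getPex; exact: weak_solution_exists. Qed.

Definition grad_norm (w : (T -> R) * ('I_d -> T -> R)) : R :=
  Num.sqrt (\sum_i norm2 mu (w.2 i) ^+ 2).

Lemma grad_norm_ge0 w : 0 <= grad_norm w. Proof. exact: sqrtr_ge0. Qed.

Lemma sqr_grad_norm w : grad_norm w ^+ 2 = \sum_i norm2 mu (w.2 i) ^+ 2.
Proof. by rewrite sqr_sqrtr// sumr_ge0// => i _; exact: sqr_ge0. Qed.

Lemma norm2_le_grad_norm w i : norm2 mu (w.2 i) <= grad_norm w.
Proof.
rewrite -ler_sqr ?nnegrE ?norm2_ge0 ?grad_norm_ge0// sqr_grad_norm.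
by rewrite (bigD1 i)//= lerDl sumr_ge0// => j _; exact: sqr_ge0.
Qed.

Lemma hnorm_le_grad_norm (i0 : 'I_d) (c : R) w : 0 <= c ->
  norm2 mu w.1 <= c * norm2 mu (w.2 i0) -> hnorm D w <= (c + 1) * grad_norm w.
Proof.
move=> c0 wc.
have g0 := grad_norm_ge0 w.
have h : norm2 mu w.1 <= c * grad_norm w.
  by apply: (le_trans wc); rewrite ler_wpM2l// norm2_le_grad_norm.
rewrite -ler_sqr ?nnegrE ?mulr_ge0 ?sqrtr_ge0 ?addr_ge0//.
rewrite sqr_hnorm /hdot -sqr_norm2; under eq_bigr do rewrite -sqr_norm2.
rewrite -sqr_grad_norm.
have : norm2 mu w.1 ^+ 2 <= (c * grad_norm w) ^+ 2.
  by rewrite ler_sqr ?nnegrE ?mulr_ge0 ?norm2_ge0.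
have : 0 <= c * grad_norm w ^+ 2 by rewrite mulr_ge0 ?sqr_ge0.
rewrite !exprMn; nra.
Qed.

Lemma weak_solution_in_H10 a f u z : weak_solution a f u -> in_H10 D z ->
  edot D (a : T -> R) (fun_grad u) z = dot mu f z.1.
Proof.
move=> /weak_solutionE uP Hz; have [Lz1 Lz2] := in_H10_sqint1 Hz.
have [v [zv gv]] := in_H10_record Hz.
have [ma _ _ _ aM] := Linfp_coefficient a.
rewrite (dotC mu) (dot_ael Lz1 (L2_sqint v) (L2_sqint f) zv) -(dotC mu) -uP.
apply: eq_bigr => i _; rewrite dotC [RHS]dotC; apply: dot_ael (gv i) => //.
  exact: L2_sqint.
by apply: sqint_bounded_mul aM _ => //; exact: L2_sqint.
Qed.

Lemma edotB a b w z : sqint1 D w -> sqint1 D z ->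
  edot D ((a : T -> R) - (b : T -> R)) w z =
  edot D (a : T -> R) w z - edot D (b : T -> R) w z.
Proof.
move=> [_ w2] [_ z2].
have [ma _ _ _ aM] := Linfp_coefficient a.
have [mb _ _ _ bM] := Linfp_coefficient b.
rewrite /edot -sumrB; apply: eq_bigr => i _; rewrite -dotBl//.
- by congr (dot _ _ _); apply/funext => x; rewrite !fctE/= mulrBl.
- exact: sqint_bounded_mul aM _.
- exact: sqint_bounded_mul bM _.
Qed.

(** The a priori estimate and the stability estimate test the equations with
    the solution and with the difference of the solutions. *)
Lemma solution_stability (i0 : 'I_d) : exists2 K : R, 0 < K &
  forall a1 a2 f1 f2,
  H10_dist (solution_operator (a1, f1)) (solution_operator (a2, f2)) <=
    K * (expR (lognorm a1) * norm2 mu f1 + expR (lognorm a2) * norm2 mu f2) /\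
  H10_dist (solution_operator (a1, f1)) (solution_operator (a2, f2)) <=
    K * (expR (lognorm a1) *
      (L2_dist f1 f2 + Linfp_dist a1 a2 * (expR (lognorm a2) * norm2 mu f2))).
Proof.
have [c c0 cP] := poincare D.
have fst_le w : in_H10 D w -> norm2 mu w.1 <= c * grad_norm w.
  move=> Hw; apply: (le_trans (cP w i0 Hw)); apply: ler_wpM2l; first exact: ltW.
  exact: norm2_le_grad_norm.
have hn_le w : in_H10 D w -> hnorm D w <= (c + 1) * grad_norm w.
  by move=> Hw; apply: (hnorm_le_grad_norm (ltW c0) (cP w i0 Hw)).
have coercive a w (B : R) : sqint1 D w ->
    edot D (a : T -> R) w w <= B * grad_norm w ->
    grad_norm w <= expR (lognorm a) * B \/ grad_norm w = 0.
  move=> Lw wB; have [->|gn0] := eqVneq (grad_norm w) 0; [by right|left].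
  have gp : 0 < grad_norm w by rewrite lt_neqAle eq_sym gn0 grad_norm_ge0.
  have [ma m0 M0 am aM] := Linfp_coefficient a.
  have cw : expR (- lognorm a) * (\sum_i norm2 mu (w.2 i) ^+ 2) <=
      edot D (a : T -> R) w w by exact: (edot_coercive ma am aM Lw).
  have := le_trans cw wB.
  rewrite -sqr_grad_norm expr2 mulrA ler_pM2r// -ler_pdivlMl//.
  by rewrite expRN invrK.
have apriori a f u : weak_solution a f u ->
    grad_norm (fun_grad u) <= c * (expR (lognorm a) * norm2 mu f).
  move=> uP; have Hu := fun_grad_in_H10 u; have Lu := in_H10_sqint1 Hu.
  have [||->] := coercive a _ (c * norm2 mu f) Lu.
  - rewrite (weak_solution_in_H10 uP Hu).
    apply: (le_trans (ler_norm _)).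
    apply: le_trans (norm_dot_le (L2_sqint f) (L2_sqint u)) _.
    rewrite mulrAC (mulrC (norm2 mu f)) ler_wpM2r ?norm2_ge0//.
    exact: (fst_le _ Hu).
  - by rewrite mulrCA.
  - by rewrite !mulr_ge0 ?norm2_ge0 ?expR_ge0// ltW.
exists ((c + 1) * c * (d%:R + 1)); first by rewrite !mulr_gt0// ?(addr_gt0 c0)// ltr_wpDl.
move=> a1 a2 f1 f2.
have P1 := solution_operatorP i0 a1 f1; have P2 := solution_operatorP i0 a2 f2.
set u1 := solution_operator (a1, f1) in P1 *.
set u2 := solution_operator (a2, f2) in P2 *.
have H1 := fun_grad_in_H10 u1; have H2 := fun_grad_in_H10 u2.
have L1 := in_H10_sqint1 H1; have L2 := in_H10_sqint1 H2.
have A1 := apriori _ _ _ P1; have A2 := apriori _ _ _ P2.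
have c1 : 0 < c + 1 by rewrite addr_gt0.
have d0 : 0 <= d%:R :> R by [].
have E1 := expR_gt0 (lognorm a1); have E2 := expR_gt0 (lognorm a2).
have F1 := norm2_ge0 mu f1; have F2 := norm2_ge0 mu f2.
have B1 : 0 <= expR (lognorm a1) * norm2 mu f1 by rewrite mulr_ge0// ltW.
have B2 : 0 <= expR (lognorm a2) * norm2 mu f2 by rewrite mulr_ge0// ltW.
have K0 : 0 <= (c + 1) * c by rewrite mulr_ge0// ltW.
rewrite H10_distE; split.
  have -> : fun_grad u1 - fun_grad u2 = fun_grad u1 + (-1) *: fun_grad u2.
    by rewrite scaleN1r.
  have LN : sqint1 D ((-1) *: fun_grad u2).
    rewrite -[_ *: _]addr0; apply: sqint1ZD => //.
    by apply: in_H10_sqint1; exact: in_H10_0.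
  apply: (le_trans (hnormD L1 LN)); rewrite hnormZ// normrN normr1 mul1r.
  apply: (@le_trans _ _ ((c + 1) * c * (expR (lognorm a1) * norm2 mu f1 +
      expR (lognorm a2) * norm2 mu f2))).
    rewrite mulrDr -!(mulrA (c + 1)); apply: lerD.
      by apply: (le_trans (hn_le _ H1)); rewrite ler_pM2l.
    by apply: (le_trans (hn_le _ H2)); rewrite ler_pM2l.
  by rewrite ler_wpM2r ?addr_ge0// ler_peMr// lerDr.
pose w := fun_grad u1 - fun_grad u2.
have Hw : in_H10 D w by exact: in_H10B.
have Lw := in_H10_sqint1 Hw.
have Df := sqintB (L2_sqint f1) (L2_sqint f2).
have dF0 : 0 <= L2_dist f1 f2 by rewrite L2_distE norm2_ge0.
set delta := Linfp_dist a1 a2.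
have delta0 : 0 <= delta by exact: Linf_norm_ge0.
have [ma1 m1 M1 am1 aM1] := Linfp_coefficient a1.
have [ma2 m2 M2 am2 aM2] := Linfp_coefficient a2.
have G0 := grad_norm_ge0 w.
pose B := c * L2_dist f1 f2 + delta * (d%:R * grad_norm (fun_grad u2)).
have en : edot D (a1 : T -> R) w w <= B * grad_norm w.
  have -> : edot D (a1 : T -> R) w w = dot mu ((f1 : T -> R) - (f2 : T -> R)) w.1
      - edot D ((a1 : T -> R) - (a2 : T -> R)) (fun_grad u2) w.
    rewrite edotB// dotBl; try exact: L2_sqint; last by case: Lw.
    rewrite -(weak_solution_in_H10 P1 Hw) -(weak_solution_in_H10 P2 Hw).
    rewrite {1}/w -[fun_grad u1 - _]addrC -scaleN1r (edotZDl ma1 aM1)// mulN1r.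
    move: (edot D a1 (fun_grad u1) w) (edot D a1 (fun_grad u2) w)
      (edot D a2 (fun_grad u2) w) => x y z.
    by rewrite opprB addrA subrK addrC.
  rewrite mulrDl; apply: lerD.
    apply: (le_trans (ler_norm _)).
    apply: le_trans (norm_dot_le Df Lw.1) _; rewrite -L2_distE mulrAC (mulrC _ (L2_dist _ _)).
    by rewrite ler_wpM2l//; exact: (fst_le _ Hw).
  have [bd1 bd2] := essbddB (Linf_essbdd a1) (Linf_essbdd a2).
  have bd := Linf_normP (essbddB (Linf_essbdd a1) (Linf_essbdd a2)).
  apply: (le_trans (ler_norm _)); rewrite normrN.
  apply: le_trans (@norm_edot_le _ _ D _ delta bd1 delta0 bd _ _ L2 Lw) _.
  rewrite -!mulrA ler_wpM2l// mulr_natl -[X in _ *+ X](card_ord d) -sumr_const.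
  by apply: ler_sum => i _; rewrite ler_pM ?norm2_ge0 ?norm2_le_grad_norm.
have B0 : 0 <= B by rewrite addr_ge0 ?mulr_ge0 ?grad_norm_ge0// ltW.
have G_le : grad_norm w <= expR (lognorm a1) * B.
  by have [//|->] := coercive a1 w B Lw en; rewrite mulr_ge0// ltW.
have h : d%:R * grad_norm (fun_grad u2) <=
    c * (d%:R + 1) * (expR (lognorm a2) * norm2 mu f2).
  apply: (@le_trans _ _ (d%:R * (c * (expR (lognorm a2) * norm2 mu f2)))).
    by rewrite ler_wpM2l.
  rewrite mulrA (mulrC c) ler_wpM2r// ler_wpM2r ?lerDl//; exact: ltW.
pose X := L2_dist f1 f2 + delta * (expR (lognorm a2) * norm2 mu f2).
have BX : B <= c * (d%:R + 1) * X.
  rewrite /B /X mulrDr; apply: lerD; last by rewrite [leRHS]mulrCA ler_wpM2l.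
  by rewrite -mulrA ler_pM2l// ler_peMl// lerDr.
apply: (le_trans (hn_le _ Hw)); rewrite -/X.
have -> : (c + 1) * c * (d%:R + 1) * (expR (lognorm a1) * X) =
    (c + 1) * (expR (lognorm a1) * (c * (d%:R + 1) * X)).
  by move: (X) (expR _) => x y; ring.
by rewrite ler_pM2l// (le_trans G_le)// ler_pM2l.
Qed.

End stability.

(** * Continuity of the solution operator *)

Section pseudometric.
Context {R : realType}.

Record pseudometric (T : Type) (dist : T -> T -> R) : Prop := Pseudometric {
  pseudometric_ge0 : forall x y, 0 <= dist x y ;
  pseudometric_sym : forall x y, dist x y = dist y x ;
  pseudometric_triangle : forall x y z, dist x z <= dist x y + dist y z }.

Lemma pseudometric_sum (S T : Type) (dS : S -> S -> R) (dT : T -> T -> R) :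
  pseudometric dS -> pseudometric dT -> pseudometric (sum_dist dS dT).
Proof.
move=> [S0 SC SD] [T0 TC TD]; split=> [x y|x y|x y z]; rewrite /sum_dist.
- by rewrite addr_ge0.
- by rewrite SC TC.
- by rewrite addrACA lerD.
Qed.

Lemma measurable_sum_dist_fst (S T : pointedType) (dS : S -> S -> R) (dT : T -> T -> R) :
  pseudometric dT ->
  measurable_fun [set: borelType (sum_dist dS dT)] (fst : _ -> borelType dS).
Proof.
move=> mT; apply: measurable_borelType => x e e0; exists e => // y.
by apply: le_lt_trans; rewrite lerDl (pseudometric_ge0 mT).
Qed.

Lemma measurable_sum_dist_snd (S T : pointedType) (dS : S -> S -> R) (dT : T -> T -> R) :
  pseudometric dS ->
  measurable_fun [set: borelType (sum_dist dS dT)] (snd : _ -> borelType dT).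
Proof.
move=> mS; apply: measurable_borelType => x e e0; exists e => // y.
by apply: le_lt_trans; rewrite lerDr (pseudometric_ge0 mS).
Qed.

Lemma measurable_dist (T : pointedType) (dist : T -> T -> R) : pseudometric dist ->
  measurable_fun [set: borelType (sum_dist dist dist)]
    ((fun z => dist z.1 z.2) : borelType (sum_dist dist dist) -> R).
Proof.
move=> [d0 dC dD]; apply: measurable_borelType_real => -[x1 x2] e e0.
exists e => // -[y1 y2] /=; rewrite /sum_dist/= => xy.
apply: le_lt_trans xy; rewrite ler_norml; apply/andP; split.
  have := dD y1 x1 y2; have := dD x1 x2 y2; rewrite (dC y1 x1); lra.
have := dD x1 y1 x2; have := dD y1 y2 x2; rewrite (dC y2 x2); lra.
Qed.

End pseudometric.

Section continuity.
Context {R : realType} {d : nat} (D : bounded_lipschitz_domain R d).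
Local Notation mu := (lebesgue_domain D).
Local Notation T := (borel_rV R d).
Implicit Types (f g : L2 D) (a b : Linfp D) (u v : H10 D).

Lemma pseudometric_L2 : pseudometric (@L2_dist R d D).
Proof.
split=> [f g|f g|f g h]; rewrite !L2_distE; first exact: norm2_ge0.
  rewrite /norm2; congr Num.sqrt; apply: eq_Rintegral => x _.
  by rewrite !fctE/= -opprB mulrNN.
have Lf := L2_sqint f; have Lg := L2_sqint g; have Lh := L2_sqint h.
apply: le_trans (norm2D (sqintB Lf Lg) (sqintB Lg Lh)).
by rewrite addrA subrK.
Qed.

Lemma pseudometric_H10 : pseudometric (@H10_dist R d D).
Proof.
have L u := fun_grad_sqint1 u.
split=> [u v|u v|u v w]; rewrite !H10_distE; first exact: sqrtr_ge0.
  rewrite -opprB -scaleN1r hnormZ ?normrN ?normr1 ?mul1r//.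
  exact: sqint1B.
apply: le_trans (hnormD (sqint1B (L u) (L v)) (sqint1B (L v) (L w))).
by rewrite addrA subrK.
Qed.

Lemma norm2_L2_lipschitz f g : norm2 mu f <= norm2 mu g + L2_dist f g.
Proof.
have Lf := L2_sqint f; have Lg := L2_sqint g.
rewrite L2_distE addrC; apply: le_trans (norm2D (sqintB Lf Lg) Lg).
by rewrite subrK.
Qed.

(** Both metrics on the coefficients are treated alike: at distances small
    compared with [exp (- lognorm b)] they control the logarithmic and the
    linear distance. *)
Record coefficient_metric (dA : Linfp D -> Linfp D -> R) : Prop :=
  CoefficientMetric {
  coefficient_pseudometric : pseudometric dA ;
  coefficient_near : forall a b, dA a b <= expR (- lognorm b) / 2 ->
    [/\ Linfp_logdist a b <= 1, Linfp_logdist a b <= 2 * expR (lognorm b) * dA a b &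
        Linfp_dist a b <= expR (lognorm b + 1) * dA a b] }.

Lemma near_dist a b : Linfp_logdist a b <= 1 ->
  Linfp_dist a b <= expR (lognorm b + 1) * Linfp_logdist a b.
Proof.
move=> l1; apply: (le_trans (Linfp_dist_log a b)).
rewrite ler_wpM2r ?Linf_norm_ge0// ler_expR ge_max lerDl ler01 andbT.
by have := lognorm_logdist a b; lra.
Qed.

Lemma expR_half_le1 b : expR (- lognorm b) / 2 <= 1.
Proof.
have : expR (- lognorm b) <= 1 by rewrite -expR0 ler_expR oppr_le0 lognorm_ge0.
lra.
Qed.

Lemma coefficient_metric_logdist : coefficient_metric (@Linfp_logdist R d D).
Proof.
split.
  split=> [a b|a b|a b c]; first exact: Linf_norm_ge0.
    exact: Linf_norm_sym.
  by apply: Linf_norm_triangle; exact: essbdd_ln.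
move=> a b small.
have l0 : 0 <= Linfp_logdist a b by exact: Linf_norm_ge0.
have l1 : Linfp_logdist a b <= 1 by apply: (le_trans small); exact: expR_half_le1.
split=> //; last exact: near_dist.
rewrite ler_peMl//.
have : 1 <= expR (lognorm b) by rewrite -expR0 ler_expR lognorm_ge0.
lra.
Qed.

Lemma coefficient_metric_dist : coefficient_metric (@Linfp_dist R d D).
Proof.
split.
  split=> [a b|a b|a b c]; first exact: Linf_norm_ge0.
    exact: Linf_norm_sym.
  by apply: Linf_norm_triangle; exact: Linf_essbdd.
move=> a b small.
have d0 : 0 <= Linfp_dist a b by exact: Linf_norm_ge0.
have l := Linfp_logdist_dist small.
split=> //.
  apply: (le_trans l); apply: (@le_trans _ _ (2 * expR (lognorm b) * (expR (- lognorm b) / 2))).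
    by rewrite ler_wpM2l// mulr_ge0// expR_ge0.
  rewrite expRN le_eqVlt; apply/orP; left; apply/eqP; field.
  by rewrite gt_eqF// expR_gt0.
by rewrite ler_peMl// -expR0 ler_expR addr_ge0// lognorm_ge0.
Qed.

(** The growth of the local Lipschitz constant of the solution operator. It is
    a product of a function of the coefficient and a function of the right-hand
    side, so that its moments factorise under product measures. *)
Definition weight (z : Linfp D * L2 D) : R :=
  expR (3 * lognorm z.1) * (1 + norm2 mu z.2).

Lemma weight_ge0 z : 0 <= weight z.
Proof. by rewrite mulr_ge0 ?expR_ge0// addr_ge0// norm2_ge0. Qed.

Lemma near_lognorm dA a b : coefficient_metric dA ->
  dA a b <= expR (- lognorm b) / 2 -> lognorm a <= lognorm b + 1.
Proof.
move=> mA /(coefficient_near mA)[l1 _ _]; have := lognorm_logdist a b; lra.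
Qed.

(** If the coefficients are close on the scale of one of them, the stability
    estimate has all its factors [exp (lognorm _)] at that same coefficient; if
    they are not, the distance exceeds that scale at both coefficients, and the
    a priori estimates suffice. *)
Lemma solution_lipschitz (i0 : 'I_d) : exists2 K : R, 0 < K &
  forall dA, coefficient_metric dA -> forall z w : Linfp D * L2 D,
  H10_dist (solution_operator z) (solution_operator w) <=
  K * (weight z + weight w) * sum_dist dA (@L2_dist R d D) z w.
Proof.
have [K K0 KP] := solution_stability D i0.
exists (K * expR 2) => [|dA mA]; first by rewrite mulr_gt0 ?expR_gt0.
have [[dA0 dAC _] _] := mA.
have [dF0 dFC _] := pseudometric_L2.
have e2 : 3 <= expR 2 :> R by have := expR_ge1Dx (2 : R); lra.
have E (t : R) : 0 <= t -> 1 <= expR t by move=> t0; rewrite -expR0 ler_expR.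
have near z w : dA z.1 w.1 <= expR (- lognorm w.1) / 2 ->
    H10_dist (solution_operator z) (solution_operator w) <=
    K * expR 2 * (weight z + weight w) * sum_dist dA (@L2_dist R d D) z w.
  case: z w => [a1 f1] [a2 f2] /= small.
  have [_ _ dn] := coefficient_near mA small.
  have ln := near_lognorm mA small.
  apply: (le_trans (KP a1 a2 f1 f2).2); rewrite -!mulrA ler_pM2l//.
  have n1 := norm2_ge0 mu f1; have n2 := norm2_ge0 mu f2.
  have F0 := dF0 f1 f2; have A0 := dA0 a1 a2.
  have N1 := lognorm_ge0 a1; have N2 := lognorm_ge0 a2.
  have B1 : expR (lognorm a1) * L2_dist f1 f2 <= expR 2 * (weight (a1, f1) * L2_dist f1 f2).
    apply: (@le_trans _ _ (weight (a1, f1) * L2_dist f1 f2)); last first.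
      by rewrite ler_peMl ?mulr_ge0 ?weight_ge0//; lra.
    rewrite ler_wpM2r// /weight/=; apply: (@le_trans _ _ (expR (3 * lognorm a1))).
      by rewrite ler_expR; lra.
    by rewrite ler_peMr ?expR_ge0// lerDl.
  have B2 : expR (lognorm a1) * (Linfp_dist a1 a2 * (expR (lognorm a2) * norm2 mu f2))
      <= expR 2 * (weight (a2, f2) * dA a1 a2).
    apply: (@le_trans _ _ (expR (lognorm a2 + 1) * ((expR (lognorm a2 + 1) * dA a1 a2) *
        (expR (lognorm a2) * norm2 mu f2)))).
      have x0 : 0 <= expR (lognorm a2) * norm2 mu f2 by rewrite mulr_ge0 ?expR_ge0.
      apply: ler_pM; rewrite ?expR_ge0 ?mulr_ge0 ?Linf_norm_ge0 ?ler_expR//.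
      by rewrite ler_wpM2r.
    have -> : expR (lognorm a2 + 1) * ((expR (lognorm a2 + 1) * dA a1 a2) *
        (expR (lognorm a2) * norm2 mu f2)) =
        expR 2 * (expR (3 * lognorm a2) * norm2 mu f2 * dA a1 a2).
      have -> : expR 2 = expR 1 * expR 1 :> R by rewrite -expRD.
      have -> : 3 * lognorm a2 = lognorm a2 + lognorm a2 + lognorm a2 by ring.
      by rewrite !expRD; ring.
    rewrite ler_wpM2l ?expR_ge0// ler_wpM2r// /weight/= ler_wpM2l ?expR_ge0//.
    by rewrite lerDr.
  have C1 : 0 <= weight (a2, f2) * L2_dist f1 f2 by rewrite mulr_ge0// weight_ge0.
  have C2 : 0 <= weight (a1, f1) * dA a1 a2 by rewrite mulr_ge0// weight_ge0.
  rewrite /sum_dist/= mulrDr; apply: (le_trans (lerD B1 B2)).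
  by rewrite -mulrDr ler_wpM2l ?expR_ge0//; lra.
move=> z w; have [|nw] := leP (dA z.1 w.1) (expR (- lognorm w.1) / 2); first exact: near.
have [small|nz] := leP (dA w.1 z.1) (expR (- lognorm z.1) / 2).
  have := near w z small; rewrite (pseudometric_sym pseudometric_H10) addrC.
  by rewrite (pseudometric_sym (pseudometric_sum (coefficient_pseudometric mA) pseudometric_L2)).
case: z w nw nz => [a1 f1] [a2 f2] /= n2 n1.
apply: (le_trans (KP a1 a2 f1 f2).1); rewrite -!mulrA ler_pM2l//.
have F0 := dF0 f1 f2; have A0 := dA0 a1 a2.
have far a f : expR (- lognorm a) / 2 < dA a1 a2 ->
    expR (lognorm a) * norm2 mu f <= 2 * (weight (a, f) * dA a1 a2).
  move=> na; have e0 := expR_gt0 (lognorm a).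
  have n0 := norm2_ge0 mu f; have N0 := lognorm_ge0 a.
  have h1 : 1 <= 2 * (expR (lognorm a) * dA a1 a2).
    have ee : expR (lognorm a) * expR (- lognorm a) = 1 by rewrite -expRD subrr expR0.
    have : expR (lognorm a) * (expR (- lognorm a) / 2) < expR (lognorm a) * dA a1 a2.
      by rewrite ltr_pM2l.
    by rewrite mulrA ee; lra.
  apply: (@le_trans _ _ (expR (lognorm a) * norm2 mu f * (2 * (expR (lognorm a) * dA a1 a2)))).
    by rewrite ler_peMr// mulr_ge0// ltW.
  have -> : expR (lognorm a) * norm2 mu f * (2 * (expR (lognorm a) * dA a1 a2)) =
      2 * (expR (lognorm a + lognorm a) * norm2 mu f * dA a1 a2) by rewrite expRD; ring.
  rewrite ler_pM2l// ler_wpM2r// /weight/= ler_pM ?expR_ge0//.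
    by rewrite ler_expR; lra.
  by rewrite lerDr.
have h1 := far a1 f1; rewrite dAC in n1; have := h1 n1; have := far a2 f2 n2.
have C1 : 0 <= weight (a1, f1) * dA a1 a2 by rewrite mulr_ge0// weight_ge0.
have C2 : 0 <= weight (a2, f2) * dA a1 a2 by rewrite mulr_ge0// weight_ge0.
have C3 : 0 <= (weight (a1, f1) + weight (a2, f2)) * L2_dist f1 f2.
  by rewrite mulr_ge0// addr_ge0// weight_ge0.
move=> g1 g2; apply: (@le_trans _ _ (2 * ((weight (a1, f1) + weight (a2, f2)) * dA a1 a2))).
  by rewrite mulrDl; move: g1 g2; lra.
apply: ler_pM => //; first by rewrite mulr_ge0// addr_ge0// weight_ge0.
  by lra.
by rewrite /sum_dist/= mulrDr lerDl.
Qed.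

Lemma lognorm_near dA a b : coefficient_metric dA ->
  dA a b <= expR (- lognorm a) / 2 ->
  `|lognorm a - lognorm b| <= 2 * expR (lognorm a) * dA a b.
Proof.
move=> mA; rewrite (pseudometric_sym (coefficient_pseudometric mA)) => small.
have [_ h _] := coefficient_near mA small.
have := lognorm_logdist a b; have := lognorm_logdist b a.
rewrite (_ : Linfp_logdist a b = Linfp_logdist b a); last exact: Linf_norm_sym.
by move=> h1 h2; rewrite (le_trans _ h)// ler_norml; apply/andP; split; lra.
Qed.

Lemma measurable_lognorm dA : coefficient_metric dA ->
  measurable_fun [set: borelType dA] (@lognorm R d D : borelType dA -> R).
Proof.
move=> mA; apply: measurable_borelType_real => a e e0.
have ea := expR_gt0 (lognorm a); have ena := expR_gt0 (- lognorm a).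
exists (Num.min (expR (- lognorm a) / 2) (e / (2 * expR (lognorm a)))).
  by rewrite lt_min !divr_gt0// mulr_gt0.
move=> b; rewrite lt_min => /andP[h1 h2].
apply: le_lt_trans (lognorm_near mA (ltW h1)) _.
by rewrite mulrC -ltr_pdivlMr// mulr_gt0.
Qed.

Lemma measurable_norm2_L2 :
  measurable_fun [set: borelType (@L2_dist R d D)]
    ((fun f => norm2 mu (f : L2 D)) : borelType (@L2_dist R d D) -> R).
Proof.
apply: measurable_borelType_real => f e e0; exists e => // g.
apply: le_lt_trans; rewrite ler_norml.
have := norm2_L2_lipschitz f g; have := norm2_L2_lipschitz g f.
by rewrite (pseudometric_sym pseudometric_L2 g); move=> h1 h2; apply/andP; split; lra.
Qed.

Lemma solution_operator_continuous (i0 : 'I_d) dA (z : Linfp D * L2 D) (e : R) :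
  coefficient_metric dA -> 0 < e -> exists2 t : R, 0 < t & forall w,
  sum_dist dA (@L2_dist R d D) z w < t ->
  H10_dist (solution_operator z) (solution_operator w) < e.
Proof.
move=> mA; have [K K0 KP] := solution_lipschitz i0.
have [mdA _] := mA; have mF := pseudometric_L2.
case: z => a f e0.
pose W := expR (3 * (lognorm a + 1)) * (2 + norm2 mu (f : L2 D)).
have W0 : 0 < W.
  by rewrite mulr_gt0 ?expR_gt0// ltr_pwDl// norm2_ge0.
pose B := K * (weight (a, f) + W).
have B0 : 0 < B by rewrite mulr_gt0// ltr_wpDl// weight_ge0.
have ena := expR_gt0 (- lognorm a).
exists (Num.min (expR (- lognorm a) / 2) (e / B)).
  by rewrite lt_min !divr_gt0.
move=> -[b g]; rewrite lt_min => /andP[h1 h2].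
have dA0 := pseudometric_ge0 mdA a b; have dF0 := pseudometric_ge0 mF f g.
have hA : dA b a <= expR (- lognorm a) / 2.
  by rewrite (pseudometric_sym mdA); move: h1; rewrite /sum_dist/=; lra.
have hF : L2_dist f g <= 1.
  by have := expR_half_le1 a; move: h1; rewrite /sum_dist/=; lra.
have Wg : weight (b, g) <= W.
  rewrite /weight /W/=; apply: ler_pM; rewrite ?expR_ge0 ?addr_ge0 ?norm2_ge0//.
    by rewrite ler_expR ler_pM2l//; exact: (near_lognorm mA).
  have := norm2_L2_lipschitz g f; rewrite (pseudometric_sym mF); lra.
apply: le_lt_trans (KP dA mA (a, f) (b, g)) _.
apply: (@le_lt_trans _ _ (B * sum_dist dA (@L2_dist R d D) (a, f) (b, g))).
  rewrite ler_wpM2r ?addr_ge0// /B ler_pM2l// lerD2l//.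
by rewrite mulrC -ltr_pdivlMr.
Qed.

End continuity.

(** * Exponential moments of Gaussian variables *)

Section gaussian.
Context {R : realType}.
Local Notation leb := (@lebesgue_measure R).

Lemma measurable_expRM (s : R) : measurable_fun setT (fun u : R => (expR (s * u))%:E).
Proof.
by apply/measurable_EFinP; apply: (@measurableT_comp _ _ _ _ _ _ expR).
Qed.

Lemma normal_integralE (m sigma : R) (f : R -> \bar R) :
  (forall x, 0 <= f x)%E -> measurable_fun setT f ->
  (\int[normal_prob m sigma]_x f x =
   \int[leb]_x (f x * (normal_pdf m sigma x)%:E))%E.
Proof.
move=> f0 mf; pose dom := normal_prob_dominates m sigma.
rewrite -(Radon_Nikodym_SigmaFinite.change_of_variables dom)//.
apply: ae_eq_integral => //.
- apply: emeasurable_funM => //; apply: (measurable_int leb).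
  exact: Radon_Nikodym_SigmaFinite.f_integrable.
- apply: emeasurable_funM => //; apply/measurable_EFinP.
  exact: measurable_normal_pdf.
- apply: ae_eqe_mul2l => /=; apply: integral_ae_eq => //=.
  + exact: Radon_Nikodym_SigmaFinite.f_integrable.
  + by apply/measurable_EFinP; exact: measurable_normal_pdf.
  + by move=> E _ mE; rewrite -Radon_Nikodym_SigmaFinite.f_integral.
Qed.

(** Completing the square turns [exp (s u)] times a normal density into a
    multiple of a shifted normal density. *)
Lemma normal_mgf (m sigma s : R) : sigma != 0 ->
  (\int[normal_prob m sigma]_u (expR (s * u))%:E =
   (expR (s * m + s ^+ 2 * sigma ^+ 2 / 2))%:E)%E.
Proof.
move=> s0.
rewrite normal_integralE//; last exact: measurable_expRM.
set c := expR (_ + _).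
transitivity (\int[leb]_u (c%:E * (normal_pdf (m + s * sigma ^+ 2) sigma u)%:E))%E.
  apply: eq_integral => u _; rewrite -!EFinM !normal_pdfE//.
  rewrite mulrCA [in RHS]mulrCA /normal_fun -!expRD; congr (_ * expR _)%:E.
  by field; rewrite s0.
rewrite integralZl//; last exact: integrable_normal_pdf.
by rewrite integral_normal_pdf mule1.
Qed.

Lemma gaussian1_mgf (m v s : R) (eta : {measure set (measurableTypeR R) -> \bar R}) :
  0 <= v -> (forall B : set R, measurable B -> eta B = gaussian1 m v B) ->
  (\int[eta]_u (expR (s * u))%:E = (expR (s * m + s ^+ 2 * v / 2))%:E)%E.
Proof.
move=> v0; rewrite /gaussian1; have [->|vn0] := eqVneq v 0 => etaE.
  transitivity (\int[@dirac _ (measurableTypeR R) m R]_u (expR (s * u))%:E)%E.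
    by apply: eq_measure_integral => A mA _; exact: etaE.
  rewrite integral_dirac//; first by rewrite diracT mul1e mulr0 mul0r addr0.
  exact: measurable_expRM.
transitivity (\int[normal_prob m (Num.sqrt v)]_u (expR (s * u))%:E)%E.
  by apply: eq_measure_integral => A mA _; exact: etaE.
by rewrite normal_mgf ?sqr_sqrtr// sqrtr_eq0 -ltNge lt_neqAle eq_sym vn0.
Qed.

End gaussian.

(** * The Matern covariance *)

Section matern.
Context {R : realType}.

Lemma partial_exp_le (x : R) n : 0 <= x -> \sum_(i < n) x ^+ i / i`!%:R <= expR x.
Proof.
move=> x0; rewrite -(big_mkord xpredT (fun i => x ^+ i / i`!%:R)) /expR.
apply: nondecreasing_cvgn_le; last exact: is_cvg_series_exp_coeff.
by apply: nondecreasing_series => i _ _; rewrite /exp_coeff/= divr_ge0// exprn_ge0.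
Qed.

(** [k! / (k - j)!] and [(2 k)! / (2 k - j)!] are products of [j] factors, of
    which those of the second are at least twice those of the first. *)
Lemma matern_coeff_nat (k j : nat) : (j <= k)%N ->
  (k`! * (2 * k - j)`! * 2 ^ j <= (2 * k)`! * (k - j)`!)%N.
Proof.
elim: j => [|j ih] jk; first by rewrite !subn0 muln1 mulnC.
have kj : (0 < k - j)%N by rewrite subn_gt0.
rewrite -(leq_pmul2l kj).
have E1 : (k - j)`! = ((k - j) * (k - j.+1)`!)%N.
  by rewrite -[in LHS](prednK kj) factS (prednK kj) -subnS.
have kj2 : (0 < 2 * k - j)%N by rewrite subn_gt0 (leq_trans jk)// leq_pmull.
have E2 : (2 * k - j)`! = ((2 * k - j) * (2 * k - j.+1)`!)%N.
  by rewrite -[in LHS](prednK kj2) factS (prednK kj2) -subnS.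
have -> : ((k - j) * ((2 * k)`! * (k - j.+1)`!) = (2 * k)`! * (k - j)`!)%N.
  by rewrite E1 mulnCA.
apply: leq_trans (ih (ltnW jk)); rewrite E2.
have le : (2 * (k - j) <= 2 * k - j)%N by rewrite mulnBr leq_sub2l// leq_pmull.
rewrite expnS.
have -> : ((k - j) * (k`! * (2 * k - j.+1)`! * (2 * 2 ^ j)) =
   (2 * (k - j)) * (k`! * (2 * k - j.+1)`! * 2 ^ j))%N by ring.
have -> : (k`! * ((2 * k - j) * (2 * k - j.+1)`!) * 2 ^ j =
   (2 * k - j) * (k`! * (2 * k - j.+1)`! * 2 ^ j))%N by ring.
by rewrite leq_mul2r le orbT.
Qed.

(** In increasing powers of [z], the constant coefficient is [1] and the
    coefficient of [z ^ j] is at most [1 / j!] by [matern_coeff_nat]. *)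
Lemma matern_factor (k : nat) (z : R) : 0 <= z ->
  1 <= k`!%:R / (2 * k)`!%:R * (\sum_(i < k.+1)
     (k + i)`!%:R / (i`!%:R * (k - i)`!%:R) * (2 * z) ^+ (k - i)) <= expR z.
Proof.
move=> z0; apply/andP; split.
  rewrite big_ord_recr/= subnn fact0 expr0 !mulr1 addnn -mul2n mulrDr.
  have -> : k`!%:R / (2 * k)`!%:R * ((2 * k)`!%:R / k`!%:R) = 1 :> R.
    by rewrite mulrA divfK ?divff// pnatr_eq0 -lt0n fact_gt0.
  rewrite lerDr mulr_ge0 ?divr_ge0// sumr_ge0// => i _.
  by rewrite mulr_ge0 ?divr_ge0 ?mulr_ge0 ?exprn_ge0// mulr_ge0.
apply: le_trans (partial_exp_le k.+1 z0).
rewrite mulr_sumr (reindex_inj rev_ord_inj)/=; apply: ler_sum => i _.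
have ik : (i <= k)%N by rewrite -ltnS.
have F n : n`!%:R != 0 :> R by rewrite pnatr_eq0 -lt0n fact_gt0.
have P n : 0 < n`!%:R :> R by rewrite ltr0n fact_gt0.
rewrite subSS subKn// exprMn [leRHS]mulrC !mulrA ler_wpM2r ?exprn_ge0//.
have -> : (k + (k - i) = 2 * k - i)%N by rewrite addnBA// addnn mul2n.
have -> : k`!%:R / (2 * k)`!%:R * (2 * k - i)`!%:R / ((k - i)`!%:R * i`!%:R) * 2 ^+ i =
    (k`!%:R * (2 * k - i)`!%:R * 2 ^+ i) / ((2 * k)`!%:R * (k - i)`!%:R) * i`!%:R^-1 :> R.
  by field; rewrite !F.
rewrite -[leRHS]mul1r ler_wpM2r ?invr_ge0 ?ler0n// ler_pdivrMr ?mulr_gt0// mul1r.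
by rewrite -natrX -!natrM ler_nat matern_coeff_nat.
Qed.

(** With [p z] for the polynomial factor, [exp (- z) <= p z * exp (- z) <= 1], and
    [exp (- z)] is at least [1 - z]. *)
Lemma matern_bounds (s2 rho : R) (k d : nat) (x y : 'rV[R]_d) :
  0 <= s2 -> 0 < rho ->
  0 <= s2 - matern s2 rho k x y <=
    s2 * (Num.sqrt (2 * k + 1)%:R / rho * eucl_norm (x - y)).
Proof.
move=> s20 rho0; set z := _ * eucl_norm _.
have z0 : 0 <= z by rewrite mulr_ge0 ?divr_ge0 ?sqrtr_ge0// ltW.
have /andP[p1 p2] := matern_factor k z0.
rewrite /matern.
have -> : 2 * Num.sqrt (2 * k + 1)%:R / rho * eucl_norm (x - y) = 2 * z.
  by rewrite /z !mulrA.
rewrite -/z.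
set p := _ * \sum_(i < _) _ in p1 p2.
rewrite [X in s2 - X](_ : _ = s2 * (p * expR (- z))); last by rewrite /p !mulrA.
have E : expR z * expR (- z) = 1 by rewrite -expRD subrr expR0.
have e0 := expR_gt0 (- z).
have h1 : p * expR (- z) <= 1 by rewrite -E ler_wpM2r// ltW.
have h2 : 1 - z <= p * expR (- z).
  apply: (@le_trans _ _ (expR (- z))); first by have := expR_ge1Dx (- z).
  by rewrite ler_peMl// ltW.
rewrite -{1 3}(mulr1 s2) -mulrBr mulr_ge0 ?subr_ge0//=.
by rewrite ler_wpM2l//; lra.
Qed.

Lemma eucl_norm0 d : eucl_norm (0 : 'rV[R]_d) = 0.
Proof. by rewrite /eucl_norm big1 ?sqrtr0// => i _; rewrite mxE expr0n. Qed.

Lemma matern_diag (s2 rho : R) (k d : nat) (x : 'rV[R]_d) :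
  0 <= s2 -> 0 < rho -> matern s2 rho k x x = s2.
Proof.
move=> s20 rho0; have := matern_bounds k x x s20 rho0.
by rewrite subrr eucl_norm0 !mulr0; lra.
Qed.

End matern.

(** * Continuous functions on the closure of the domain *)

Section continuous_functions.
Context {R : realType} {d : nat} (D : bounded_lipschitz_domain R d).
Local Notation mu := (lebesgue_domain D).
Local Notation T := (borel_rV R d).
Local Notation clD := (closure (domain_set D)).
Implicit Types (f g : CD D).

Lemma closure_bounded_norm : exists2 M : R, 0 < M & forall x, clD x -> `|x| < M.
Proof.
have [M M0 MP] := domain_bounded_norm D.
exists (M + 1) => [|x clx]; first by rewrite addr_gt0.
have [y [Dy]] := clx _ (nbhsx_ballx x 1 ltr01).
rewrite -ball_normE/= => xy.
rewrite -(subrK y x) (le_lt_trans (ler_normD _ _))// addrC ltrD//.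
exact: MP.
Qed.

Lemma compact_closure_domain : compact clD.
Proof.
apply: bounded_closed_compact; last exact: closed_closure.
have [M M0 MP] := closure_bounded_norm.
exists M; split; first exact: num_real.
by move=> M' MM' x /MP xM; apply/ltW; exact: lt_trans MM'.
Qed.

Lemma valL_in f (x : clD) : 'valL_ 0 f (set_val x) = f x.
Proof. exact: (congr1 (fun h => h x) (valLK 0 (f : clD -> R))). Qed.

Lemma valL_out f x : ~ clD x -> 'valL_ 0 f x = 0.
Proof.
move=> nx; rewrite /valL_/= oinv_set_val insubF//.
by apply/negP => /set_mem.
Qed.

Lemma within_continuous_valL f : {within clD, continuous ('valL_ 0 f)}.
Proof. by apply/subspace_valL_continuousP'; exact: cts_fun. Qed.

Lemma CD_bounded f : exists M : R, forall x : clD, `|f x| <= M.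
Proof.
have /compact_bounded[M [Mr MP]] : compact ('valL_ 0 f @` clD).
  by apply: continuous_compact compact_closure_domain; exact: within_continuous_valL.
have M1 : M < `|M| + 1 by rewrite (le_lt_trans (ler_norm _))// ltrDl.
exists (`|M| + 1) => x; rewrite -valL_in; apply: MP M1 _ _.
by exists (set_val x) => //; apply: set_mem; exact: valP.
Qed.

Lemma closure_point : clD.
Proof.
have [x Dx] := cid (domain_nonempty D).
by exists x; apply: mem_set; exact: subset_closure.
Qed.

Lemma sup_norm_ge (h : clD -> R) : (exists M : R, forall x, `|h x| <= M) ->
  forall x, `|h x| <= sup_norm h.
Proof.
move=> [M hM] x; apply: sup_upper_bound; last by exists x.
by split; [exists `|h x|, x|exists M => _ [y _ <-]].
Qed.

Lemma sup_norm_le (h : clD -> R) (M : R) : (forall x, `|h x| <= M) ->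
  sup_norm h <= M.
Proof.
move=> hM; apply: ge_sup; first by exists `|h closure_point|, closure_point.
by move=> _ [y _ <-].
Qed.

Lemma le_sup_norm_CD f x : `|f x| <= sup_norm f.
Proof. by apply: sup_norm_ge; exact: CD_bounded. Qed.

Lemma le_CD_dist f g x : `|f x - g x| <= CD_dist f g.
Proof.
apply: (@sup_norm_ge (fun x => f x - g x)).
have [M fM] := CD_bounded f; have [M' gM] := CD_bounded g.
by exists (M + M') => y; rewrite (le_trans (ler_normB _ _))// lerD.
Qed.

Lemma measurable_eval (x : clD) :
  measurable_fun [set: borelType (@CD_dist R d D)]
    ((fun f : CD D => f x) : borelType (@CD_dist R d D) -> R).
Proof.
apply: measurable_borelType_real => f e e0; exists e => // g.
by apply: le_lt_trans; exact: le_CD_dist.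
Qed.

Lemma measurable_valL f : measurable_fun setT ('valL_ 0 f : T -> R).
Proof.
apply: (measurability _ (RGenOpens.measurableE R)).
move=> _ [U [a [b ->]] <-]; rewrite setTI.
set V := `]a, b[%classic.
have mA : measurable (clD : set T).
  by rewrite -[clD]setCK; apply: measurableC; apply: sub_sigma_algebra;
    apply: closed_openC; exact: closed_closure.
have /open_subspaceP[W oW WE] : open ('valL_ 0 f @^-1` V : set (subspace clD)).
  have /continuousP := @within_continuous_valL f; apply.
  exact: interval_open.
have -> : 'valL_ 0 f @^-1` V =
    (W `&` clD) `|` (if 0 \in V then ~` clD else set0).
  apply/seteqP; split => [x Vx|x].
    have [cx|cx] := pselect (clD x); first by left; rewrite WE.
    right; move: Vx; rewrite /preimage /mkset valL_out// => V0.
    by rewrite mem_set.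
  case=> [Wx|]; first by move: Wx; rewrite WE => -[].
  case: ifPn => // /set_mem V0 cx; by rewrite /preimage /mkset valL_out.
apply: measurableU.
  by apply: measurableI => //; exact: sub_sigma_algebra.
by case: ifP => // _; exact: measurableC.
Qed.

Lemma ae_closure (P : R -> Prop) (h : clD -> R) (F : T -> R) :
  (forall x : clD, F (set_val x) = h x) -> (forall x, P (h x)) ->
  {ae mu, forall x, P (F x)}.
Proof.
move=> Fh Ph; apply: (aeS (ae_domain D)) => x Dx.
have cx : x \in clD by apply: mem_set; exact: subset_closure.
by have := Fh (exist _ x cx); rewrite /= => ->.
Qed.

Lemma essbdd_valL f : essbdd D ('valL_ 0 f).
Proof.
split; first exact: measurable_valL.
have [M fM] := CD_bounded f; exists M.
exact: (@ae_closure (fun y => `|y| <= M) f ('valL_ 0 f) (valL_in f) fM).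
Qed.

Lemma CD_LinfE f : ('valL_ 0 f : T -> R) = (CD_Linf f : T -> R) %[ae mu].
Proof. by apply: Lspace_ofE; apply/Lfun_essbdd; exact: essbdd_valL. Qed.

Lemma Linf_norm_CD f : Linf_norm D (CD_Linf f) = Linf_norm D ('valL_ 0 f).
Proof.
apply/esym; apply: eq_Linf_norm_ae (CD_LinfE f); first exact: essbdd_valL.
exact: Linf_essbdd.
Qed.

Lemma Linf_norm_CD_le f : Linf_norm D (CD_Linf f) <= sup_norm f.
Proof.
rewrite Linf_norm_CD; apply: Linf_norm_le.
  by apply: le_trans (le_sup_norm_CD f closure_point).
exact: (@ae_closure (fun y => `|y| <= sup_norm f) f ('valL_ 0 f) (valL_in f)
  (le_sup_norm_CD f)).
Qed.

Lemma measurable_Linf_norm_CD :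
  measurable_fun [set: borelType (@CD_dist R d D)]
    ((fun f : CD D => Linf_norm D (CD_Linf f)) : borelType (@CD_dist R d D) -> R).
Proof.
have h f g : Linf_norm D (CD_Linf f) <= Linf_norm D (CD_Linf g) + CD_dist f g.
  rewrite !Linf_norm_CD; apply: Linf_norm_le.
    rewrite addr_ge0 ?Linf_norm_ge0//.
    by apply: le_trans (le_CD_dist f g closure_point).
  have h1 : {ae mu, forall x, `|'valL_ 0 f x - 'valL_ 0 g x| <= CD_dist f g}.
    apply: (@ae_closure (fun y => `|y| <= CD_dist f g) (fun x => f x - g x)
      (fun x => 'valL_ 0 f x - 'valL_ 0 g x)).
      by move=> x; rewrite !valL_in.
    by move=> x; exact: le_CD_dist.
  apply: (aeS2 (Linf_normP (essbdd_valL g)) h1) => x h2 h3.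
  rewrite -(subrK ('valL_ 0 g x) ('valL_ 0 f x)) addrC.
  by rewrite (le_trans (ler_normD _ _))// lerD.
apply: measurable_borelType_real => f e e0; exists e => // g.
have sym : CD_dist g f = CD_dist f g.
  rewrite /CD_dist /sup_norm; congr sup.
  by apply/seteqP; split=> _ [x _ <-]; exists x => //; rewrite distrC.
apply: le_lt_trans; rewrite ler_norml.
by have := h f g; have := h g f; rewrite sym => h1 h2; apply/andP; split; lra.
Qed.

End continuous_functions.

(** * Chaining over dyadic cells *)

Section jensen.
Context {R : realType}.

(** Jensen's inequality for the exponential, from its tangent line at the
    weighted mean; the missing mass of the weights is put at the point 0. *)
Lemma expR_weighted_sum n (w x : 'I_n -> R) : (forall i, 0 <= w i) ->
  \sum_i w i <= 1 -> expR (\sum_i w i * x i) <= 1 + \sum_i w i * expR (x i).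
Proof.
move=> w0 w1; set S := \sum_i w i * x i.
have tangent y : expR S * (1 + (y - S)) <= expR y.
  have := expR_ge1Dx (y - S); rewrite -(ler_pM2l (expR_gt0 S)) => h.
  by apply: (le_trans h); rewrite -expRD addrC subrK.
have h1 : \sum_i w i * (expR S * (1 + (x i - S))) <= \sum_i w i * expR (x i).
  by apply: ler_sum => i _; rewrite ler_wpM2l.
have h2 : \sum_i w i * (expR S * (1 + (x i - S))) =
    expR S * ((\sum_i w i) * (1 - S) + S).
  rewrite (eq_bigr (fun i => expR S * (1 - S) * w i + expR S * (w i * x i))).
    by rewrite big_split/= -!mulr_sumr -/S; ring.
  by move=> i _; ring.
have := tangent 0; rewrite expR0 => h3.
have h4 : (1 - \sum_i w i) * (expR S * (1 + (0 - S))) <= 1.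
  apply: (@le_trans _ _ ((1 - \sum_i w i) * 1)); first by rewrite ler_wpM2l// subr_ge0.
  by rewrite mulr1 gerBl sumr_ge0.
rewrite h2 in h1; have := lerD h4 h1; set W := \sum_i w i.
have -> // : (1 - W) * (expR S * (1 + (0 - S))) + expR S * (W * (1 - S) + S) = expR S.
by ring.
Qed.

Lemma expR_normr_le (t g : R) : expR (t * `|g|) <= expR (t * g) + expR (- t * g).
Proof.
have [g0|g0] := leP 0 g.
  by rewrite ger0_norm// lerDl expR_ge0.
by rewrite ltr0_norm// mulrN -mulNr lerDr expR_ge0.
Qed.

(** The closed form shows that [\sum_n n (3/4)^n = 12]. *)
Lemma sum_nat_geometric N :
  \sum_(n < N) n%:R * (3 / 4) ^+ n = 12 - (4 * N%:R + 12) * (3 / 4) ^+ N :> R.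
Proof.
elim: N => [|N ih]; first by rewrite big_ord0 mulr0 add0r expr0; ring.
by rewrite big_ord_recr/= ih exprS -natr1; field.
Qed.

Lemma sum_geometric N : \sum_(n < N) 4^-1 * (3 / 4) ^+ n = 1 - (3 / 4) ^+ N :> R.
Proof.
elim: N => [|N ih]; first by rewrite big_ord0 expr0 subrr.
by rewrite big_ord_recr/= ih exprS; field.
Qed.

Lemma eucl_norm_le_sum d (v : 'rV[R]_d) : eucl_norm v <= \sum_i `|v ord0 i|.
Proof.
have s0 : 0 <= \sum_i `|v ord0 i| by rewrite sumr_ge0.
rewrite -[leRHS]ger0_norm// -sqrtr_sqr; apply: ler_wsqrtr.
rewrite expr2 mulr_suml; apply: ler_sum => i _.
rewrite -(real_normK (num_real _)) expr2 ler_wpM2l//.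
by rewrite (bigD1 i)//= lerDl sumr_ge0.
Qed.

End jensen.

Section cells.
Context {R : realType} {d : nat} (D : bounded_lipschitz_domain R d).
Local Notation clD := (closure (domain_set D)).
Variables (M : R) (M0 : 0 < M) (MP : forall x, clD x -> `|x| < M).

Definition cell n : Type := {ffun 'I_d -> 'I_(2 ^ n)}.

Definition scaled (x : 'rV[R]_d) i : R := (x ord0 i + M) / (2 * M).

Definition in_cell n (c : cell n) (x : 'rV[R]_d) : Prop :=
  forall i, (c i)%:R <= 2 ^+ n * scaled x i < (c i)%:R + 1.

Lemma scaled_itv (x : clD) i : 0 <= scaled (set_val x) i < 1.
Proof.
have /MP xM : clD (set_val x) by apply: set_mem; exact: valP.
have := le_lt_trans (normr_coord_le (set_val x) i) xM.
rewrite ltr_norml => /andP[h1 h2].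
rewrite /scaled ltr_pdivrMr ?mulr_gt0// divr_ge0 ?mulr_ge0 ?ltW//=; lra.
Qed.

Lemma in_cell_exists n (x : clD) : exists c : cell n, in_cell c (set_val x).
Proof.
have H i : (Num.truncn (2 ^+ n * scaled (set_val x) i) < 2 ^ n)%N.
  have /andP[h0 h1] := scaled_itv x i.
  rewrite -(ltr_nat R) natrX.
  have /andP[h _] := Num.Theory.truncn_itv (mulr_ge0 (exprn_ge0 n (ler0n R 2)) h0).
  by apply: (le_lt_trans h); rewrite gtr_pMr// exprn_gt0.
exists [ffun i => Ordinal (H i)] => i; rewrite ffunE/= natr1.
have /andP[h0 _] := scaled_itv x i.
exact: Num.Theory.truncn_itv (mulr_ge0 (exprn_ge0 n (ler0n R 2)) h0).
Qed.

Lemma half_lt_expn n (c : 'I_(2 ^ n.+1)) : (c./2 < 2 ^ n)%N.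
Proof. by rewrite ltn_half_double -mul2n -expnS. Qed.

Definition parent n (c : cell n.+1) : cell n :=
  [ffun i => Ordinal (half_lt_expn (c i))].

Lemma in_cell_parent n (c : cell n.+1) x : in_cell c x -> in_cell (parent c) x.
Proof.
move=> h i; have /andP[] := h i; rewrite ffunE/= exprS.
set k := (c i : nat); rewrite -mulrA; set y := 2 ^+ n * _ => h1 h2.
have h3 : (2 * k./2 <= k <= 2 * k./2 + 1)%N.
  by rewrite -{2 3}(odd_double_half k) mul2n leq_addl addnC leq_add2l leq_b1.
move: h3 => /andP[h3 h4].
have h3' : 2 * (k./2)%:R <= k%:R :> R by rewrite -natrM ler_nat.
have h4' : k%:R <= 2 * (k./2)%:R + 1 :> R by rewrite -natrM natr1 -addn1 ler_nat.
by apply/andP; split; lra.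
Qed.

Definition mesh n : R := d%:R * (2 * M) / 2 ^+ n.

Lemma in_cell_coord n (c : cell n) x y i : in_cell c x -> in_cell c y ->
  `|x ord0 i - y ord0 i| <= 2 * M / 2 ^+ n.
Proof.
move=> hx hy; have /andP[x1 x2] := hx i; have /andP[y1 y2] := hy i.
have E (z : 'rV[R]_d) : z ord0 i = 2 * M / 2 ^+ n * (2 ^+ n * scaled z i) - M.
  by rewrite /scaled; field; rewrite !gt_eqF// exprn_gt0.
have p0 : 0 <= 2 * M / 2 ^+ n by rewrite divr_ge0 ?mulr_ge0 ?exprn_ge0// ltW.
have -> : x ord0 i - y ord0 i = 2 * M / 2 ^+ n * (2 ^+ n * scaled x i - 2 ^+ n * scaled y i).
  by rewrite (E x) (E y); ring.
rewrite normrM ger0_norm// ler_piMr// ler_norml; apply/andP; split; lra.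
Qed.

Lemma in_cell_eucl_norm n (c : cell n) x y : in_cell c x -> in_cell c y ->
  eucl_norm (x - y) <= mesh n.
Proof.
move=> hx hy; apply: (le_trans (eucl_norm_le_sum _)).
rewrite /mesh -mulrA mulr_natl -[X in _ *+ X](card_ord d) -sumr_const.
by apply: ler_sum => i _; rewrite !mxE; exact: in_cell_coord hx hy.
Qed.

(** The representative of an empty cell is inherited from its parent, so that
    the chain does not move there. *)
Fixpoint representative n : cell n -> clD :=
  match n return cell n -> clD with
  | 0 => fun _ => closure_point D
  | n'.+1 => fun c =>
    match pselect (exists x : clD, in_cell c (set_val x)) with
    | left h => projT1 (cid h)
    | right _ => representative (parent c)
    end
  end.

Lemma representative_in_cell n (c : cell n) :
  (exists x : clD, in_cell c (set_val x)) ->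
  in_cell c (set_val (representative c)).
Proof.
case: n c => [c _ i|n c h] /=.
  have /andP[h0 h1] := scaled_itv (closure_point D) i.
  by rewrite (ord1 (c i)) expr0 mul1r add0r h0.
by case: pselect => // h'; case: cid.
Qed.

Lemma representative_step n (c : cell n.+1) :
  eucl_norm (set_val (representative c) - set_val (representative (parent c)))
  <= mesh n.
Proof.
have m0 : 0 <= mesh n by rewrite divr_ge0 ?mulr_ge0 ?exprn_ge0// ltW.
rewrite {1}/representative -/(@representative n).
case: pselect => [h|_]; last by rewrite subrr eucl_norm0.
have hp : exists x : clD, in_cell (parent c) (set_val x).
  by case: h => x hx; exists x; exact: in_cell_parent.
apply: (@in_cell_eucl_norm _ (parent c)).
  by case: cid => x hx /=; exact: in_cell_parent.
exact: representative_in_cell.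
Qed.

Lemma representative_dense (f : CD D) (x : clD) (e : R) : 0 < e ->
  exists n (c : cell n), `|f x - f (representative c)| < e.
Proof.
move=> e0; have clx : clD (set_val x) by apply: set_mem; exact: valP.
have : within clD (nbhs (set_val x)) [set y | `|f x - 'valL_ 0 f y| < e].
  rewrite nbhs_subspace_in//.
  have := @within_continuous_valL R d D f (set_val x).
  move=> /cvgrPdist_lt /(_ e e0).
  by rewrite -[in X in _ -> X](valL_in f x).
move=> /nbhs_ballP[t /= t0 tP].
have [n nP] : exists n : nat, 2 * M / 2 ^+ n < t.
  exists (Num.truncn (2 * M / t)); set n := Num.truncn _.
  rewrite ltr_pdivrMr ?exprn_gt0// [ltRHS]mulrC -ltr_pdivrMr//.
  apply: (lt_le_trans (Num.Theory.truncnS_gt _)); rewrite -/n -natrX ler_nat.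
  exact: ltn_expl.
have [c cx] := in_cell_exists n x.
have cr : in_cell c (set_val (representative c)).
  by apply: representative_in_cell; exists x.
exists n, c; rewrite -(valL_in f (representative c)).
have clr : clD (set_val (representative c)) by apply: set_mem; exact: valP.
apply: tP clr; split=> // i j; rewrite (ord1 i).
by apply: le_lt_trans nP; exact: in_cell_coord cx cr.
Qed.

End cells.

(** * Exponential moments of the supremum of a Gaussian field *)

Section pushforward.
Context {R : realType} d1 d2 (T1 : measurableType d1) (T2 : measurableType d2).

Lemma pushforward_probability (P : probability T1 R) (F : T1 -> T2) :
  measurable_fun setT F -> exists Q : probability T2 R,
  (forall A, measurable A -> Q A = P (F @^-1` A)) /\
  (forall h : T2 -> \bar R, measurable_fun setT h -> (forall y, 0 <= h y)%E ->
    (\int[Q]_y h y = \int[P]_x h (F x))%E).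
Proof.
move=> mF.
pose FM : {mfun T1 >-> T2} := mfun_Sub (mem_set mF).
exists (distribution P FM); split=> // h mh h0.
by rewrite /distribution ge0_integral_pushforward.
Qed.

End pushforward.

Section field_moments.
Context {R : realType} {d : nat} (D : bounded_lipschitz_domain R d).
Local Notation clD := (closure (domain_set D)).
Local Notation CDB := (borelType (@CD_dist R d D)).
Variables (nu : probability CDB R) (m : CD D) (cov : 'rV[R]_d -> 'rV[R]_d -> R).
Hypothesis gauss : is_gaussian m cov nu.

Definition centred (f : CD D) (x : clD) : R := f x - m x.

Lemma measurable_combination n (x : 'I_n -> clD) (t : 'I_n -> R) :
  measurable_fun [set: CDB] ((fun f : CD D => \sum_i t i * f (x i)) : CDB -> R).
Proof.
apply: measurable_sum => i; apply: measurable_funM; first exact: measurable_cst.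
exact: measurable_eval.
Qed.

Lemma measurable_centred (x : clD) :
  measurable_fun [set: CDB] ((fun f : CD D => centred f x) : CDB -> R).
Proof.
apply: measurable_funB; first exact: measurable_eval.
exact: measurable_cst.
Qed.

Lemma gaussian_combination_mgf n (x : 'I_n -> clD) (t : 'I_n -> R) (s : R) :
  let v := \sum_i \sum_j t i * t j * cov (set_val (x i)) (set_val (x j)) in
  0 <= v ->
  (\int[nu]_f (expR (s * \sum_i t i * centred f (x i)))%:E =
   (expR (s ^+ 2 * v / 2))%:E)%E.
Proof.
move=> v v0; pose mean := \sum_i t i * m (x i).
have [eta [etaE etaI]] := pushforward_probability (T2 := measurableTypeR R) nu
  (measurable_combination x t).
have H (B : set R) : measurable B -> eta B = gaussian1 mean v B.
  by move=> mB; have -> := etaE B mB; exact: gauss.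
have := @gaussian1_mgf R mean v s eta v0 H.
have -> := etaI _ (measurable_expRM s) (fun y => expR_ge0 (s * y)).
move=> E.
transitivity (\int[nu]_f ((expR (- (s * mean)))%:E *
    (expR (s * \sum_i t i * (f : CD D) (x i)))%:E))%E.
  apply: eq_integral => f _; rewrite -EFinM -expRD; congr (expR _)%:E.
  rewrite /mean addrC -mulrBr -sumrB; congr (_ * _).
  by apply: eq_bigr => i _; rewrite /centred mulrBr.
rewrite ge0_integralZl//=.
- by rewrite E -EFinM -expRD; congr (expR _)%:E; ring.
- apply/measurable_EFinP; apply: measurableT_comp => //.
  by apply: measurable_funM => //; exact: measurable_combination.
Qed.

Definition increment_variance (x y : 'rV[R]_d) : R :=
  cov x x - cov x y - cov y x + cov y y.

Lemma value_mgf (x : clD) (s : R) : 0 <= cov (set_val x) (set_val x) ->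
  (\int[nu]_f (expR (s * centred f x))%:E =
   (expR (s ^+ 2 * cov (set_val x) (set_val x) / 2))%:E)%E.
Proof.
move=> v0.
have := @gaussian_combination_mgf 1 (fun _ => x) (fun _ => 1) s.
rewrite !big_ord_recl !big_ord0 /= !addr0 !mul1r => /(_ v0) <-.
by apply: eq_integral => f _; rewrite big_ord_recl big_ord0 addr0 mul1r.
Qed.

Lemma increment_mgf (x y : clD) (s : R) :
  0 <= increment_variance (set_val x) (set_val y) ->
  (\int[nu]_f (expR (s * (centred f x - centred f y)))%:E =
   (expR (s ^+ 2 * increment_variance (set_val x) (set_val y) / 2))%:E)%E.
Proof.
move=> v0.
pose X (i : 'I_2) : clD := if i == ord0 then x else y.
pose t (i : 'I_2) : R := if i == ord0 then 1 else -1.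
have := @gaussian_combination_mgf 2 X t s.
rewrite !big_ord_recl !big_ord0 /X /t /= !addr0.
rewrite (_ : _ + _ = increment_variance (set_val x) (set_val y)); last first.
  by rewrite /increment_variance; ring.
move=> /(_ v0) <-.
apply: eq_integral => f _; rewrite !big_ord_recl big_ord0 /= addr0.
by rewrite mul1r mulN1r.
Qed.

Variables (M : R) (M0 : 0 < M) (MP : forall x, clD x -> `|x| < M).
Local Notation cell := (@cell d).
Local Notation rep := (@representative R d D M _).
Variables (V q : R) (V0 : 0 <= V) (q0 : 0 < q).
Hypothesis cov0 : forall x : clD, 0 <= cov (set_val x) (set_val x) <= V.
Hypothesis cov_step : forall n (c : cell n.+1),
  0 <= increment_variance (set_val (rep c)) (set_val (rep (parent c))) <=
  V / 2 ^+ n.+1.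

(** The chain that ends at the representative of a cell starts at the single cell
    of level 0, whose increment is the centred value itself. *)
Definition increment n : cell n -> CD D -> R :=
  match n return cell n -> CD D -> R with
  | 0 => fun c f => centred f (rep c)
  | n'.+1 => fun c f => centred f (rep c) - centred f (rep (parent c))
  end.

Lemma measurable_increment n (c : cell n) :
  measurable_fun [set: CDB] (increment c : CDB -> R).
Proof.
case: n c => [|n] c /=; first exact: measurable_centred.
by apply: measurable_funB; exact: measurable_centred.
Qed.

(** The weights sum up to 1. They decay slowly enough, [(3 / 4)^2 > 1 / 2], for
    the variances [V / 2 ^ n] to make up for the growth of [level_scale n ^ 2]. *)
Definition level_weight n : R := 4^-1 * (3 / 4) ^+ n.

Definition level_scale n : R := q / level_weight n.

Lemma level_weight_gt0 n : 0 < level_weight n.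
Proof. by rewrite mulr_gt0// exprn_gt0// divr_gt0. Qed.

(** The exponent is at most [8 q^2 V (8 / 9)^n]. *)
Lemma increment_moment n (c : cell n) (s : R) : s ^+ 2 = level_scale n ^+ 2 ->
  (\int[nu]_f (expR (s * increment c f))%:E <= (expR (8 * q ^+ 2 * V))%:E)%E.
Proof.
move=> sE.
have key v : 0 <= v <= V / 2 ^+ n -> s ^+ 2 * v / 2 <= 8 * q ^+ 2 * V.
  move=> /andP[v0 vV].
  apply: (@le_trans _ _ (s ^+ 2 * (V / 2 ^+ n) / 2)).
    by rewrite ler_wpM2r ?invr_ge0// ler_wpM2l// sqr_ge0.
  have -> : s ^+ 2 * (V / 2 ^+ n) / 2 = 8 * q ^+ 2 * V * (8 / 9) ^+ n.
    have -> : (8 / 9) ^+ n = ((3 / 4) ^+ n)^-1 ^+ 2 / 2 ^+ n :> R.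
      rewrite -!exprVn -exprM mulnC exprM -exprMn; congr (_ ^+ n).
      by field.
    rewrite sE /level_scale /level_weight; field.
    by rewrite !expf_neq0.
  have p8 : 0 <= 8 * q ^+ 2 * V.
    by apply: mulr_ge0 => //; apply: mulr_ge0 => //; exact: sqr_ge0.
  have l8 : (8 / 9 : R) ^+ n <= 1 by apply: exprn_ile1; lra.
  by rewrite ler_piMr.
case: n c sE key => [|n] c sE key /=.
  have /andP[h0 h1] := cov0 (rep c).
  rewrite value_mgf// lee_fin ler_expR; apply: key.
  by rewrite expr0 divr1 h0.
have /andP[h0 h1] := cov_step c.
by rewrite increment_mgf// lee_fin ler_expR; apply: key; rewrite h0.
Qed.

(** A smooth substitute for the maximum of the increments over the cells: up to
    the number [2 ^ (n d)] of cells, the mean dominates the maximum. *)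
Definition level_sum n (f : CD D) : R :=
  level_weight n * (2 ^+ (n * d))^-1 *
  \sum_(c : cell n) (expR (level_scale n * increment c f) +
                     expR (- level_scale n * increment c f)).

Lemma level_sum_ge0 n f : 0 <= level_sum n f.
Proof.
have w0 := ltW (level_weight_gt0 n).
apply: mulr_ge0; first by rewrite mulr_ge0// invr_ge0 exprn_ge0.
by apply: sumr_ge0 => c _; rewrite addr_ge0 ?expR_ge0.
Qed.

Lemma measurable_expR_increment n (c : cell n) (s : R) :
  measurable_fun [set: CDB] ((fun f : CD D => (expR (s * increment c f))%:E) : CDB -> \bar R).
Proof.
apply/measurable_EFinP; apply: measurableT_comp => //.
by apply: measurable_funM => //; exact: measurable_increment.
Qed.

Lemma measurable_level_sum n :
  measurable_fun [set: CDB] (EFin \o (level_sum n : CDB -> R)).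
Proof.
apply/measurable_EFinP; apply: measurable_funM; first exact: measurable_cst.
apply: measurable_sum => c; apply: measurable_funD.
  by apply/measurable_EFinP; exact: measurable_expR_increment.
by apply/measurable_EFinP; exact: measurable_expR_increment.
Qed.

Lemma level_sum_moment n :
  (\int[nu]_f (level_sum n f)%:E <= (level_weight n * (2 * expR (8 * q ^+ 2 * V)))%:E)%E.
Proof.
have w0 := level_weight_gt0 n.
have p0 : 0 < (2 ^+ (n * d) : R) by rewrite exprn_gt0.
have wp0 : 0 <= level_weight n * (2 ^+ (n * d))^-1.
  by apply: mulr_ge0; [exact: ltW|rewrite invr_ge0 ltW].
rewrite /level_sum; under eq_integral do rewrite EFinM -sumEFin.
rewrite ge0_integralZl//=; last 2 first.
- apply: emeasurable_sum => c; under eq_fun do rewrite EFinD.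
  by apply: emeasurable_funD; exact: measurable_expR_increment.
- by move=> f _; apply: sume_ge0 => c _; rewrite lee_fin addr_ge0 ?expR_ge0.
rewrite ge0_integral_sum//=; last first.
  move=> c; under eq_fun do rewrite EFinD.
  by apply: emeasurable_funD; exact: measurable_expR_increment.
apply: (@le_trans _ _ ((level_weight n * (2 ^+ (n * d))^-1)%:E *
    \sum_(c : cell n) (2 * expR (8 * q ^+ 2 * V))%:E)%E).
  apply: lee_wpmul2l; first by rewrite lee_fin.
  apply: lee_sum => c _; under eq_integral do rewrite EFinD.
  rewrite ge0_integralD//=; try exact: measurable_expR_increment.
  rewrite mulr_natl mulr2n EFinD; apply: leeD; apply: increment_moment => //.
  by rewrite sqrrN.
rewrite sumEFin sumr_const card_ffun !card_ord -EFinM lee_fin.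
rewrite [X in _ * X <= _](_ : _ = 2 ^+ (n * d) * (2 * expR (8 * q ^+ 2 * V))); last first.
  by rewrite -[LHS]mulr_natl !natrX -exprM.
by rewrite -(mulrA (level_weight n)) mulKf// gt_eqF.
Qed.

(** Pathwise chaining: the value at a representative is the sum of the
    increments along its ancestors. The entropy [n d ln 2] of level [n] is
    absorbed by the weights, as [\sum_n level_weight n * n] converges. *)
Lemma chaining N (c : cell N) (f : CD D) :
  expR (q * `|centred f (rep c)|) <=
  expR (3 * (d%:R * ln 2)) * (1 + \sum_(n < N.+1) level_sum n f).
Proof.
pose a n : R := \big[Num.max/0]_(c : cell n) `|increment c f|.
have amax n (c' : cell n) : `|increment c' f| <= a n.
  exact: (le_bigmax _ (fun c => `|increment c f|) c').
have step n (c' : cell n) : `|centred f (rep c')| <= \sum_(i < n.+1) a i.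
  elim: n c' => [|n ih] c'; rewrite big_ord_recr /=.
    by rewrite big_ord0 add0r; exact: (amax 0 c').
  rewrite -[X in `|X|](subrK (centred f (rep (parent c')))).
  apply: (le_trans (ler_normD _ _)); rewrite [leRHS]addrC.
  by apply: lerD; [exact: (amax n.+1 c')|exact: ih].
have w0 n : 0 <= level_weight n by exact/ltW/level_weight_gt0.
have W (n : nat) : level_weight n * level_scale n = q.
  by rewrite /level_scale mulrC divfK// gt_eqF// level_weight_gt0.
pose L : R := d%:R * ln 2.
have L0 : 0 <= L by rewrite mulr_ge0// ln_ge0// ler1n.
have a_exp n : level_weight n * expR (level_scale n * a n - n%:R * L) <= level_sum n f.
  rewrite /level_sum -mulrA ler_wpM2l// expRB.
  have -> : expR (n%:R * L) = 2 ^+ (n * d).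
    by rewrite /L mulrA -natrM expRM_natl lnK// posrE.
  rewrite mulrC ler_wpM2l ?invr_ge0 ?exprn_ge0//.
  rewrite /a; set S := \sum_(c : cell n) _.
  have S_ge (c' : cell n) : expR (level_scale n * `|increment c' f|) <= S.
    apply: (le_trans (expR_normr_le _ _)).
    rewrite /S (bigD1 c')//= lerDl; apply: sumr_ge0 => i _.
    by apply: addr_ge0; exact: expR_ge0.
  have s0 : 0 <= level_scale n by rewrite divr_ge0// ltW.
  have [c0] : exists c0 : cell n, true.
    by have [c0 _] := in_cell_exists M0 MP n (closure_point D); exists c0.
  move=> _; apply: (big_ind (fun v => expR (level_scale n * v) <= S)).
  - apply: le_trans (S_ge c0); rewrite mulr0 ler_expR mulr_ge0//.
  - by move=> x y Sx Sy; rewrite /Num.max; case: ifP.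
  - by move=> c' _; exact: S_ge.
apply: (@le_trans _ _ (expR (3 * L + \sum_(n < N.+1)
    level_weight n * (level_scale n * a n - n%:R * L)))).
  rewrite ler_expR; apply: (@le_trans _ _ (q * \sum_(i < N.+1) a i)).
    by rewrite ler_pM2l.
  under [X in _ <= _ + X]eq_bigr do rewrite mulrBr mulrA W.
  rewrite sumrB -mulr_sumr addrCA lerDl subr_ge0.
  have -> : \sum_(i < N.+1) level_weight i * (i%:R * L) =
      4^-1 * L * \sum_(i < N.+1) i%:R * (3 / 4) ^+ i.
    by rewrite mulr_sumr; apply: eq_bigr => i _; rewrite /level_weight; ring.
  rewrite sum_nat_geometric.
  have e0 : 0 <= (4 * N.+1%:R + 12) * (3 / 4) ^+ N.+1 :> R.
    by rewrite mulr_ge0 ?exprn_ge0 ?divr_ge0// addr_ge0// mulr_ge0.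
  have -> : 3 * L = 4^-1 * L * 12 by field.
  by apply: ler_wpM2l; [rewrite mulr_ge0 ?invr_ge0|rewrite gerBl].
rewrite expRD ler_wpM2l ?expR_ge0//.
have J := @expR_weighted_sum R N.+1 (fun n => level_weight n)
  (fun n => level_scale n * a n - n%:R * L).
apply: (le_trans (J _ _)).
- by move=> i; exact: w0.
- rewrite /level_weight sum_geometric; have : 0 <= (3 / 4 : R) ^+ N.+1 by rewrite exprn_ge0.
  lra.
- by rewrite lerD2l; apply: ler_sum => i _; exact: a_exp.
Qed.

(** The right-hand side of [chaining] increases to a limit that does not depend on
    the cell, and the representatives are dense. *)
Lemma sup_moment (B : R) :
  (forall x : clD, `|m x| <= B) ->
  (\int[nu]_f (expR (q * Linf_norm D (CD_Linf f)))%:E <=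
   (expR (q * B) * (expR (3 * (d%:R * ln 2)) * (1 + 2 * expR (8 * q ^+ 2 * V))))%:E)%E.
Proof.
move=> mB; set K3 := expR (3 * _).
have K3p : 0 < K3 by exact: expR_gt0.
have H0 n (f : CD D) : (0 <= (level_sum n f)%:E)%E by rewrite lee_fin level_sum_ge0.
pose F (f : CD D) : \bar R := ((expR (q * B))%:E * (K3%:E * (1 + \sum_(n <oo) (level_sum n f)%:E)))%E.
have sum0 (f : CD D) : (0 <= \sum_(n <oo) (level_sum n f)%:E)%E.
  by apply: nneseries_ge0 => n _ _; exact: H0.
have bound (f : CD D) : ((expR (q * Linf_norm D (CD_Linf f)))%:E <= F f)%E.
  have := sum0 f; rewrite /F.
  case E : (\sum_(n <oo) (level_sum n f)%:E)%E => [r| |//] r0; last first.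
    by rewrite addey// !gt0_muley ?lte_fin ?expR_gt0// leey.
  rewrite -EFinD -!EFinM lee_fin.
  have r1 : 0 < 1 + r by rewrite ltr_pwDl// -lee_fin.
  have rep_le n (c : cell n) : q * `|centred f (rep c)| <= ln (K3 * (1 + r)).
    rewrite -ler_expR lnK ?posrE ?mulr_gt0//; apply: (le_trans (chaining c f)).
    rewrite ler_pM2l// lerD2l -lee_fin -E -sumEFin.
    rewrite -(big_mkord xpredT (fun n => (level_sum n f)%:E)).
    by apply: nneseries_lim_ge => i _ _; exact: H0.
  have -> : K3 * (1 + r) = expR (ln (K3 * (1 + r))) by rewrite lnK ?posrE ?mulr_gt0.
  rewrite -expRD ler_expR; set l := ln _ in rep_le *.
  have sup_le : sup_norm f <= B + l / q.
    apply: sup_norm_le => x; apply/ler_addgt0Pl => e e0.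
    have [n [c fc]] := representative_dense M0 MP f x e0.
    have h1 : `|centred f (rep c)| <= l / q by rewrite ler_pdivlMr// mulrC.
    have h2 := mB (rep c).
    have h3 : `|f (rep c)| <= B + l / q.
      have -> : f (rep c) = m (rep c) + centred f (rep c).
        by rewrite /centred addrC subrK.
      by apply: (le_trans (ler_normD _ _)); exact: lerD.
    have := ler_normD (f x - f (rep c)) (f (rep c)); rewrite subrK.
    by move: fc h3; lra.
  have := le_trans (Linf_norm_CD_le f) sup_le.
  rewrite -(ler_pM2l q0) mulrDr [q * (l / q)]mulrC divfK// gt_eqF//.
have mS : measurable_fun [set: CDB] ((fun f : CD D => (\sum_(n <oo) (level_sum n f)%:E)%E) : CDB -> \bar R).
  apply: ge0_emeasurable_sum => [n f _ _|n _]; first exact: H0.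
  exact: measurable_level_sum.
have m1S : measurable_fun [set: CDB] ((fun f : CD D => (1 + \sum_(n <oo) (level_sum n f)%:E)%E) : CDB -> \bar R).
  by apply: emeasurable_funD => //; exact: measurable_cst.
have pS (f : CD D) : (0 <= 1 + \sum_(n <oo) (level_sum n f)%:E)%E by rewrite adde_ge0.
apply: (@le_trans _ _ (\int[nu]_f F f)%E).
  apply: ge0_le_integral => //.
  - apply/measurable_EFinP; apply: measurableT_comp => //.
    by apply: measurable_funM => //; exact: measurable_Linf_norm_CD.
  - by apply: measurable_funeM; exact: measurable_funeM.
have mKS : measurable_fun [set: CDB] ((fun f : CD D =>
    (K3%:E * (1 + \sum_(n <oo) (level_sum n f)%:E))%E) : CDB -> \bar R).
  exact: measurable_funeM.
have pKS (f : CD D) : (0 <= K3%:E * (1 + \sum_(n <oo) (level_sum n f)%:E))%E.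
  by rewrite mule_ge0// lee_fin ltW.
have eB : (0 <= (expR (q * B))%:E)%E by rewrite lee_fin expR_ge0.
have K3e : (0 <= K3%:E)%E by rewrite lee_fin ltW.
rewrite /F ge0_integralZl//=.
rewrite EFinM; apply: lee_wpmul2l; first by rewrite lee_fin expR_ge0.
rewrite ge0_integralZl//=.
rewrite EFinM; apply: lee_wpmul2l; first by rewrite lee_fin ltW.
rewrite ge0_integralD//=.
rewrite integral_cst// [X in (1 * X + _)%E](_ : _ = 1%E); last exact: probability_setT.
rewrite mule1 EFinD leeD2l//.
rewrite integral_nneseries//; last by move=> n; exact: measurable_level_sum.
set E8 := expR (8 * _ * _).
apply: lime_le.
  by apply: is_cvg_nneseries => n _ _; apply: integral_ge0 => f _; exact: H0.
apply: nearW => N; rewrite big_mkord.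
apply: (@le_trans _ _ (\sum_(n < N) (level_weight n * (2 * E8))%:E)%E).
  by apply: lee_sum => n _; exact: level_sum_moment.
rewrite sumEFin lee_fin -mulr_suml ler_piMl ?mulr_ge0 ?expR_ge0//.
rewrite /level_weight sum_geometric; have : 0 <= (3 / 4 : R) ^+ N by rewrite exprn_ge0.
lra.
Qed.

End field_moments.

(** * Lognormal coefficients with Matern covariances *)

Section lognormal_moments.
Context {R : realType} {d : nat} (D : bounded_lipschitz_domain R d).
Local Notation clD := (closure (domain_set D)).
Local Notation CDB := (borelType (@CD_dist R d D)).
Local Notation mu := (lebesgue_domain D).
Local Notation T := (borel_rV R d).
Variables (r_m s_max : R) (k_max : nat) (rho_min : R).
Hypothesis rho_min_gt0 : 0 < rho_min.

Lemma eucl_normB (x y : 'rV[R]_d) : eucl_norm (x - y) = eucl_norm (y - x).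
Proof.
rewrite /eucl_norm; congr Num.sqrt; apply: eq_bigr => i _.
by rewrite !mxE -sqrrN opprB.
Qed.

(** A Matern covariance is Lipschitz at the diagonal, uniformly in the class,
    so that the increments along a chain have geometrically decaying
    variances. *)
Lemma matern_increment_variance s2 rho k (x y : 'rV[R]_d) : 0 <= s2 -> 0 < rho ->
  0 <= increment_variance (@matern R s2 rho k d) x y <=
  2 * (s2 * (Num.sqrt (2 * k + 1)%:R / rho * eucl_norm (x - y))).
Proof.
move=> s0 r0; rewrite /increment_variance !matern_diag//.
have /andP[h1 h2] := matern_bounds k x y s0 r0.
have := matern_bounds k y x s0 r0; rewrite eucl_normB => /andP[h3 h4].
move: h1 h2 h3 h4; move: (matern _ _ _ x y) (matern _ _ _ y x) (s2 * (_ / _ * _)).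
move=> X Y b h1 h2 h3 h4.
have -> : s2 - X - Y + s2 = (s2 - X) + (s2 - Y) by ring.
by apply/andP; split; lra.
Qed.

Lemma matern_moment (q : R) : 0 < q -> exists K : R,
  forall m c (nu : probability CDB R), mean_class r_m m ->
  matern_class s_max rho_min k_max c -> is_gaussian m c nu ->
  (\int[nu]_f (expR (q * Linf_norm D (CD_Linf f)))%:E <= K%:E)%E.
Proof.
move=> q0; have [M M0 MP] := closure_bounded_norm D.
pose L : R := Num.sqrt (2 * k_max + 1)%:R / rho_min.
have L0 : 0 <= L by rewrite divr_ge0 ?sqrtr_ge0// ltW.
pose dM : R := d%:R * (2 * M).
have dM0 : 0 <= dM by rewrite mulr_ge0 ?mulr_ge0// ltW.
pose V : R := s_max ^+ 2 * (1 + 4 * (L * dM)).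
have LdM0 : 0 <= L * dM by exact: mulr_ge0.
have V0 : 0 <= V by rewrite mulr_ge0 ?sqr_ge0//; lra.
exists (expR (q * r_m) * (expR (3 * (d%:R * ln 2)) * (1 + 2 * expR (8 * q ^+ 2 * V)))).
move=> m c nu mM [s [rho [k [/andP[s0 sm] rm km ->]]]] gauss.
have r0 : 0 < rho by exact: lt_le_trans rm.
have ss : s ^+ 2 <= s_max ^+ 2 by rewrite ler_sqr// nnegrE ltW// (lt_le_trans s0).
have Lk : Num.sqrt (2 * k + 1)%:R / rho <= L.
  rewrite /L ler_pM ?sqrtr_ge0 ?invr_ge0 ?(ltW r0)//.
    by rewrite ler_sqrt// ler_nat leq_add2r leq_mul2l.
  by rewrite lef_pV2.
apply: (sup_moment gauss M0 MP V0 q0).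
- move=> x; rewrite (matern_diag k _ (sqr_ge0 s) r0) sqr_ge0/=; apply: (le_trans ss).
  by rewrite ler_peMr ?sqr_ge0//; lra.
- move=> n c'.
  have /andP[-> h] := matern_increment_variance k
    (set_val (representative D M c')) (set_val (representative D M (parent c')))
    (sqr_ge0 s) r0.
  apply: (le_trans h).
  have stp := representative_step M0 MP c'.
  apply: (@le_trans _ _ (2 * (s_max ^+ 2 * (L * @mesh R d M n)))).
    rewrite ler_pM2l//; apply: ler_pM; rewrite ?sqr_ge0//.
      by rewrite !mulr_ge0 ?sqrtr_ge0// invr_ge0 ltW.
    by apply: ler_pM; rewrite ?sqrtr_ge0// divr_ge0 ?sqrtr_ge0// ltW.
  have p0 : 0 < (2 ^+ n : R)^-1 by rewrite invr_gt0 exprn_gt0.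
  have -> : V / 2 ^+ n.+1 = s_max ^+ 2 * ((1 + 4 * (L * dM)) / 2) / 2 ^+ n.
    by rewrite exprS /V; field; rewrite expf_neq0.
  rewrite /mesh -/dM.
  have -> : 2 * (s_max ^+ 2 * (L * (dM / 2 ^+ n))) =
      s_max ^+ 2 * (2 * (L * dM)) / 2 ^+ n by ring.
  rewrite ler_pM2r// ler_wpM2l ?sqr_ge0//; lra.
- by move=> x; apply: le_trans mM; exact: le_sup_norm_CD.
Qed.

Lemma Linf_norm_near (f g : Linf D) :
  Linf_norm D f <= Linf_norm D g + Linf_dist f g.
Proof.
have b0 : essbdd D (cst 0 : T -> R).
  by apply/Lfun_essbdd; exact: cst_Linf.
have bf := Linf_essbdd f; have bg := Linf_essbdd g.
have := Linf_norm_triangle bf bg b0.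
have E (h : Linf D) : Linf_norm D (fun x => h x - cst 0 x) = Linf_norm D h.
  by congr Linf_norm; apply/funext => x; rewrite /= subr0.
by rewrite !E addrC.
Qed.

Lemma measurable_Linf_norm :
  measurable_fun [set: borelType (@Linf_dist R d D)]
    ((fun f => Linf_norm D (f : Linf D)) : borelType (@Linf_dist R d D) -> R).
Proof.
apply: measurable_borelType_real => f e e0; exists e => // g.
apply: le_lt_trans; rewrite ler_norml.
have h1 := Linf_norm_near f g; have := Linf_norm_near g f.
rewrite {1}/Linf_dist Linf_norm_sym -/(Linf_dist f g) => h2.
by apply/andP; split; lra.
Qed.

Lemma lognormE (a : Linfp D) : lognorm a = Linf_norm D (Linfp_ln a).
Proof.
apply: eq_Linf_norm_ae; [exact: essbdd_ln|exact: Linf_essbdd|].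
by apply: Lspace_ofE; apply/Lfun_essbdd; exact: essbdd_ln.
Qed.

(** The hypothesis compares the law of [ln a] with a law on [C(D)] as measures on
    [L^oo(D)]; the norm is a Borel function there, and carries both to the same
    law on the real line. *)
Lemma lognormal_moment (q : R) : 0 < q -> exists K : R,
  forall (dA : Linfp D -> Linfp D -> R) (Pa : probability (borelType dA) R),
  coefficient_metric dA ->
  lognormal (mean_class r_m) (matern_class s_max rho_min k_max (d:=d)) Pa ->
  (\int[Pa]_a (expR (q * lognorm a))%:E <= K%:E)%E.
Proof.
move=> q0; have [K KP] := matern_moment q0.
exists K => dA Pa mA [m [c [nu [mm cc gauss E]]]].
apply: le_trans (KP m c nu mm cc gauss).
have [eta [etaE etaI]] := pushforward_probability (T2 := measurableTypeR R) nu
  (@measurable_Linf_norm_CD R d D).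
have [xi [xiE xiI]] := pushforward_probability (T2 := measurableTypeR R) Pa
  (measurable_lognorm mA).
have e0 (y : R) : (0 <= (expR (q * y))%:E)%E by rewrite lee_fin expR_ge0.
rewrite -(etaI _ (measurable_expRM q) e0) -(xiI _ (measurable_expRM q) e0).
rewrite (@eq_measure_integral _ _ _ _ eta)// => B mB _.
apply: etrans (xiE B mB) _; apply: etrans _ (esym (etaE B mB)).
have mBn : measurable ((fun f => Linf_norm D (f : Linf D)) @^-1` B :
    set (borelType (@Linf_dist R d D))).
  by rewrite -[X in measurable X]setTI; exact: measurable_Linf_norm.
apply: etrans _ (E _ mBn); congr (Pa _).
by apply/funext => a; rewrite /preimage/= lognormE.
Qed.

End lognormal_moments.

(** * Transport of couplings *)

Section products.
Context {R : realType} (S T : pointedType) (dS : S -> S -> R) (dT : T -> T -> R).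

(** The Borel sets of the sum of two metrics contain the product sigma-algebra,
    possibly strictly. The integrand is measurable for the latter, on which the
    values on rectangles determine [P]. *)
Lemma integral_product (P : probability (borelType (sum_dist dS dT)) R)
    (PS : probability (borelType dS) R) (PT : probability (borelType dT) R)
    (g : S -> R) (h : T -> R) :
  pseudometric dS -> pseudometric dT -> is_product P PS PT ->
  measurable_fun setT (g : borelType dS -> R) ->
  measurable_fun setT (h : borelType dT -> R) ->
  (forall x, 0 <= g x) -> (forall y, 0 <= h y) ->
  (\int[P]_z (g z.1 * h z.2)%:E =
   (\int[PS]_x (g x)%:E) * (\int[PT]_y (h y)%:E))%E.
Proof.
move=> mS mT PE mg mh g0 h0.
have mid : measurable_fun [set: borelType (sum_dist dS dT)]
    ((fun z => (z.1, z.2)) : _ -> (borelType dS * borelType dT)%type).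
  apply: measurable_fun_pair; first exact: measurable_sum_dist_fst.
  exact: measurable_sum_dist_snd.
have [Q [QE QI]] := pushforward_probability P mid.
pose f (z : borelType dS * borelType dT) : \bar R := (g z.1 * h z.2)%:E.
have mf : measurable_fun setT f.
  apply/measurable_EFinP; apply: measurable_funM.
    exact: (@measurableT_comp _ _ _ _ _ _ (g : borelType dS -> R)).
  exact: (@measurableT_comp _ _ _ _ _ _ (h : borelType dT -> R)).
have f0 z : (0 <= f z)%E by rewrite lee_fin mulr_ge0.
transitivity (\int[Q]_z f z)%E; first by rewrite QI.
transitivity (\int[PS \x PT]_z f z)%E.
  apply: (@eq_measure_integral _ _ _ _ (PS \x PT)%E) => A mA _.
  apply/esym; apply: product_measure_unique => // B C mB mC.
  apply: etrans (QE _ (measurableX mB mC)) _; rewrite -PE//.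
rewrite fubini_tonelli1// /fubini_F /f /=.
have I0 : (0 <= \int[PT]_y (h y)%:E)%E.
  by apply: integral_ge0 => y _; rewrite lee_fin.
rewrite muleC -ge0_integralZl//; last 2 first.
- exact/measurable_EFinP.
- by move=> x _; rewrite lee_fin.
apply: eq_integral => x _; under eq_integral do rewrite EFinM.
rewrite ge0_integralZl//; first by rewrite muleC.
- exact/measurable_EFinP.
- by move=> y _; rewrite lee_fin.
- by rewrite lee_fin.
Qed.

End products.

Section powers.
Context {R : realType}.

Lemma powRD_le (x y r : R) : 0 <= x -> 0 <= y -> 0 <= r ->
  (x + y) `^ r <= 2 `^ r * (x `^ r + y `^ r).
Proof.
move=> x0 y0 r0.
wlog xy : x y x0 y0 / x <= y.
  move=> H; have [|/ltW] := leP x y; first exact: H.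
  by move=> /H; rewrite addrC [y `^ r + _]addrC; exact.
apply: (@le_trans _ _ ((2 * y) `^ r)).
  by apply: ge0_ler_powR; rewrite ?nnegrE ?addr_ge0 ?mulr_ge0//; lra.
by rewrite powRM// ler_wpM2l ?powR_ge0// lerDr powR_ge0.
Qed.

Lemma ge0_lee_poweR (r : R) (x y : \bar R) : 0 <= r -> (0 <= x)%E -> (x <= y)%E ->
  (x `^ r <= y `^ r)%E.
Proof.
move=> r0 x0 xy; apply: gt0_ler_poweR => //; rewrite in_itv/= leey andbT//.
exact: le_trans xy.
Qed.

End powers.

Section weighted_lipschitz.
Context {R : realType} (X Y : pointedType) (dX : X -> X -> R) (dY : Y -> Y -> R).
Hypotheses (mX : pseudometric dX) (mY : pseudometric dY).
Variables (F : borelType dX -> borelType dY) (w : X -> R) (K p A : R).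
Hypothesis F_continuous : forall (x : X) (e : R), 0 < e ->
  exists2 t : R, 0 < t & forall y, dX x y < t -> dY (F x) (F y) < e.
Hypothesis w0 : forall x, 0 <= w x.
Hypothesis mw : measurable_fun setT (w : borelType dX -> R).
Hypotheses (K0 : 0 < K) (p0 : 0 < p) (A0 : 0 <= A).
Hypothesis F_lipschitz : forall x y, dY (F x) (F y) <= K * (w x + w y) * dX x y.

(** The summand [1] makes the constant positive, so that the infimum over the
    couplings may be divided by it. *)
Definition weighted_constant : R :=
  (1 + (K * 2) `^ (2 * p) * (A + A)) `^ (2 * p)^-1.

Lemma measurable_image_pair : measurable_fun setT ((fun z => (F z.1, F z.2)) :
  borelType (sum_dist dX dX) -> borelType (sum_dist dY dY)).
Proof.
apply: measurable_borelType => -[x1 x2] e e0.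
have e2 : 0 < e / 2 by rewrite divr_gt0.
have [t1 t10 h1] := F_continuous x1 e2; have [t2 t20 h2] := F_continuous x2 e2.
exists (Num.min t1 t2) => [|[y1 y2]]; first by rewrite lt_min t10.
have := pseudometric_ge0 mX x1 y1; have := pseudometric_ge0 mX x2 y2.
rewrite /sum_dist/= lt_min => g2 g1 /andP[l1 l2].
have := h1 y1; have := h2 y2; have : dX x1 y1 < t1 by lra.
have : dX x2 y2 < t2 by lra.
by move=> a b /(_ a) c /(_ b) d; lra.
Qed.

Lemma measurable_image_dist : measurable_fun setT
  ((fun z => dY (F z.1) (F z.2)) : borelType (sum_dist dX dX) -> R).
Proof. exact: (measurableT_comp (measurable_dist mY) measurable_image_pair). Qed.

Lemma coupling_image (P Q : probability (borelType dX) R) pi :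
  coupling P Q pi -> exists2 pi' : probability (borelType (sum_dist dY dY)) R,
  coupling (pushforward P F) (pushforward Q F) pi' &
  (\int[pi']_z (dY z.1 z.2 `^ p)%:E = \int[pi]_z (dY (F z.1) (F z.2) `^ p)%:E)%E.
Proof.
move=> piPQ.
have mF : measurable_fun setT F by exact: measurable_borelType.
have mFF := measurable_image_pair.
have [pi' [piE piI]] := pushforward_probability pi mFF.
exists pi'.
  move=> B mB; rewrite !piE.
  - have mFB : measurable (F @^-1` B) by rewrite -[X in measurable X]setTI; exact: mF.
    have [h1 h2] := piPQ _ mFB.
    split; [apply: etrans _ h1|apply: etrans _ h2]; congr (pi _);
      by apply/seteqP; split => -[x y] //= [].
  - rewrite setTX -[X in measurable X]setTI.
    exact: (measurable_sum_dist_snd (dT := dY) mY).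
  - rewrite setXT -[X in measurable X]setTI.
    exact: (measurable_sum_dist_fst (dS := dY) mY).
rewrite piI// => [|z]; last by rewrite lee_fin powR_ge0.
apply/measurable_EFinP; apply: (measurableT_comp (measurable_powR p)).
exact: measurable_dist.
Qed.

Lemma coupling_marginals (P Q : probability (borelType dX) R) pi (f : X -> R) :
  coupling P Q pi -> measurable_fun setT (f : borelType dX -> R) ->
  (forall x, 0 <= f x) ->
  (\int[pi]_z (f z.1)%:E = \int[P]_x (f x)%:E)%E /\
  (\int[pi]_z (f z.2)%:E = \int[Q]_x (f x)%:E)%E.
Proof.
move=> piPQ mf f0.
have mE : measurable_fun setT (EFin \o f : borelType dX -> \bar R) by exact/measurable_EFinP.
have e0 x : (0 <= (EFin \o f) x)%E by rewrite lee_fin.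
have [eta1 [E1 I1]] := pushforward_probability pi (measurable_sum_dist_fst mX).
have [eta2 [E2 I2]] := pushforward_probability pi (measurable_sum_dist_snd mX).
split.
  rewrite -[LHS](I1 _ mE e0); apply: eq_measure_integral => B mB _.
  by apply: etrans (E1 B mB) _; apply: etrans _ (piPQ B mB).1; rewrite setXT.
rewrite -[LHS](I2 _ mE e0); apply: eq_measure_integral => B mB _.
by apply: etrans (E2 B mB) _; apply: etrans _ (piPQ B mB).2; rewrite setTX.
Qed.

Lemma weighted_constant_gt0 : 0 < weighted_constant.
Proof.
by rewrite powR_gt0// ltr_pwDl// mulr_ge0 ?addr_ge0// powR_ge0.
Qed.

Lemma coupling_weight_moment (P Q : probability (borelType dX) R) pi :
  coupling P Q pi ->
  (\int[P]_x (w x `^ (2 * p))%:E <= A%:E)%E ->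
  (\int[Q]_x (w x `^ (2 * p))%:E <= A%:E)%E ->
  (\int[pi]_z ((K * (w z.1 + w z.2)) `^ (2 * p))%:E <=
   ((K * 2) `^ (2 * p) * (A + A))%:E)%E.
Proof.
move=> piPQ PA QA; set q := 2 * p in PA QA *.
have q0 : 0 <= q by rewrite mulr_ge0// ltW.
have mwq : measurable_fun setT ((fun x => w x `^ q) : borelType dX -> R).
  exact: (measurableT_comp (measurable_powR q) mw).
have wq0 x : 0 <= w x `^ q by exact: powR_ge0.
have [I1 I2] := coupling_marginals piPQ mwq wq0.
have mw1 : measurable_fun setT ((fun z => w z.1) : borelType (sum_dist dX dX) -> R).
  exact: (measurableT_comp mw (measurable_sum_dist_fst mX)).
have mw2 : measurable_fun setT ((fun z => w z.2) : borelType (sum_dist dX dX) -> R).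
  exact: (measurableT_comp mw (measurable_sum_dist_snd mX)).
have mwq1 : measurable_fun setT ((fun z => w z.1 `^ q) : borelType (sum_dist dX dX) -> R).
  exact: (measurableT_comp (measurable_powR q) mw1).
have mwq2 : measurable_fun setT ((fun z => w z.2 `^ q) : borelType (sum_dist dX dX) -> R).
  exact: (measurableT_comp (measurable_powR q) mw2).
have c0 : 0 <= (K * 2) `^ q by exact: powR_ge0.
apply: (@le_trans _ _ (\int[pi]_z (((K * 2) `^ q)%:E * ((w z.1 `^ q)%:E + (w z.2 `^ q)%:E)))%E).
  apply: ge0_le_integral => //.
  - by move=> z _; rewrite lee_fin powR_ge0.
  - apply/measurable_EFinP; apply: (measurableT_comp (measurable_powR q)).
    by apply: measurable_funM => //; exact: measurable_funD.
  - apply: measurable_funeM; apply: emeasurable_funD; exact/measurable_EFinP.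
  - move=> z _; rewrite -EFinD -EFinM lee_fin.
    rewrite !powRM ?addr_ge0// ?(ltW K0)// -mulrA ler_wpM2l ?powR_ge0//.
    exact: powRD_le.
rewrite ge0_integralZl//; last 2 first.
- by apply: emeasurable_funD; exact/measurable_EFinP.
- by move=> z _; rewrite adde_ge0 ?lee_fin.
rewrite EFinM; apply: lee_wpmul2l => //.
rewrite ge0_integralD//; last 4 first.
- by move=> z _; rewrite lee_fin.
- exact/measurable_EFinP.
- by move=> z _; rewrite lee_fin.
- exact/measurable_EFinP.
by rewrite EFinD I1 I2 leeD.
Qed.

(** The image of a coupling is a coupling of the images, so the infimum over
    the latter is bounded by Cauchy-Schwarz along each coupling of the
    sources. *)
Lemma wasserstein_weighted_lipschitz (P Q : probability (borelType dX) R) :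
  (\int[P]_x (w x `^ (2 * p))%:E <= A%:E)%E ->
  (\int[Q]_x (w x `^ (2 * p))%:E <= A%:E)%E ->
  (wasserstein (dist := dY) p (pushforward P F) (pushforward Q F) <=
   weighted_constant%:E * wasserstein (dist := dX) (2 * p) P Q)%E.
Proof.
move=> PA QA; have C0 := weighted_constant_gt0.
rewrite -lee_pdivrMl//; apply: le_ereal_inf_tmp => _ [pi piPQ <-].
rewrite lee_pdivrMl//.
have [pi' pi'PQ piE] := coupling_image piPQ.
apply: (@le_trans _ _ ((\int[pi']_z (dY z.1 z.2 `^ p)%:E) `^ p^-1)%E).
  by apply: ereal_inf_lbound; exists pi'.
have pi0 : 0 <= p^-1 by rewrite invr_ge0 ltW.
have p2 : 0 < 2 * p by rewrite mulr_gt0.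
pose f (z : borelType (sum_dist dX dX)) : R := (K * (w z.1 + w z.2)) `^ p.
pose g (z : borelType (sum_dist dX dX)) : R := dX z.1 z.2 `^ p.
have mw1 : measurable_fun setT ((fun z => w z.1) : borelType (sum_dist dX dX) -> R).
  exact: (measurableT_comp mw (measurable_sum_dist_fst mX)).
have mw2 : measurable_fun setT ((fun z => w z.2) : borelType (sum_dist dX dX) -> R).
  exact: (measurableT_comp mw (measurable_sum_dist_snd mX)).
have mf : measurable_fun setT f.
  apply: (measurableT_comp (measurable_powR p)).
  by apply: measurable_funM => //; exact: measurable_funD.
have mg : measurable_fun setT g.
  by apply: (measurableT_comp (measurable_powR p)); exact: measurable_dist.
have f0 z : 0 <= f z by exact: powR_ge0.
have g0 z : 0 <= g z by exact: powR_ge0.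
have dX0 := pseudometric_ge0 mX; have dY0 := pseudometric_ge0 mY.
have Kw0 (z : X * X) : 0 <= K * (w z.1 + w z.2).
  by rewrite mulr_ge0 ?addr_ge0// ltW.
have fg : (\int[pi']_z (dY z.1 z.2 `^ p)%:E <= 'N[pi]_1[EFin \o (f \* g)%R])%E.
  rewrite piE Lnorm1; apply: ge0_le_integral => //.
  - by move=> z _; rewrite lee_fin powR_ge0.
  - apply/measurable_EFinP; apply: (measurableT_comp (measurable_powR p)).
    exact: measurable_image_dist.
  - apply: measurableT_comp => //; apply/measurable_EFinP; exact: measurable_funM.
  - move=> z _; rewrite /= lee_fin ger0_norm ?mulr_ge0// /f /g -powRM//.
    apply: ge0_ler_powR; rewrite ?nnegrE ?mulr_ge0 ?addr_ge0 ?(ltW p0) ?(ltW K0)//.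
have two0 : 0 < 2 :> R by [].
have two1 : 2^-1 + 2^-1 = 1 :> R by field.
have H := le_trans fg (hoelder pi mf mg two0 two0 two1).
apply: (@le_trans _ _ (('N[pi]_2%:E[EFin \o f] * 'N[pi]_2%:E[EFin \o g]) `^ p^-1)%E).
  apply: ge0_lee_poweR => //.
  by apply: integral_ge0 => z _; rewrite lee_fin powR_ge0.
rewrite poweRM ?Lnorm_ge0//.
have N2 (h : borelType (sum_dist dX dX) -> R) (u : X * X -> R) :
    (forall z, 0 <= u z) -> (forall z, h z = u z `^ p) ->
    ('N[pi]_2%:E[EFin \o h] `^ p^-1 =
     (\int[pi]_z (u z `^ (2 * p))%:E) `^ (2 * p)^-1)%E.
  move=> u0 hE; rewrite unlock -poweRrM invfM; congr (_ `^ _)%E.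
  apply: eq_integral => z _; rewrite /= hE ger0_norm ?powR_ge0//.
  by rewrite -powRrM mulrC.
rewrite (N2 f (fun z => K * (w z.1 + w z.2)))//.
rewrite (N2 g (fun z => dX z.1 z.2))//.
apply: lee_wpmul2r; first exact: poweR_ge0.
rewrite /weighted_constant -poweR_EFin; apply: ge0_lee_poweR.
- by rewrite invr_ge0 ltW.
- by apply: integral_ge0 => z _; rewrite lee_fin powR_ge0.
- by apply: (le_trans (coupling_weight_moment piPQ PA QA)); rewrite lee_fin lerDr.
Qed.

End weighted_lipschitz.

(** * The estimate for lognormal coefficients *)

Section main.
Context {R : realType} {d : nat} (D : bounded_lipschitz_domain R d).
Local Notation mu := (lebesgue_domain D).
Variables (p r_m s_max : R) (k_max : nat) (rho_min r_f : R).
Hypotheses (p_ge1 : 1 <= p) (rho_min_gt0 : 0 < rho_min).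

Lemma rhs_moment (Pf : probability (borelType (@L2_dist R d D)) R) :
  (\int[Pf]_f (L2_norm D f `^ (2 * p))%:E <= r_f%:E)%E ->
  (\int[Pf]_f ((1 + norm2 mu (f : L2 D)) `^ (2 * p))%:E <=
   (2 `^ (2 * p) * (1 + r_f))%:E)%E.
Proof.
move=> Pr; set q := 2 * p in Pr *.
have q0 : 0 <= q by rewrite mulr_ge0// (le_trans _ p_ge1).
have mn := @measurable_norm2_L2 R d D.
have mnq : measurable_fun [set: borelType (@L2_dist R d D)]
    ((fun f => norm2 mu (f : L2 D) `^ q) : borelType (@L2_dist R d D) -> R).
  exact: (measurableT_comp (measurable_powR q) mn).
apply: (@le_trans _ _ (\int[Pf]_f ((2 `^ q)%:E * (1%:E + (norm2 mu (f : L2 D) `^ q)%:E)))%E).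
  apply: ge0_le_integral => //.
  - by move=> f _; rewrite lee_fin powR_ge0.
  - apply/measurable_EFinP; apply: (measurableT_comp (measurable_powR q)).
    by apply: measurable_funD => //; exact: measurable_cst.
  - by apply: measurable_funeM; apply: emeasurable_funD => //; exact/measurable_EFinP.
  - move=> f _; rewrite -EFinD -EFinM lee_fin.
    by have := powRD_le ler01 (norm2_ge0 mu (f : L2 D)) q0; rewrite powR1.
have e0 f : (0 <= (norm2 mu (f : L2 D) `^ q)%:E)%E by rewrite lee_fin powR_ge0.
have mnqE : measurable_fun [set: borelType (@L2_dist R d D)]
    ((fun f => (norm2 mu (f : L2 D) `^ q)%:E) : borelType (@L2_dist R d D) -> \bar R).
  exact/measurable_EFinP.
have m1 : measurable_fun [set: borelType (@L2_dist R d D)]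
    ((fun f => 1%:E + (norm2 mu (f : L2 D) `^ q)%:E)%E : borelType (@L2_dist R d D) -> \bar R).
  by apply: emeasurable_funD => //; exact: measurable_cst.
have e1 f : (0 <= 1%:E + (norm2 mu (f : L2 D) `^ q)%:E)%E by exact: adde_ge0.
have c0 : (0 <= (2 `^ q)%:E :> \bar R)%E by rewrite lee_fin powR_ge0.
rewrite ge0_integralZl//.
rewrite EFinM; apply: lee_wpmul2l; first by rewrite lee_fin powR_ge0.
rewrite ge0_integralD//.
rewrite integral_cst// [X in (1%:E * X + _)%E](_ : _ = 1%E); last exact: probability_setT.
rewrite mule1 (EFinD 1 r_f); apply: leeD2l; apply: le_trans Pr.
rewrite le_eqVlt; apply/orP; left; apply/eqP; apply: eq_integral => f _.
by rewrite (L2_normE (L2_sqint f)).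
Qed.

(** Under a product measure the coefficient and the right-hand side are
    independent, so the moments of the weight are products of moments. *)
Lemma weight_moment : exists2 A : R, 0 <= A &
  forall (dA : Linfp D -> Linfp D -> R)
    (P : probability (borelType (sum_dist dA (@L2_dist R d D))) R)
    (Pa : probability (borelType dA) R)
    (Pf : probability (borelType (@L2_dist R d D)) R),
  coefficient_metric dA -> is_product P Pa Pf ->
  lognormal (mean_class r_m) (matern_class s_max rho_min k_max (d:=d)) Pa ->
  (\int[Pf]_f (L2_norm D f `^ (2 * p))%:E <= r_f%:E)%E ->
  (\int[P]_z (weight z `^ (2 * p))%:E <= A%:E)%E.
Proof.
have q0 : 0 < 3 * (2 * p) by rewrite !mulr_gt0// (lt_le_trans ltr01).
have [K KP] := @lognormal_moment R d D r_m s_max k_max rho_min rho_min_gt0 _ q0.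
exists `|K * (2 `^ (2 * p) * (1 + r_f))| => // dA P Pa Pf mA PE La Pr.
pose g (a : Linfp D) := expR (3 * (2 * p) * lognorm a).
pose h (f : L2 D) := (1 + norm2 mu f) `^ (2 * p).
have mg : measurable_fun setT (g : borelType dA -> R).
  apply: measurableT_comp => //; apply: measurable_funM.
    exact: measurable_cst.
  exact: measurable_lognorm.
have mh : measurable_fun setT (h : borelType (@L2_dist R d D) -> R).
  apply: (measurableT_comp (measurable_powR (2 * p))).
  by apply: measurable_funD; [exact: measurable_cst|exact: measurable_norm2_L2].
have g0 a : 0 <= g a by exact: expR_ge0.
have h0 f : 0 <= h f by exact: powR_ge0.
have I := integral_product (coefficient_pseudometric mA) (pseudometric_L2 D)
  PE mg mh g0 h0.
rewrite [X in (X <= _)%E](_ : _ = \int[P]_z (g z.1 * h z.2)%:E)%E; last first.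
  apply: eq_integral => z _; rewrite /weight powRM ?expR_ge0//.
    by rewrite -expRM mulrAC.
  by rewrite addr_ge0// norm2_ge0.
rewrite I; apply: (@le_trans _ _ (K%:E * (2 `^ (2 * p) * (1 + r_f))%:E)%E).
  apply: lee_pmul.
  - by apply: integral_ge0 => a _; rewrite lee_fin.
  - by apply: integral_ge0 => f _; rewrite lee_fin.
  - exact: KP.
  - exact: rhs_moment.
by rewrite -EFinM lee_fin ler_norm.
Qed.

End main.

Theorem corollary3p10 (R : realType) (d : nat) (hd : d = 2%N \/ d = 3%N)
  (D : bounded_lipschitz_domain R d)
  (p r_m s_max : R) (k_max : nat) (rho_min r_f : R)
  (p_ge1 : 1 <= p) (rho_min_gt0 : 0 < rho_min) :
  exists C : R,
  forall dA : Linfp D -> Linfp D -> R,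
  dA = @Linfp_logdist R d D \/ dA = @Linfp_dist R d D ->
  let dX := sum_dist dA (@L2_dist R d D) in
  let dV := @H10_dist R d D in
  let S : borelType dX -> borelType dV := @solution_operator R d D in
  forall (P Q : probability (borelType dX) R)
    (P_a Q_a : probability (borelType dA) R)
    (P_f Q_f : probability (borelType (@L2_dist R d D)) R),
  is_product P P_a P_f -> is_product Q Q_a Q_f ->
  lognormal (mean_class r_m) (matern_class s_max rho_min k_max (d:=d)) P_a ->
  lognormal (mean_class r_m) (matern_class s_max rho_min k_max (d:=d)) Q_a ->
  (\int[P_f]_f (L2_norm D f `^ (2 * p))%:E <= r_f%:E)%E ->
  (\int[Q_f]_f (L2_norm D f `^ (2 * p))%:E <= r_f%:E)%E ->
  (wasserstein (dist := dV) p (pushforward P S) (pushforward Q S)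
     <= C%:E * wasserstein (dist := dX) (2 * p) P Q)%E.
Proof.
have [i0] : exists i0 : 'I_d, true.
  by case: hd D => ->; exists ord0.
move=> _; have [K K0 KP] := solution_lipschitz D i0.
have [A A0 AP] := weight_moment D r_m s_max k_max r_f p_ge1 rho_min_gt0.
have p0 : 0 < p by exact: lt_le_trans ltr01 p_ge1.
exists (weighted_constant K p A) => dA dAE dX dV S P Q Pa Qa Pf Qf Pp Qp LP LQ MP MQ.
have mA : coefficient_metric dA.
  by case: dAE => ->; [exact: coefficient_metric_logdist|exact: coefficient_metric_dist].
have mX := pseudometric_sum (coefficient_pseudometric mA) (pseudometric_L2 D).
have mw : measurable_fun setT (@weight R d D : borelType dX -> R).
  apply: measurable_funM.
    apply: measurableT_comp => //; apply: measurable_funM; first exact: measurable_cst.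
    apply: (measurableT_comp (measurable_lognorm mA)).
    exact: (measurable_sum_dist_fst (pseudometric_L2 D)).
  apply: measurable_funD; first exact: measurable_cst.
  apply: (measurableT_comp (@measurable_norm2_L2 R d D)).
  exact: (measurable_sum_dist_snd (coefficient_pseudometric mA)).
apply: (@wasserstein_weighted_lipschitz R _ _ dX dV mX (pseudometric_H10 D) S
  (@weight R d D)) => //.
- by move=> z e e0; exact: solution_operator_continuous.
- exact: weight_ge0.
- exact: KP.
- exact: (AP dA P Pa Pf).
- exact: (AP dA Q Qa Qf).
Qed.
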